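(* (1) Let $q > 1$. Then \[ \| f \|_{\mathcal{B}} \leq \| f \|_{B^q, 1} \quad \text{and} \quad \| f \|_{\mathcal{B}} \leq 2^{\frac{q - 1}{q}} \| f \|_{B^q, 2}, \quad \forall f \in B^q. \] Moreover, if equality is attained by $f \in B^q$ in any of these two inequalities, then $f$ must be of one of the following forms: \[ f_0 (z) = \alpha z + \beta, \qquad f_\zeta (z) = \gamma\, \frac{1 - |\zeta |^2}{\overline{\zeta}}\, \frac{1}{1 - \overline{\zeta} z} + \delta \quad (0 < |\zeta | < 1), \] for some constants $\alpha, \beta, \gamma, \delta \in \mathbb{C}$ (and some $\zeta$ with $0<|\zeta|<1$ in the second case). (2) The following inequality is sharp (i.e. the constant $2$ cannot be replaced by a smaller one): \[ \| f \|_{\mathcal{B}} \leq 2 \| f \|_{B^1}, \quad \forall f \in B^1. \] Moreover, equality is attained only if $f \equiv 0$.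
   Context: $\mathbb{D}$ is the open unit disk of $\mathbb{C}$, and $dA(z) = \frac{1}{\pi}\,dx\,dy$ is the normalized area measure on $\mathbb{D}$. Bloch space: for $f$ analytic in $\mathbb{D}$, $\rho_{\mathcal{B}}(f) := \sup_{z\in\mathbb{D}} |f'(z)|(1-|z|^2)$; $\mathcal{B}$ is the set of analytic $f$ in $\mathbb{D}$ with $\rho_{\mathcal{B}}(f)<\infty$, normed by $\|f\|_{\mathcal{B}} := |f(0)| + \rho_{\mathcal{B}}(f)$. Besov spaces, $q>1$: put $\|g\|_{A^q_{q-2}} := \left( (q-1)\int_{\mathbb{D}} |g(z)|^q (1-|z|^2)^{q-2}\, dA(z)\right)^{1/q}$. $B^q$ is the set of analytic $f$ in $\mathbb{D}$ with $\|f'\|_{A^q_{q-2}}<\infty$. The two norms are $\|f\|_{B^q,1} := |f(0)| + \|f'\|_{A^q_{q-2}}$ and $\|f\|_{B^q,2} := \left(|f(0)|^q + \|f'\|_{A^q_{q-2}}^q\right)^{1/q}$. Besov space, $q=1$: for $a\in\mathbb{D}$ let $\varphi_a(z) := \frac{a-z}{1-\overline{a}z}$. $B^1$ is the set of all functions $f$ of the form $f(z) = \sum_{k=1}^\infty b_k \varphi_{a_k}(z)$, $z\in\mathbb{D}$, for some $\{a_k\}_{k\ge 1}\subset\mathbb{D}$ and $\{b_k\}_{k\ge1}\in\ell^1$, and $\|f\|_{B^1} := \inf \|\{b_k\}_{k\geq 1}\|_{\ell^1}$, the infimum being over all such representations of $f$. *)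

(* Defs.v *)
From HB Require Import structures.
From mathcomp Require Import all_boot all_order all_algebra.
From mathcomp Require Import complex.
From mathcomp Require Import all_classical all_reals all_analysis.
Set Implicit Arguments.
Unset Strict Implicit.
Unset Printing Implicit Defensive.
Import Order.TTheory GRing.Theory Num.Theory.
Import numFieldNormedType.Exports.

Local Open Scope classical_set_scope.
Local Open Scope ring_scope.
Local Open Scope complex_scope.

HB.instance Definition _ (R : realType) := NormedModule.copy R[i] R[i]^o.

(* Functions on the disk are represented by total functions [R[i] -> R[i]], of
   which only the values on [disk] matter; norms take values in [\bar R], and
   are [+oo] when the defining quantity is infinite.  [derive1] is the complex
   derivative, since the base field of the domain [R[i]] is [R[i]] itself. *)

Section Defs.
Variable R : realType.
Implicit Types (f g : R[i] -> R[i]) (z w : R[i]) (q : R).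

(* [`|z|] has type [R[i]]; this is the modulus as an element of [R]. *)
Definition cmod z : R := complex.Re `|z|.

Definition disk : set R[i] := [set z | cmod z < 1].

Definition analytic_disk f : Prop :=
  forall z, disk z -> derivable f z 1.

Definition bloch_seminorm f : \bar R :=
  ereal_sup [set (cmod (derive1 f z) * (1 - cmod z ^+ 2))%:E | z in disk].

Definition in_bloch f : Prop :=
  analytic_disk f /\ (bloch_seminorm f < +oo)%E.

Definition bloch_norm f : \bar R := ((cmod (f 0))%:E + bloch_seminorm f)%E.

(* Integral over the disk against the normalized area measure [dx dy / pi]. *)
Definition disk_integral (u : R[i] -> R) : \bar R :=
  (pi^-1%:E * \int[(@lebesgue_measure R) \x (@lebesgue_measure R)]_(p in
     [set p : R * R | disk (p.1 +i* p.2)]) (u (p.1 +i* p.2))%:E)%E.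

Definition bergman_norm q g : \bar R :=
  (((q - 1)%:E * disk_integral (fun z =>
      (cmod (g z) `^ q * (1 - cmod z ^+ 2) `^ (q - 2))%R)) `^ q^-1)%E.

Definition in_besov q f : Prop :=
  analytic_disk f /\ (bergman_norm q (derive1 f) < +oo)%E.

Definition besov_norm1 q f : \bar R :=
  ((cmod (f 0))%:E + bergman_norm q (derive1 f))%E.

Definition besov_norm2 q f : \bar R :=
  (((cmod (f 0))%:E `^ q + bergman_norm q (derive1 f) `^ q) `^ q^-1)%E.

Definition moebius (a z : R[i]) : R[i] := (a - z) / (1 - a^* * z).

Definition l1_norm (b : nat -> R[i]) : \bar R :=
  (\sum_(0 <= k <oo) (cmod (b k))%:E)%E.

(* The sum over [k >= 1] is indexed from 0. *)
Definition besov1_repr f (a b : nat -> R[i]) : Prop :=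
  [/\ forall k, disk (a k),
      (l1_norm b < +oo)%E &
      forall z, disk z ->
        series (fun k => b k * moebius (a k) z) @ \oo --> f z].

Definition in_besov1 f : Prop := exists a b, besov1_repr f a b.

Definition besov1_norm f : \bar R :=
  ereal_inf [set t | exists a b, besov1_repr f a b /\ t = l1_norm b].

End Defs.

(* Main.v *)
(* For g = f' analytic and |a| < 1, compare g with k = lam phi_a', where lam is
   chosen so that k(a) = g(a).  The tangent line inequality
     |g|^q >= |k|^q + q |k|^(q-2) Re (conj k (g - k)),
   strict unless g = k, is integrated against (1-|z|^2)^(q-2) over the
   pseudo-hyperbolic disc |phi_a| < r.  There |phi_a'| (1-|z|^2) = 1-|phi_a|^2,
   so the first term is explicit, and the linear term has the form
   Re (h conj(phi_a')) F(|phi_a|) with h analytic and h(a) = 0; it integrates to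
   0 by Green's formula on the Euclidean disc |phi_a| < r, on whose boundary a
   suitable primitive of F vanishes.  As r -> 1 this gives
   |g(a)| (1-|a|^2) <= ||g||, with equality only for g = k.  The same estimate
   with r = 1/2 and the tail of a convergent integral show that
   |g(a)| (1-|a|^2) -> 0 as |a| -> 1, so the Bloch seminorm is attained and
   equality in (1) forces f' = lam phi_a'.

   For q = 1 the bounds |phi_a| <= 1 and |phi_a'| (1-|z|^2) <= 1 give
   |f| <= ||f|| and the seminorm bound; equality forces |f(0)| = max |f|, so f is
   constant and has seminorm 0.  Sharpness is seen on phi_t with t -> 1. *)
Require Import Defs.
From HB Require Import structures.
From mathcomp Require Import all_boot all_order all_algebra.
From mathcomp Require Import complex.
From mathcomp Require Import all_classical all_reals all_analysis.
From mathcomp Require Import measurable_realfun.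
From mathcomp Require Import ring lra.
Import Order.TTheory GRing.Theory Num.Theory.
Import numFieldNormedType.Exports.
Local Open Scope classical_set_scope.
Local Open Scope ring_scope.
Local Open Scope complex_scope.
Set Implicit Arguments.
Unset Strict Implicit.
Unset Printing Implicit Defensive.

Local Notation Re := complex.Re.
Local Notation Im := complex.Im.

(** Cauchy's theory is developed up to one fact: the derivative of a complex differentiable function
    is again differentiable. It makes [f'] admissible as [g] and controls [h''] near [a], where the
    function put into Green's formula, [(h / phi_a) G(|phi_a|^2)], divides by zero. Its derivatives
    stay bounded there if [h a = 0] or if [G 0 = 0]; both cases occur. Since [G] vanishes on the
    circle, Green's formula reduces to the fundamental theorem of calculus on chords, without a
    boundary integral. The explicit first term needs no change of variables in the plane. With [G]
    vanishing at 0 and at [r^2], Green's formula replaces the weight [(1 - |phi_a|^2)^(q-2)] by a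
    constant; orthogonality with exponent 0 and the mean value property at the Euclidean centre then
    give the area [pi r^2]. The factor [2^((q-1)/q)] is Hölder's constant for a sum of two terms, so
    the second inequality of (1) factors through the first and has no further equality cases. The
    point [a] where the seminorm is attained decides the extremal form: [a = 0] gives the affine
    one, any other [a] gives [zeta = a]. *)

Lemma is_deriveP (K : numFieldType) (h : K^o -> K^o) (z d : K^o) : is_derive z (1 : K^o) h d <->
  forall e : K, 0 < e -> exists2 x : K, 0 < x & forall w : K^o, `|w - z| < x ->
     `|h w - h z - d * (w - z)| <= e * `|w - z|.
Proof.
have key : (fun k : K^o => k^-1 *: ((h \o shift z) (k *: 1) - h z)) @ 0^' --> d <->
  forall e : K, 0 < e -> exists2 x : K, 0 < x & forall w : K^o, `|w - z| < x ->
     `|h w - h z - d * (w - z)| <= e * `|w - z|.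
  split=> [/cvgrPdist_le cv e e0|H].
    have /cv := e0; rewrite near_withinE => /nbhs_ballP[x /= x0 xP]; exists x => // w wz.
    have [->|wnz] := eqVneq w z; first by rewrite !subrr mulr0 subr0 normr0 mulr0.
    have wz0 : w - z != 0 by rewrite subr_eq0.
    have := xP (w - z); rewrite -ball_normE/= sub0r normrN => /(_ wz wz0).
    rewrite [(w - z) *: 1]mulr1 subrK => {}H.
    have -> : h w - h z - d * (w - z) = - ((d - (w - z)^-1 * (h w - h z)) * (w - z)).
      by rewrite mulrBl mulrAC mulVf// mul1r opprB.
    by rewrite normrN normrM ler_wpM2r.
  apply/cvgrPdist_le => e e0; have [x x0 xP] := H _ e0.
  rewrite near_withinE; apply/nbhs_ballP; exists x => // k.
  rewrite -ball_normE/= sub0r normrN [k *: 1]mulr1 => kx kn0.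
  have := xP (k + z); rewrite addrK => /(_ kx) le1.
  have k0 : 0 < `|k| by rewrite normr_gt0.
  rewrite -(ler_pM2r k0) -normrM mulrBl -[_ *: _ * k]/(_ * _ * k) mulrAC mulVf// mul1r.
  by rewrite distrC.
split=> [[dv Dd]|/key cv]; first by apply/key; rewrite -Dd; exact: dv.
by split; [apply/cvg_ex; exists d|exact: (cvg_lim _ cv)].
Qed.

(** * Modulus, complex differentiability and continuity with real epsilons *)

Section ComplexPlane.
Variable R : realType.
Implicit Types (f g : R[i] -> R[i]) (z w d : R[i]) (x y : R).

Lemma normcE_cmod z : `|z| = (cmod z)%:C.
Proof. by rewrite /cmod normc_def. Qed.

Lemma cmod_ge0 z : 0 <= cmod z.
Proof. by rewrite -ler0c -normcE_cmod. Qed.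

Lemma cmodE z : cmod z = Num.sqrt (Re z ^+ 2 + Im z ^+ 2).
Proof. by rewrite /cmod normc_def. Qed.

Lemma sqr_cmod z : cmod z ^+ 2 = Re z ^+ 2 + Im z ^+ 2.
Proof. by rewrite cmodE sqr_sqrtr// addr_ge0// sqr_ge0. Qed.

Lemma cmodM z w : cmod (z * w) = cmod z * cmod w.
Proof. by apply: complexI; rewrite rmorphM/= -!normcE_cmod normrM. Qed.

Lemma cmodV z : cmod z^-1 = (cmod z)^-1.
Proof. by apply: complexI; rewrite fmorphV/= -!normcE_cmod normfV. Qed.

Lemma cmodN z : cmod (- z) = cmod z.
Proof. by rewrite /cmod normrN. Qed.

Lemma cmodB z w : cmod (z - w) = cmod (w - z).
Proof. by rewrite -cmodN opprB. Qed.

Lemma cmodJ z : cmod z^* = cmod z.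
Proof. by rewrite /cmod normcJ. Qed.

Lemma cmodX z n : cmod (z ^+ n) = cmod z ^+ n.
Proof. by apply: complexI; rewrite rmorphXn/= -!normcE_cmod normrX. Qed.

Lemma cmod0 : cmod (0 : R[i]) = 0.
Proof. by rewrite /cmod normr0. Qed.

Lemma cmod1 : cmod (1 : R[i]) = 1.
Proof. by rewrite /cmod normr1. Qed.

Lemma cmod_real x : cmod x%:C = `|x|.
Proof. by rewrite cmodE/= expr0n addr0 sqrtr_sqr. Qed.

Lemma cmod_eq0 z : (cmod z == 0) = (z == 0).
Proof. by rewrite -(inj_eq (@complexI R)) -normcE_cmod normr_eq0. Qed.

Lemma cmod_gt0 z : (0 < cmod z) = (z != 0).
Proof. by rewrite lt_neqAle cmod_ge0 andbT eq_sym cmod_eq0. Qed.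

Lemma cmodD z w : cmod (z + w) <= cmod z + cmod w.
Proof. by rewrite -lecR rmorphD/= -!normcE_cmod ler_normD. Qed.

Lemma cmod_subD z w t : cmod (z - w) <= cmod (z - t) + cmod (t - w).
Proof. by have := cmodD (z - t) (t - w); rewrite addrA subrK. Qed.

Lemma cmodBD z w : cmod (z - w) <= cmod z + cmod w.
Proof. by rewrite -(cmodN w) cmodD. Qed.

Lemma cmod_sub_ge z w : cmod z - cmod w <= cmod (z - w).
Proof. by rewrite lerBlDr; have := cmodD (z - w) w; rewrite subrK. Qed.

Lemma Re_cmod z : `|Re z| <= cmod z.
Proof. by rewrite cmodE -sqrtr_sqr ler_wsqrtr// lerDl sqr_ge0. Qed.

Lemma Im_cmod z : `|Im z| <= cmod z.
Proof. by rewrite cmodE -sqrtr_sqr ler_wsqrtr// lerDr sqr_ge0. Qed.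

Lemma cmod_ReIm z : cmod z <= `|Re z| + `|Im z|.
Proof.
rewrite -(ler_pXn2r (_ : 0 < 2)%N) ?nnegrE ?cmod_ge0 ?addr_ge0//.
rewrite sqr_cmod -[Re z ^+ 2]real_normK ?num_real//.
rewrite -[Im z ^+ 2]real_normK ?num_real//.
by rewrite sqrrD lerD2r lerDl mulrn_wge0// mulr_ge0.
Qed.

Lemma ReD z w : Re (z + w) = Re z + Re w.
Proof. by case: z; case: w. Qed.
Lemma ImD z w : Im (z + w) = Im z + Im w.
Proof. by case: z; case: w. Qed.
Lemma ReB z w : Re (z - w) = Re z - Re w.
Proof. by case: z; case: w. Qed.
Lemma ImB z w : Im (z - w) = Im z - Im w.
Proof. by case: z; case: w. Qed.
Lemma ReM z w : Re (z * w) =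
  Re z * Re w - Im z * Im w.
Proof. by case: z; case: w. Qed.
Lemma ImM z w : Im (z * w) =
  Re z * Im w + Im z * Re w.
Proof. by case: z => a b; case: w => c e /=; ring. Qed.
Lemma ReMr z x : Re (z * x%:C) = Re z * x.
Proof. by rewrite ReM/= mulr0 subr0. Qed.
Lemma ImMr z x : Im (z * x%:C) = Im z * x.
Proof. by rewrite ImM/= mulr0 add0r. Qed.
Lemma ReJ z : Re z^* = Re z. Proof. by case: z. Qed.
Lemma ImJ z : Im z^* = - Im z. Proof. by case: z. Qed.

Lemma cplxE z : z = Re z +i* Im z.
Proof. by case: z. Qed.

Lemma cplx_eq z w : Re z = Re w ->
  Im z = Im w -> z = w.
Proof. by case: z => ? ?; case: w => ? ? /= -> ->. Qed.

Lemma mulcJ z : z * z^* = (cmod z ^+ 2)%:C.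
Proof. by rewrite rmorphXn/= -normcE_cmod sqr_normc. Qed.

Lemma real_pos_cplx (e : R[i]) : 0 < e -> e = (Re e)%:C /\ 0 < Re e.
Proof. by case: e => a b; rewrite ltcE/= => /andP[/eqP-> ?]. Qed.

Lemma cball_cmod z w x : ball z x%:C w <-> cmod (w - z) < x.
Proof. by rewrite -ball_normE/= normcE_cmod ltcR cmodB. Qed.

Lemma nbhs_cmodP z (A : set R[i]) :
  nbhs z A <-> exists2 x, 0 < x & forall w, cmod (w - z) < x -> A w.
Proof.
split=> [/nbhs_ballP[e /= e0 eA]|[x x0 xA]].
  have [eE e1] := real_pos_cplx e0; exists (Re e) => // w we; apply: eA.
  by rewrite eE; apply/cball_cmod.
by apply/nbhs_ballP; exists x%:C; rewrite /= ?ltcR// => w /cball_cmod/xA.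
Qed.

Definition cdiff f z d := is_derive (z : R[i]) (1 : R[i]) f d.

Lemma cdiffP f z d : cdiff f z d <->
  forall e, 0 < e -> exists2 x, 0 < x & forall w, cmod (w - z) < x ->
     cmod (f w - f z - d * (w - z)) <= e * cmod (w - z).
Proof.
split=> [/(is_deriveP (K := R[i]))H e e0|H].
  have [|x /real_pos_cplx[-> x0] xP] := H e%:C; first by rewrite ltcR.
  exists (Re x) => // w wx; have := xP w.
  by rewrite !normcE_cmod ltcR -rmorphM/= lecR; apply.
apply/(is_deriveP (K := R[i])) => e /real_pos_cplx[-> e0]; have [x x0 xP] := H _ e0.
exists x%:C; first by rewrite ltcR.
by move=> w; rewrite !normcE_cmod ltcR -rmorphM/= lecR; exact: xP.
Qed.

Lemma cdiff_derivable f z d : cdiff f z d -> derivable f z 1.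
Proof. by case. Qed.

Lemma cdiff_derive1 f z d : cdiff f z d -> derive1 f z = d.
Proof. by case=> _ <-; rewrite derive1E. Qed.

Lemma derivable_cdiff f z : derivable f z 1 -> cdiff f z (derive1 f z).
Proof. by move=> fz; rewrite derive1E; exact: (DeriveDef fz erefl). Qed.

Lemma cdiff_uniq f z d1 d2 : cdiff f z d1 -> cdiff f z d2 -> d1 = d2.
Proof. by move=> /cdiff_derive1 <- /cdiff_derive1 <-. Qed.

Lemma cdiff_eq f z d1 d2 : cdiff f z d1 -> d1 = d2 -> cdiff f z d2.
Proof. by move=> ? <-. Qed.

Lemma cdiff_near f g z d x : 0 < x -> (forall w, cmod (w - z) < x -> f w = g w) ->
  cdiff f z d -> cdiff g z d.
Proof.
move=> x0 fg /cdiffP H; apply/cdiffP => e e0.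
have [y y0 yP] := H _ e0; exists (Num.min x y); first by rewrite lt_min x0.
move=> w; rewrite lt_min => /andP[wx wy].
by rewrite -!fg ?subrr ?cmod0//; exact: yP.
Qed.

Lemma cdiff_cst c z : cdiff (fun _ => c) z 0.
Proof.
apply/cdiffP => e e0; exists 1 => // w _.
by rewrite subrr mul0r subr0 cmod0 mulr_ge0 ?cmod_ge0// ltW.
Qed.

Lemma cdiff_id z : cdiff id z 1.
Proof.
apply/cdiffP => e e0; exists 1 => // w _.
by rewrite mul1r subrr cmod0 mulr_ge0 ?cmod_ge0// ltW.
Qed.

Lemma cdiffD f g z d1 d2 : cdiff f z d1 -> cdiff g z d2 ->
  cdiff (fun w => f w + g w) z (d1 + d2).
Proof. by move=> h1 h2; exact: is_deriveD. Qed.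

Lemma cdiffN f z d : cdiff f z d -> cdiff (fun w => - f w) z (- d).
Proof. by move=> h1; exact: is_deriveN. Qed.

Lemma cdiffB f g z d1 d2 : cdiff f z d1 -> cdiff g z d2 ->
  cdiff (fun w => f w - g w) z (d1 - d2).
Proof. by move=> h1 h2; exact: is_deriveB. Qed.

Lemma cdiffM f g z d1 d2 : cdiff f z d1 -> cdiff g z d2 ->
  cdiff (fun w => f w * g w) z (f z * d2 + g z * d1).
Proof. by move=> h1 h2; exact: is_deriveM. Qed.

Lemma cdiff_cmul c f z d : cdiff f z d -> cdiff (fun w => c * f w) z (c * d).
Proof.
move=> h; apply: (cdiff_eq (cdiffM (cdiff_cst c z) h)).
by rewrite mulr0 addr0.
Qed.

Lemma ccontP f z : {for z, continuous f} <-> forall e, 0 < e ->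
  exists2 x, 0 < x & forall w, cmod (w - z) < x -> cmod (f w - f z) < e.
Proof.
split=> [cf e e0|H A /nbhs_cmodP[e e0 eA]].
  by have /nbhs_cmodP := cf [set w | cmod (w - f z) < e]
    ((nbhs_cmodP _ _).2 (ex_intro2 _ _ e e0 (fun _ => id))).
have [x x0 xP] := H _ e0.
by apply/nbhs_cmodP; exists x => // w /xP/eA.
Qed.

Lemma rcontP (u : R[i] -> R) z : {for z, continuous u} <-> forall e, 0 < e ->
  exists2 x, 0 < x & forall w, cmod (w - z) < x -> `|u w - u z| < e.
Proof.
split=> [cf e e0|H A /nbhs_ballP[e /= e0 eA]].
  have /nbhs_cmodP[x x0 xP] := cf _ (nbhsx_ballx (u z) e e0).
  by exists x => // w /xP; rewrite /= distrC.
have [x x0 xP] := H _ e0.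
by apply/nbhs_cmodP; exists x => // w /xP wx; apply: eA; rewrite /ball/= distrC.
Qed.

Lemma cdiff_cont f z d : cdiff f z d -> {for z, continuous f}.
Proof.
move=> /cdiffP H; apply/ccontP => e e0.
have [x x0 xP] := H _ ltr01.
pose k := 1 + cmod d; have k0 : 0 < k by rewrite ltr_pwDl// cmod_ge0.
exists (Num.min x (e / k)); first by rewrite lt_min x0 divr_gt0.
move=> w; rewrite lt_min => /andP[wx]; rewrite ltr_pdivlMr// => we.
apply: le_lt_trans we.
have -> : f w - f z = (f w - f z - d * (w - z)) + d * (w - z) by rewrite subrK.
apply: (le_trans (cmodD _ _)).
by rewrite cmodM /k [leRHS]mulrDr mulr1 [cmod d * _]mulrC lerD2r -[leRHS]mul1r xP.
Qed.

Lemma cdiffV f z d : f z != 0 -> cdiff f z d ->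
  cdiff (fun w => (f w)^-1) z (- (d / f z ^+ 2)).
Proof.
move=> fz h; have [dv <-] := h.
apply: DeriveDef; first exact: derivableV.
by rewrite deriveV// [_ *: _]mulrC mulrN.
Qed.

Lemma cdiff_line f a b t d : cdiff f (a + t%:C * b) d ->
  is_derive t 1 (fun s : R => Re (f (a + s%:C * b))) (Re (b * d)) /\
  is_derive t 1 (fun s : R => Im (f (a + s%:C * b))) (Im (b * d)).
Proof.
move=> /cdiffP H.
have key : forall e, 0 < e -> exists2 x, 0 < x & forall s, `|s - t| < x ->
   cmod (f (a + s%:C * b) - f (a + t%:C * b) - b * d * (s - t)%:C) <= e * `|s - t|.
  move=> e e0.
  pose k := 1 + cmod b; have k0 : 0 < k by rewrite ltr_pwDl// cmod_ge0.
  have [x x0 xP] := H _ (divr_gt0 e0 k0).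
  exists (x / k); first by rewrite divr_gt0.
  move=> s; rewrite ltr_pdivlMr// => st.
  have E : a + s%:C * b - (a + t%:C * b) = (s - t)%:C * b.
    by rewrite rmorphB/=; ring.
  have wE : cmod (a + s%:C * b - (a + t%:C * b)) = `|s - t| * cmod b.
    by rewrite E cmodM cmod_real.
  have bk : `|s - t| * cmod b <= `|s - t| * k by rewrite ler_wpM2l// /k lerDr.
  have := xP (a + s%:C * b); rewrite wE => /(_ (le_lt_trans bk st)).
  rewrite E => H1.
  have -> : b * d * (s - t)%:C = d * ((s - t)%:C * b) by ring.
  apply: le_trans H1 _.
  by rewrite -mulrA ler_wpM2l ?(ltW e0)// mulrC -ler_pdivlMr ?invr_gt0// invrK.
split; apply/(is_deriveP (K := R)) => e e0; have [x x0 xP] := key _ e0; exists x => // s /xP.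
- apply: le_trans; apply: le_trans (Re_cmod _).
  by rewrite !ReB ReMr.
- apply: le_trans; apply: le_trans (Im_cmod _).
  by rewrite !ImB ImMr.
Qed.

Lemma cdiff_partialx f x y d : cdiff f (x +i* y) d ->
  is_derive x 1 (fun s : R => Re (f (s +i* y))) (Re d) /\
  is_derive x 1 (fun s : R => Im (f (s +i* y))) (Im d).
Proof.
have E s : (0 +i* y) + s%:C * 1 = s +i* y by apply: cplx_eq => /=; ring.
rewrite -E => /cdiff_line; rewrite mul1r => -[h1 h2].
by split; [move: h1|move: h2]; congr is_derive; apply/funext => s; rewrite E.
Qed.

(** Along the direction ['i] the derivative is ['i * d]; compared with the horizontal case, this is
    the pair of Cauchy-Riemann equations. *)
Lemma cdiff_partialy f x y d : cdiff f (x +i* y) d ->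
  is_derive y 1 (fun s : R => Re (f (x +i* s))) (- Im d) /\
  is_derive y 1 (fun s : R => Im (f (x +i* s))) (Re d).
Proof.
have E s : x%:C + s%:C * 'i = x +i* s by apply: cplx_eq => /=; ring.
rewrite -E => /cdiff_line; rewrite ReM ImM/= !mul0r !mul1r sub0r add0r => -[h1 h2].
by split; [move: h1|move: h2]; congr is_derive; apply/funext => s; rewrite E.
Qed.

Lemma continuous_cmod : continuous (@cmod R).
Proof.
move=> z; apply/rcontP => e e0; exists e => // w; apply: le_lt_trans.
rewrite ler_norml; apply/andP; split; last exact: cmod_sub_ge.
by rewrite lerNl opprB cmodB cmod_sub_ge.
Qed.

Lemma continuous_Re : continuous (@Re R).
Proof.
move=> z; apply/rcontP => e e0; exists e => // w; apply: le_lt_trans.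
by rewrite -ReB Re_cmod.
Qed.

Lemma continuous_Im : continuous (@Im R).
Proof.
move=> z; apply/rcontP => e e0; exists e => // w; apply: le_lt_trans.
by rewrite -ImB Im_cmod.
Qed.

Definition toC (p : R * R) : R[i] := p.1 +i* p.2.

Lemma continuous_toC : continuous toC.
Proof.
move=> p A /nbhs_cmodP[e e0 eA].
apply/nbhs_ballP; exists (e / 2); first by rewrite /= divr_gt0.
move=> q [/= q1 q2]; apply: eA; apply: le_lt_trans (cmod_ReIm _) _.
rewrite /= [e]splitr; move: q1 q2; rewrite /ball/= => q1 q2.
by rewrite -[`|_ - p.1|]distrC -[`|_ - p.2|]distrC ltrD.
Qed.

Lemma continuous_line (a b : R[i]) : continuous (fun t : R => a + t%:C * b).
Proof.
move=> t A /nbhs_cmodP[e e0 eA].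
have k0 : 0 < 1 + cmod b by rewrite ltr_pwDl// cmod_ge0.
apply/nbhs_ballP; exists (e / (1 + cmod b)); first by rewrite /= divr_gt0.
move=> s; rewrite /ball/= ltr_pdivlMr// => st; apply: eA.
have -> : a + s%:C * b - (a + t%:C * b) = (s - t)%:C * b by rewrite rmorphB/=; ring.
rewrite cmodM cmod_real distrC; apply: le_lt_trans st.
by rewrite ler_wpM2l// lerDr.
Qed.

Lemma continuous_horizontal (y : R) : continuous (fun x : R => x +i* y).
Proof.
have -> : (fun x : R => x +i* y) = (fun x : R => (0 +i* y) + x%:C * 1).
  by apply/funext => s; apply: cplx_eq => /=; ring.
exact: continuous_line.
Qed.

Lemma continuous_vertical (x : R) : continuous (fun y : R => x +i* y).
Proof.
have -> : (fun y : R => x +i* y) = (fun y : R => x%:C + y%:C * 'i).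
  by apply/funext => s; apply: cplx_eq => /=; ring.
exact: continuous_line.
Qed.

Lemma ccontM f g z : {for z, continuous f} -> {for z, continuous g} ->
  {for z, continuous (fun w => f w * g w)}.
Proof. by move=> cf cg; exact: (cvgM cf cg). Qed.

Lemma ccontD f g z : {for z, continuous f} -> {for z, continuous g} ->
  {for z, continuous (fun w => f w + g w)}.
Proof. by move=> cf cg; exact: (cvgD cf cg). Qed.

Lemma ccont_cst c z : {for z, continuous (fun _ : R[i] => c : R[i])}.
Proof. exact: cst_continuous. Qed.

Lemma ccontX f k z : {for z, continuous f} ->
  {for z, continuous (fun w => f w ^+ k)}.
Proof.
move=> cf; elim: k => [|k IH].
  have -> : (fun w => f w ^+ 0) = fun=> 1 by apply/funext => w; rewrite expr0.
  exact: ccont_cst.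
have -> : (fun w => f w ^+ k.+1) = fun w => f w * f w ^+ k by apply/funext => w; rewrite exprS.
exact: ccontM.
Qed.

End ComplexPlane.

(** * Goursat's theorem *)

Section RectangleIntegral.
Variable R : realType.
Implicit Types (f g u : R[i] -> R[i]) (h k : R -> R[i]) (z w a d : R[i]) (x y : R).
Notation mu := (@lebesgue_measure R).

Definition ccontinuous_on h x y := forall t, x <= t <= y -> {for t, continuous h}.

Definition cint h x y : R[i] :=
  (\int[mu]_(t in `[x, y]) Re (h t)) +i*
  (\int[mu]_(t in `[x, y]) Im (h t)).

Lemma rcont_integrable (v : R -> R) x y : (forall t, x <= t <= y -> {for t, continuous v}) ->
  mu.-integrable `[x, y] (EFin \o v).
Proof.
move=> cv; apply: continuous_compact_integrable; first exact: segment_compact.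
by apply: continuous_in_subspaceT => t; rewrite inE/= in_itv/= => /cv.
Qed.

Lemma ccont_integrable h x y : ccontinuous_on h x y ->
  mu.-integrable `[x, y] (EFin \o (fun t => Re (h t))) /\
  mu.-integrable `[x, y] (EFin \o (fun t => Im (h t))).
Proof.
move=> ch; split; apply: rcont_integrable => t xty.
- by apply: continuous_comp; [exact: ch|exact: continuous_Re].
- by apply: continuous_comp; [exact: ch|exact: continuous_Im].
Qed.

Lemma eq_cint h k x y : (forall t, x <= t <= y -> h t = k t) -> cint h x y = cint k x y.
Proof.
move=> hk; rewrite /cint; congr (_ +i* _); apply: eq_Rintegral => t;
  by rewrite inE/= in_itv/= => /hk ->.
Qed.

Lemma cintD h k x y : ccontinuous_on h x y -> ccontinuous_on k x y ->
  cint (fun t => h t + k t) x y = cint h x y + cint k x y.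
Proof.
move=> /ccont_integrable[h1 h2] /ccont_integrable[k1 k2].
rewrite /cint; apply: cplx_eq => /=; rewrite -RintegralD//; apply: eq_Rintegral => t _.
- by rewrite ReD.
- by rewrite ImD.
Qed.

Lemma cintM a h x y : ccontinuous_on h x y ->
  cint (fun t => a * h t) x y = a * cint h x y.
Proof.
move=> /ccont_integrable[h1 h2].
have iZ r v : mu.-integrable `[x, y] (EFin \o v) ->
    mu.-integrable `[x, y] (EFin \o (fun t => r * v t)).
  by move=> iv; refine (integrableZl _ r iv); exact: measurable_itv.
rewrite /cint; apply: cplx_eq; rewrite ?(ReM, ImM)/= -!RintegralZl//.
- rewrite -RintegralB//; [|exact: iZ..]; apply: eq_Rintegral => t _; exact: ReM.
- rewrite -RintegralD//; [|exact: iZ..]; apply: eq_Rintegral => t _; exact: ImM.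
Qed.

Lemma cint_split h x y s : x <= s <= y -> ccontinuous_on h x y ->
  cint h x y = cint h x s + cint h s y.
Proof.
move=> /andP[xs sy] /ccont_integrable[h1 h2].
have key v : mu.-integrable `[x, y] (EFin \o v) ->
    \int[mu]_(t in `[x, y]) v t = \int[mu]_(t in `[x, s]) v t + \int[mu]_(t in `[s, y]) v t.
  move=> iv; have := @Rintegral_itvB _ v (BLeft x) (BRight y) s iv.
  rewrite !bnd_simp => /(_ xs sy) E.
  apply/eqP; rewrite addrC -subr_eq E Rintegral_itv_obnd_cbnd//.
  apply: integrableS iv => //; apply: subset_itvr.
  by rewrite bnd_simp.
by rewrite /cint; apply: cplx_eq => /=; exact: key.
Qed.

Lemma rint_bound (v : R -> R) x y M : x <= y -> mu.-integrable `[x, y] (EFin \o v) ->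
  (forall t, x <= t <= y -> `|v t| <= M) ->
  `| \int[mu]_(t in `[x, y]) v t| <= M * (y - x).
Proof.
move=> xy iv vM; apply: (le_trans (le_normr_Rintegral _ _)) => //.
have -> : M * (y - x) = \int[mu]_(t in `[x, y]) M.
  rewrite Rintegral_cst//= lebesgue_measure_itv/= lte_fin.
  by case: ltP => //= yx; congr (_ * _); apply/eqP; rewrite subr_eq0 eq_le xy yx.
have ic : mu.-integrable `[x, y] (EFin \o fun=> M).
  by apply: rcont_integrable => t _; exact: cst_continuous.
have inv := integrable_norm iv.
by apply: le_Rintegral => // t; rewrite /= in_itv/= => /vM.
Qed.

(** The factor 2 comes from bounding the real and imaginary parts separately; later estimates depend
    only on the order of magnitude. *)
Lemma cint_bound h x y M : x <= y -> ccontinuous_on h x y ->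
  (forall t, x <= t <= y -> cmod (h t) <= M) ->
  cmod (cint h x y) <= 2 * M * (y - x).
Proof.
move=> xy /ccont_integrable[h1 h2] hM; apply: (le_trans (cmod_ReIm _)).
rewrite -mulrA mulr_natl mulr2n; apply: lerD; apply: rint_bound => // t /hM.
- by apply: le_trans; exact: Re_cmod.
- by apply: le_trans; exact: Im_cmod.
Qed.

Lemma Rintegral_FTC (v F : R -> R) x y : x <= y ->
  (forall t : R, x <= t <= y -> is_derive t (1 : R) F (v t)) ->
  (forall t, x <= t <= y -> {for t, continuous v}) ->
  \int[mu]_(t in `[x, y]) v t = F y - F x.
Proof.
rewrite le_eqVlt => /predU1P[->|xy] dF cv.
  by rewrite set_itv1 Rintegral_set1 subrr.
have cF t : x <= t <= y -> {for t, continuous F}.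
  by move=> /dF[dt _]; apply/differentiable_continuous/derivable1_diffP.
have := @continuous_FTC2 R v F x y xy.
rewrite /Rintegral => -> //.
- by apply: continuous_in_subspaceT => t; rewrite inE/= in_itv/= => /cv.
- split => [t||].
  + by rewrite in_itv/= => /andP[/ltW xt /ltW ty]; have [] := dF t (introT andP (conj xt ty)).
  + by apply/cvg_at_right_filter/cF; rewrite lexx ltW.
  + by apply/cvg_at_left_filter/cF; rewrite lexx ltW.
- move=> t; rewrite in_itv/= => /andP[/ltW xt /ltW ty].
  by rewrite derive1E; have [_ ->] := dF t (introT andP (conj xt ty)).
Qed.

Lemma cint_affine a d x y : x <= y ->
  cint (fun t => a + t%:C * d) x y = (y - x)%:C * a + ((y ^+ 2 - x ^+ 2) / 2)%:C * d.
Proof.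
move=> xy.
have key (p q : R) : \int[mu]_(t in `[x, y]) (p + t * q) =
    (y - x) * p + ((y ^+ 2 - x ^+ 2) / 2) * q.
  pose F (t : R) := t * p + t ^+ 2 / 2 * q.
  transitivity (F y - F x); last by rewrite /F; field.
  apply: (@Rintegral_FTC (fun t => p + t * q) F x y xy) => t _.
    by apply: is_derive_eq; rewrite /GRing.scale/=; field.
  by apply: cvgD; [exact: cvg_cst|apply: cvgM; [exact: cvg_id|exact: cvg_cst]].
rewrite /cint; apply: cplx_eq.
- rewrite [LHS]/= (@eq_Rintegral _ _ _ mu _ (fun t : R => Re a + t * Re d)).
    by rewrite key ReD !ReM/= !mul0r !subr0.
  by move=> t _; rewrite ReD ReM/= mul0r subr0.
- rewrite [LHS]/= (@eq_Rintegral _ _ _ mu _ (fun t : R => Im a + t * Im d)).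
    by rewrite key ImD !ImM/= !mul0r !addr0.
  by move=> t _; rewrite ImD ImM/= mul0r addr0.
Qed.

(** The counterclockwise contour integral: bottom minus top side, and right minus left side with
    [dz = 'i dt]. *)
Definition rectint f x1 x2 y1 y2 : R[i] :=
  cint (fun t => f (t +i* y1)) x1 x2 - cint (fun t => f (t +i* y2)) x1 x2
  + 'i * (cint (fun t => f (x2 +i* t)) y1 y2 - cint (fun t => f (x1 +i* t)) y1 y2).

Definition rectbd x1 x2 y1 y2 : set R[i] := [set z |
  (x1 <= Re z <= x2 /\ (Im z = y1 \/ Im z = y2)) \/
  (y1 <= Im z <= y2 /\ (Re z = x1 \/ Re z = x2))].

Definition bdcont f x1 x2 y1 y2 :=
  forall z, rectbd x1 x2 y1 y2 z -> {for z, continuous f}.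

Lemma bdcont_on f x1 x2 y1 y2 : bdcont f x1 x2 y1 y2 ->
  [/\ ccontinuous_on (fun t => f (t +i* y1)) x1 x2,
      ccontinuous_on (fun t => f (t +i* y2)) x1 x2,
      ccontinuous_on (fun t => f (x2 +i* t)) y1 y2 &
      ccontinuous_on (fun t => f (x1 +i* t)) y1 y2].
Proof.
move=> cf; split=> t tP.
- apply: (@continuous_comp _ _ _ (fun t : R => t +i* y1) f).
    exact: continuous_horizontal.
  by apply: cf; left; split => //; left.
- apply: (@continuous_comp _ _ _ (fun t : R => t +i* y2) f).
    exact: continuous_horizontal.
  by apply: cf; left; split => //; right.
- apply: (@continuous_comp _ _ _ (fun t : R => x2 +i* t) f).
    exact: continuous_vertical.
  by apply: cf; right; split => //; right.
- apply: (@continuous_comp _ _ _ (fun t : R => x1 +i* t) f).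
    exact: continuous_vertical.
  by apply: cf; right; split => //; left.
Qed.

Lemma eq_rectint f g x1 x2 y1 y2 : x1 <= x2 -> y1 <= y2 ->
  (forall z, rectbd x1 x2 y1 y2 z -> f z = g z) ->
  rectint f x1 x2 y1 y2 = rectint g x1 x2 y1 y2.
Proof.
move=> x12 y12 fg; rewrite /rectint.
congr (_ - _ + _ * (_ - _)); apply: eq_cint => t tP; apply: fg => /=; by
  [left; split => //; left|left; split => //; right
  |right; split => //; right|right; split => //; left].
Qed.

Lemma rectintD f g x1 x2 y1 y2 : bdcont f x1 x2 y1 y2 -> bdcont g x1 x2 y1 y2 ->
  rectint (fun z => f z + g z) x1 x2 y1 y2 = rectint f x1 x2 y1 y2 + rectint g x1 x2 y1 y2.
Proof.
move=> /bdcont_on[f1 f2 f3 f4] /bdcont_on[g1 g2 g3 g4].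
by rewrite /rectint !cintD//; ring.
Qed.

Lemma rectintM a f x1 x2 y1 y2 : bdcont f x1 x2 y1 y2 ->
  rectint (fun z => a * f z) x1 x2 y1 y2 = a * rectint f x1 x2 y1 y2.
Proof.
move=> /bdcont_on[f1 f2 f3 f4]; by rewrite /rectint !cintM//; ring.
Qed.

Lemma rectint_bound f x1 x2 y1 y2 M : x1 <= x2 -> y1 <= y2 ->
  bdcont f x1 x2 y1 y2 -> (forall z, rectbd x1 x2 y1 y2 z -> cmod (f z) <= M) ->
  cmod (rectint f x1 x2 y1 y2) <= 4 * M * ((x2 - x1) + (y2 - y1)).
Proof.
move=> x12 y12 /bdcont_on[f1 f2 f3 f4] fM; rewrite /rectint.
have -> : 4 * M * ((x2 - x1) + (y2 - y1)) =
  (2 * M * (x2 - x1) + 2 * M * (x2 - x1)) + (2 * M * (y2 - y1) + 2 * M * (y2 - y1)).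
  by ring.
apply: (le_trans (cmodD _ _)); apply: lerD.
  apply: (le_trans (cmodBD _ _)); apply: lerD; apply: cint_bound => // t tP; apply: fM;
  by [left; split => //; left|left; split => //; right].
rewrite cmodM (_ : cmod 'i = 1); last by rewrite cmodE/= expr0n expr1n add0r sqrtr1.
rewrite mul1r; apply: (le_trans (cmodBD _ _)); apply: lerD; apply: cint_bound => // t tP; apply: fM;
  by [right; split => //; right|right; split => //; left].
Qed.

(** Computed side by side. This is the part of a differentiable function that drops out in Goursat's
    argument. *)
Lemma rectint_affine a d x1 x2 y1 y2 : x1 <= x2 -> y1 <= y2 ->
  rectint (fun z => a + z * d) x1 x2 y1 y2 = 0.
Proof.
move=> x12 y12; rewrite /rectint.
have H y : cint (fun t => a + (t +i* y) * d) x1 x2 =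
    (x2 - x1)%:C * (a + (0 +i* y) * d) + ((x2 ^+ 2 - x1 ^+ 2) / 2)%:C * d.
  rewrite -cint_affine//; apply: eq_cint => t _.
  have -> : t +i* y = t%:C + (0 +i* y) by apply: cplx_eq => /=; ring.
  by ring.
have V x : cint (fun t => a + (x +i* t) * d) y1 y2 =
    (y2 - y1)%:C * (a + x%:C * d) + ((y2 ^+ 2 - y1 ^+ 2) / 2)%:C * ('i * d).
  rewrite -cint_affine//; apply: eq_cint => t _.
  have -> : x +i* t = x%:C + t%:C * 'i by apply: cplx_eq => /=; ring.
  by ring.
rewrite !H !V.
have E y : 0 +i* y = y%:C * 'i :> R[i] by apply: cplx_eq => /=; ring.
by rewrite !E !rmorphB/=; ring.
Qed.

(** The common vertical side enters twice with opposite signs, so continuity matters on the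
    horizontal sides, where the integrals are split. *)
Lemma rectint_splitx f x1 x2 x3 y1 y2 : x1 <= x2 <= x3 ->
  (forall z, x1 <= Re z <= x3 -> Im z = y1 \/ Im z = y2 ->
    {for z, continuous f}) ->
  rectint f x1 x3 y1 y2 = rectint f x1 x2 y1 y2 + rectint f x2 x3 y1 y2.
Proof.
move=> x123 cf.
have c1 y : y = y1 \/ y = y2 -> ccontinuous_on (fun t => f (t +i* y)) x1 x3.
  move=> yP t tP; apply: (@continuous_comp _ _ _ (fun t : R => t +i* y) f).
    exact: continuous_horizontal.
  exact: cf.
have H1 := cint_split x123 (c1 y1 (or_introl erefl)).
have H2 := cint_split x123 (c1 y2 (or_intror erefl)).
by rewrite /rectint H1 H2; ring.
Qed.

Lemma rectint_splity f x1 x2 y1 y2 y3 : y1 <= y2 <= y3 ->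
  (forall z, y1 <= Im z <= y3 -> Re z = x1 \/ Re z = x2 ->
    {for z, continuous f}) ->
  rectint f x1 x2 y1 y3 = rectint f x1 x2 y1 y2 + rectint f x1 x2 y2 y3.
Proof.
move=> y123 cf.
have c1 x : x = x1 \/ x = x2 -> ccontinuous_on (fun t => f (x +i* t)) y1 y3.
  move=> xP t tP; apply: (@continuous_comp _ _ _ (fun t : R => x +i* t) f).
    exact: continuous_vertical.
  exact: cf.
have H1 := cint_split y123 (c1 x1 (or_introl erefl)).
have H2 := cint_split y123 (c1 x2 (or_intror erefl)).
by rewrite /rectint H1 H2; ring.
Qed.

End RectangleIntegral.

(** * Goursat's theorem by repeated quartering *)

Section Goursat.
Variable R : realType.
Implicit Types (f g u : R[i] -> R[i]) (z w d : R[i]) (x y : R).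

Lemma nested_intervals (l r : nat -> R) : (forall n, l n <= l n.+1) ->
  (forall n, r n.+1 <= r n) -> (forall n, l n <= r n) ->
  exists c, forall n, l n <= c <= r n.
Proof.
move=> ll rr lr.
have lm : {homo l : m n / (m <= n)%N >-> m <= n} by apply/nondecreasing_seqP.
have rm : {homo r : m n / (m <= n)%N >-> n <= m}.
  exact/nonincreasing_seqP.
have lr2 m n : l m <= r n.
  apply: (le_trans (lm _ _ (leq_maxl m n))).
  apply: (le_trans (lr _)); exact: (rm _ _ (leq_maxr m n)).
exists (sup (range l)) => n; apply/andP; split.
- apply: ub_le_sup; last by exists n.
  by exists (r 0%N) => _ [m _ <-].
- by apply: ge_sup => [|_ [m _ <-]//]; exists (l 0%N), 0%N.
Qed.

Lemma small_pow (c e : R) : 0 < e -> exists n, c / 2 ^+ n < e.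
Proof.
move=> e0.
have /cvgrPdist_lt/(_ e e0)[n _ /(_ n (leqnn n))] : c * (2^-1 ^+ n) @[n --> \oo] --> c * 0.
  by apply: cvgM; [exact: cvg_cst|apply: cvg_expr; rewrite gtr0_norm// invf_lt1// ltr1n].
rewrite /= mulr0 sub0r normrN => H; exists n.
by rewrite -exprVn (le_lt_trans (ler_norm _)).
Qed.

Lemma half_interval_sub (p p' v lo hi : R) : 0 <= v -> lo <= p -> p + v <= hi ->
  p' = p \/ p' = p + v / 2 -> lo <= p' /\ p' + v / 2 <= hi.
Proof. by move=> ? ? ? [->|->]; split; lra. Qed.

Lemma four_quarters (t a1 a2 a3 a4 : R) : t <= a1 + a2 + (a3 + a4) ->
  4 * a1 < t -> 4 * a2 < t -> 4 * a3 < t -> 4 * a4 < t -> False.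
Proof. move=> *; lra. Qed.

(** The integral is the sum of those over the four quarters, so by the triangle inequality one of
    them carries at least a quarter of the modulus. *)
Lemma rectint_cmod_le_quarter f x y (w h : R) : 0 <= w -> 0 <= h ->
  (forall z, x <= Re z <= x + w -> y <= Im z <= y + h ->
     {for z, continuous f}) ->
  exists p : R * R, [/\ (p.1 = x \/ p.1 = x + w / 2), (p.2 = y \/ p.2 = y + h / 2) &
    cmod (rectint f x (x + w) y (y + h)) <=
    4 * cmod (rectint f p.1 (p.1 + w / 2) p.2 (p.2 + h / 2))].
Proof.
move=> w0 h0 cf.
have xw : x <= x + w / 2 <= x + w.
  by apply/andP; split; lra.
have yh : y <= y + h / 2 <= y + h by apply/andP; split; lra.
have xE : x + w = x + w / 2 + w / 2 by field.
have yE : y + h = y + h / 2 + h / 2 by field.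
rewrite (@rectint_splitx _ f x (x + w / 2))//; last first.
  by move=> z zx [] zy; apply: cf => //; rewrite zy lexx ?andbT lerDl.
rewrite (@rectint_splity _ f x _ y (y + h / 2))//; last first.
  move=> z zx [] zy; apply: cf => //; rewrite zy ?lexx /= ?lerDl//; lra.
rewrite (@rectint_splity _ f (x + w / 2) _ y (y + h / 2))//; last first.
  move=> z zx [] zy; apply: cf => //; rewrite zy ?lexx ?lerDl ?andbT//; lra.
rewrite xE yE.
set A := rectint _ _ _ _ _; set B := rectint _ _ _ _ _.
set C := rectint _ _ _ _ _; set D := rectint _ _ _ _ _.
have T : cmod (A + B + (C + D)) <= cmod A + cmod B + (cmod C + cmod D).
  by apply: (le_trans (cmodD _ _)); apply: lerD; exact: cmodD.
have M1 := @four_quarters _ _ _ _ _ T.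
have [?|hA] := leP (cmod (A + B + (C + D))) (4 * cmod A).
  by exists (x, y); split => //; left.
have [?|hB] := leP (cmod (A + B + (C + D))) (4 * cmod B).
  by exists (x, y + h / 2); split => //; [left|right].
have [?|hC] := leP (cmod (A + B + (C + D))) (4 * cmod C).
  by exists (x + w / 2, y); split => //; [right|left].
have [?|hD] := leP (cmod (A + B + (C + D))) (4 * cmod D).
  by exists (x + w / 2, y + h / 2); split => //; right.
by have := M1 hA hB hC hD.
Qed.

(** Quartering yields nested rectangles, smaller by [2^-n], whose integrals have modulus at least
    [4^-n] times the original one. At their common point differentiability makes the integrals small
    compared with [4^-n]. *)
Lemma goursat f x1 x2 y1 y2 : x1 <= x2 -> y1 <= y2 ->
  (forall z, x1 <= Re z <= x2 -> y1 <= Im z <= y2 ->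
    exists d, cdiff f z d) ->
  rectint f x1 x2 y1 y2 = 0.
Proof.
move=> x12 y12 df.
have cf z : x1 <= Re z <= x2 -> y1 <= Im z <= y2 -> {for z, continuous f}.
  by move=> h1 h2; have [d /cdiff_cont] := df z h1 h2.
pose W := x2 - x1; pose H := y2 - y1.
have W0 : 0 <= W by rewrite subr_ge0.
have H0 : 0 <= H by rewrite subr_ge0.
have Wn n : 0 <= W / 2 ^+ n by rewrite divr_ge0// exprn_ge0.
have Hn n : 0 <= H / 2 ^+ n by rewrite divr_ge0// exprn_ge0.
have halfE (c : R) n : c / 2 ^+ n / 2 = c / 2 ^+ n.+1.
  by rewrite exprSr invfM mulrA.
pose inr (n : nat) (p : R * R) := [/\ x1 <= p.1, p.1 + W / 2 ^+ n <= x2, y1 <= p.2 &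
  p.2 + H / 2 ^+ n <= y2].
pose Q (n : nat) (p : R * R) :=
  rectint f p.1 (p.1 + W / 2 ^+ n) p.2 (p.2 + H / 2 ^+ n).
(* [next] is total on pairs of a step number and a lower left corner; the guard [inr] is discharged
   along the sequence [s] in [sin]. *)
have /boolp.choice[next nextP] : forall np : nat * (R * R), exists p : R * R, inr np.1 np.2 ->
   [/\ (p.1 = np.2.1 \/ p.1 = np.2.1 + W / 2 ^+ np.1.+1),
       (p.2 = np.2.2 \/ p.2 = np.2.2 + H / 2 ^+ np.1.+1) &
       cmod (Q np.1 np.2) <= 4 * cmod (Q np.1.+1 p)].
  move=> [n p] /=.
  have [[i1 i2 i3 i4]|ni] := pselect (inr n p); last by exists p.
  have [|p' []] := @rectint_cmod_le_quarter f p.1 p.2 _ _ (Wn n) (Hn n).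
    move=> z /andP[z1 z2] /andP[z3 z4]; apply: cf.
    - by rewrite (le_trans i1)//= (le_trans z2).
    - by rewrite (le_trans i3)//= (le_trans z4).
  by rewrite !halfE => a1 a2 a3; exists p'.
pose s := fix s n := if n is m.+1 then next (m, s m) else (x1, y1).
have sS n : s n.+1 = next (n, s n) by [].
have sin n : inr n (s n).
  elim: n => [|n sn]; first by split; rewrite ?expr0 ?divr1 //= /W /H addrC subrK.
  have /= := nextP (n, s n) sn; move: sn.
  rewrite -!halfE => -[/= i1 i2 i3 i4] [a1 a2 _].
  have [b1 b2] := half_interval_sub (Wn n) i1 i2 a1.
  have [b3 b4] := half_interval_sub (Hn n) i3 i4 a2.
  by rewrite /inr ?sS -!halfE.
have sP n := nextP (n, s n) (sin n).
have smono n : [/\ (s n).1 <= (s n.+1).1, (s n.+1).1 + W / 2 ^+ n.+1 <= (s n).1 + W / 2 ^+ n,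
   (s n).2 <= (s n.+1).2 & (s n.+1).2 + H / 2 ^+ n.+1 <= (s n).2 + H / 2 ^+ n].
  have [/= a1 a2 _] := sP n; move: a1 a2; rewrite -!halfE => a1 a2.
  have [b1 b2] := half_interval_sub (Wn n) (lexx _) (lexx _) a1.
  by have [b3 b4] := half_interval_sub (Hn n) (lexx _) (lexx _) a2.
have [px pxP] : exists a, forall n, (s n).1 <= a <= (s n).1 + W / 2 ^+ n.
  apply: (@nested_intervals (fun n => (s n).1) (fun n => (s n).1 + W / 2 ^+ n)).
  - by move=> n; have [] := smono n.
  - by move=> n; have [] := smono n.
  - by move=> n; rewrite lerDl.
have [py pyP] : exists a, forall n, (s n).2 <= a <= (s n).2 + H / 2 ^+ n.
  apply: (@nested_intervals (fun n => (s n).2) (fun n => (s n).2 + H / 2 ^+ n)).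
  - by move=> n; have [] := smono n.
  - by move=> n; have [] := smono n.
  - by move=> n; rewrite lerDl.
have kQ n : cmod (rectint f x1 x2 y1 y2) <= 4 ^+ n * cmod (Q n (s n)).
  elim: n => [|n IH].
    by rewrite /Q expr0 mul1r /= !divr1 /W /H ![_ + (_ - _)]addrC !subrK.
  apply: (le_trans IH); rewrite exprSr -mulrA ler_wpM2l ?exprn_ge0//.
  by have [] := sP n.
have [p0 p0E] : exists p0 : R[i], p0 = px +i* py by exists (px +i* py).
have [d dfp] : exists d, cdiff f p0 d.
  rewrite p0E.
  have := pxP 0%N; have := pyP 0%N; rewrite /= !divr1 /W /H ![_ + (_ - _)]addrC !subrK.
  by move=> h1 h2; apply: df.
apply/eqP; rewrite -cmod_eq0 eq_le cmod_ge0 andbT.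
apply/ler_addgt0Pr => e e0; rewrite add0r.
(* Once the powers of 2 cancel, the boundary estimate reads [4 (W + H)^2 e / K]. The added 1 keeps
   [K] positive for a degenerate rectangle. *)
pose K := 4 * (W + H) ^+ 2 + 1.
have K0 : 0 < K by rewrite ltr_wpDl// mulr_ge0// sqr_ge0.
have [r r0 rP] := (cdiffP _ _ _).1 dfp _ (divr_gt0 e0 K0).
have [n nr] := small_pow (W + H) r0.
apply: (le_trans (kQ n)).
have [i1 i2 i3 i4] := sin n.
have zin z : rectbd (s n).1 ((s n).1 + W / 2 ^+ n) (s n).2 ((s n).2 + H / 2 ^+ n) z ->
   (s n).1 <= Re z <= (s n).1 + W / 2 ^+ n /\
   (s n).2 <= Im z <= (s n).2 + H / 2 ^+ n.
  have := Wn n; have := Hn n; set w := W / _; set h := H / _ => h0 w0.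
  by case=> -[zx []] ->; split => //; rewrite ?lexx ?lerDl ?w0 ?h0.
(* Removing the affine part of [f] at [p0] leaves the contour integral unchanged and makes the
   integrand small compared with the diameter. *)
pose E z := f z - f p0 - d * (z - p0).
have cE : bdcont E (s n).1 ((s n).1 + W / 2 ^+ n) (s n).2 ((s n).2 + H / 2 ^+ n).
  move=> z /zin[/andP[z1 z2] /andP[z3 z4]].
  have [|| dz dfz] := df z.
  - by rewrite (le_trans i1)//= (le_trans z2).
  - by rewrite (le_trans i3)//= (le_trans z4).
  apply: (@cdiff_cont _ E z (dz - 0 - d * (1 - 0))).
  apply: cdiffB; first by apply: cdiffB => //; exact: cdiff_cst.
  by apply: cdiff_cmul; apply: cdiffB; [exact: cdiff_id|exact: cdiff_cst].
have QE : Q n (s n) = rectint E (s n).1 ((s n).1 + W / 2 ^+ n) (s n).2 ((s n).2 + H / 2 ^+ n).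
  pose A z := (f p0 - d * p0) + z * d.
  have cA : bdcont A (s n).1 ((s n).1 + W / 2 ^+ n) (s n).2 ((s n).2 + H / 2 ^+ n).
    move=> z _; apply: (@cdiff_cont _ A z (0 + (z * 0 + d * 1))).
    by apply: cdiffD; [exact: cdiff_cst|apply: cdiffM; [exact: cdiff_id|exact: cdiff_cst]].
  have lw : (s n).1 <= (s n).1 + W / 2 ^+ n by rewrite lerDl.
  have lh : (s n).2 <= (s n).2 + H / 2 ^+ n by rewrite lerDl.
  have A0 := rectint_affine (f p0 - d * p0) d lw lh.
  have AE := rectintD cA cE.
  transitivity (rectint (fun z => A z + E z) (s n).1 ((s n).1 + W / 2 ^+ n) (s n).2 ((s n).2 + H / 2 ^+ n)).
    by apply: (eq_rectint lw lh) => z _; rewrite /A /E; ring.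
  by rewrite AE A0 add0r.
have Ebd z : rectbd (s n).1 ((s n).1 + W / 2 ^+ n) (s n).2 ((s n).2 + H / 2 ^+ n) z ->
    cmod (E z) <= e / K * ((W + H) / 2 ^+ n).
  move=> /zin[z1 z2]; have pn := pxP n; have qn := pyP n.
  have zp : cmod (z - p0) <= (W + H) / 2 ^+ n.
    apply: (le_trans (cmod_ReIm _)); rewrite ReB ImB p0E/= mulrDl.
    by apply: lerD; rewrite ler_norml; apply/andP; split; lra.
  apply: (le_trans (rP _ _)); first exact: le_lt_trans nr.
  by rewrite ler_wpM2l// divr_ge0// ltW.
rewrite QE.
have E1 := Wn n; have E2 := Hn n.
have := rectint_bound _ _ cE Ebd; rewrite !lerDl => /(_ E1 E2) B1.
have -> : e = 4 ^+ n * (e / 4 ^+ n) by rewrite mulrCA divff ?mulr1// expf_eq0 andbF.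
rewrite ler_wpM2l ?exprn_ge0//; apply: (le_trans B1).
have -> : (4 : R) ^+ n = 2 ^+ n * 2 ^+ n by rewrite -exprMn; congr (_ ^+ _); ring.
set u := 2 ^+ n; have u0 : 0 < u by rewrite exprn_gt0.
have -> : 4 * (e / K * ((W + H) / u)) *
  ((s n).1 + W / u - (s n).1 + ((s n).2 + H / u - (s n).2)) =
  (4 * (W + H) ^+ 2) / K * (e / (u * u)) by field; rewrite !gt_eqF.
rewrite ger_pMl ?divr_gt0 ?mulr_gt0// ler_pdivrMr// mul1r /K; lra.
Qed.

End Goursat.

(** * Cauchy integrals and differentiability of the derivative *)

Section Cauchy.
Variable R : realType.
Implicit Types (f g u : R[i] -> R[i]) (z w d a p : R[i]) (x y : R).
Notation mu := (@lebesgue_measure R).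

(** The left, right, bottom and top strips around the inner rectangle avoid [p]; cut off one after
    the other, each contributes 0 by Goursat's theorem. *)
Lemma goursat_shrink f p x1 x2 y1 y2 x3 x4 y3 y4 :
  x1 <= x3 -> x3 < Re p < x4 -> x4 <= x2 ->
  y1 <= y3 -> y3 < Im p < y4 -> y4 <= y2 ->
  (forall z, x1 <= Re z <= x2 -> y1 <= Im z <= y2 -> z != p ->
    exists d, cdiff f z d) ->
  rectint f x1 x2 y1 y2 = rectint f x3 x4 y3 y4.
Proof.
move=> x13 /andP[x3p px4] x42 y13 /andP[y3p py4] y42 df.
have neR z : Re z != Re p -> z != p by apply: contra => /eqP ->.
have neI z : Im z != Im p -> z != p by apply: contra => /eqP ->.
have cf z : x1 <= Re z <= x2 -> y1 <= Im z <= y2 -> z != p ->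
    {for z, continuous f}.
  by move=> h1 h2 h3; have [d /cdiff_cont] := df z h1 h2 h3.
have x34 := ltW (lt_trans x3p px4); have y34 := ltW (lt_trans y3p py4).
have x32 := le_trans x34 x42; have y32 := le_trans y34 y42.
have x14 := le_trans x13 x34; have y14 := le_trans y13 y34.
have x12 := le_trans x13 x32; have y12 := le_trans y13 y32.
have edge z : x1 <= Re z <= x2 -> Im z = y1 \/ Im z = y2 ->
    {for z, continuous f}.
  move=> zx [] zy; apply: cf; rewrite ?zy ?lexx ?y12//; apply: neI; rewrite zy.
    by rewrite lt_eqF// (le_lt_trans y13).
  by rewrite gt_eqF// (lt_le_trans py4).
have vedge z : y1 <= Im z <= y2 -> Re z = x3 \/ Re z = x4 ->
    {for z, continuous f}.
  move=> zy zx; apply: cf => //; first by case: zx => ->; rewrite ?x13 ?x32 ?x14 ?x42.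
  by apply: neR; case: zx => ->; [rewrite lt_eqF|rewrite gt_eqF].
rewrite (@rectint_splitx _ f x1 x3 x2 y1 y2); [|by rewrite x13|exact: edge].
rewrite (@goursat _ f _ _ _ _ x13 y12) ?add0r; last first.
  move=> z /andP[z1 z2] zy; apply: df => //; first by rewrite z1 (le_trans z2).
  by apply: neR; rewrite lt_eqF// (le_lt_trans z2).
rewrite (@rectint_splitx _ f x3 x4 x2 y1 y2); [|by rewrite x34|]; last first.
  by move=> z /andP[z1 z2]; apply: edge; rewrite z2 (le_trans x13).
rewrite (@goursat _ f _ _ _ _ x42 y12) ?addr0; last first.
  move=> z /andP[z1 z2] zy; apply: df => //; first by rewrite z2 (le_trans x14).
  by apply: neR; rewrite gt_eqF// (lt_le_trans px4).
rewrite (@rectint_splity _ f x3 x4 y1 y3 y2); [|by rewrite y13|exact: vedge].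
rewrite (@goursat _ f _ _ _ _ x34 y13) ?add0r; last first.
  move=> z /andP[z1 z2] /andP[z3 z4]; apply: df.
  - by rewrite (le_trans x13)// (le_trans z2).
  - by rewrite z3 (le_trans z4).
  - by apply: neI; rewrite lt_eqF// (le_lt_trans z4).
rewrite (@rectint_splity _ f x3 x4 y3 y4 y2); [|by rewrite y34|]; last first.
  by move=> z /andP[z1 z2]; apply: vedge; rewrite z2 (le_trans y13).
rewrite (@goursat _ f _ _ _ _ x34 y42) ?addr0; first exact: erefl.
move=> z /andP[z1 z2] /andP[z3 z4]; apply: df.
- by rewrite (le_trans x13)// (le_trans z2).
- by rewrite z4 (le_trans y14).
- by apply: neI; rewrite gt_eqF// (lt_le_trans py4).
Qed.

(** Boundedness near [p] is enough: the contour shrinks to a square about [p] of half-side [s], over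
    which the integral has modulus at most [16 M s]. *)
Lemma goursat_punctured f p M r x1 x2 y1 y2 :
  x1 < Re p < x2 -> y1 < Im p < y2 ->
  (forall z, x1 <= Re z <= x2 -> y1 <= Im z <= y2 -> z != p ->
    exists d, cdiff f z d) ->
  0 < r -> (forall z, z != p -> cmod (z - p) < r -> cmod (f z) <= M) ->
  rectint f x1 x2 y1 y2 = 0.
Proof.
move=> /andP[x1p px2] /andP[y1p py2] df r0 fM.
apply/eqP; rewrite -cmod_eq0 eq_le cmod_ge0 andbT.
apply/ler_addgt0Pr => e e0; rewrite add0r.
set a := Re p in x1p px2; set b := Im p in y1p py2.
pose K := 16 * (`|M| + 1).
have K0 : 0 < K by rewrite mulr_gt0// ltr_wpDl.
have [s [s0 [sx1 sx2 sy1 sy2] sr se]] : exists s, [/\ 0 < s,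
    [/\ x1 <= a - s, a + s <= x2, y1 <= b - s & b + s <= y2], 2 * s < r & s * K <= e].
  pose s := Num.min (Num.min (Num.min (a - x1) (x2 - a)) (Num.min (b - y1) (y2 - b)))
     (Num.min (r / 4) (e / K)).
  have : s <= s by [].
  rewrite {2}/s !le_min => /andP[/andP[/andP[h1 h2] /andP[h3 h4]] /andP[h5 h6]].
  have s0 : 0 < s.
    by rewrite /s !lt_min !subr_gt0 x1p px2 y1p py2 !divr_gt0.
  by exists s; split => //; [split; lra|lra|rewrite -ler_pdivlMr].
have aas : a - s < a < a + s by rewrite gtrBl ltrDl s0.
have bbs : b - s < b < b + s by rewrite gtrBl ltrDl s0.
rewrite (goursat_shrink sx1 aas sx2 sy1 bbs sy2 df).
have [[al ar] [bl br]] := (andP aas, andP bbs).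
have aas' := ltW (lt_trans al ar); have bbs' := ltW (lt_trans bl br).
have neR z : Re z != a -> z != p by apply: contra => /eqP ->.
have neI z : Im z != b -> z != p by apply: contra => /eqP ->.
have zin z : rectbd (a - s) (a + s) (b - s) (b + s) z ->
    [/\ a - s <= Re z <= a + s, b - s <= Im z <= b + s & z != p].
  case=> -[h1 h2]; split => //.
  - by case: h2 => ->; rewrite lexx ?bbs'.
  - by case: h2 => h2; apply: neI; rewrite h2; [rewrite lt_eqF|rewrite gt_eqF].
  - by case: h2 => ->; rewrite lexx ?aas'.
  - by case: h2 => h2; apply: neR; rewrite h2; [rewrite lt_eqF|rewrite gt_eqF].
have := @rectint_bound _ f (a - s) (a + s) (b - s) (b + s) M aas' bbs'.
move=> /(_ _ _)/le_trans; apply.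
- move=> z /zin[/andP[h1 h2] /andP[h3 h4] h5].
  have [||//|d /cdiff_cont//] := df z.
    by rewrite (le_trans sx1)// (le_trans h2).
  by rewrite (le_trans sy1)// (le_trans h4).
- move=> z /zin[h1 h2 h3]; apply: fM => //.
  apply: le_lt_trans (cmod_ReIm _) _; apply: le_lt_trans sr.
  rewrite mulr_natl mulr2n ReB ImB -/a -/b.
  by move: h1 h2; rewrite -!ler_distl => h1 h2; exact: lerD.
- have -> : 4 * M * (a + s - (a - s) + (b + s - (b - s))) = s * (16 * M) by ring.
  apply: le_trans se; rewrite ler_pM2l// /K ler_pM2l//.
  by rewrite (le_trans (ler_norm _))// lerDl.
Qed.

(** Differentiation under the integral sign. The remainder is quadratic in [w - a] uniformly on the
    boundary, so its integral is quadratic too. *)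
Lemma cdiff_rectint_param (ker : R[i] -> R[i] -> R[i]) (dker : R[i] -> R[i])
    a x1 x2 y1 y2 (e C : R) : x1 <= x2 -> y1 <= y2 -> 0 < e -> 0 <= C ->
  (forall w, cmod (w - a) < e -> bdcont (ker w) x1 x2 y1 y2) ->
  bdcont dker x1 x2 y1 y2 ->
  (forall w z, cmod (w - a) < e -> rectbd x1 x2 y1 y2 z ->
     cmod (ker w z - ker a z - dker z * (w - a)) <= C * cmod (w - a) ^+ 2) ->
  cdiff (fun w => rectint (ker w) x1 x2 y1 y2) a (rectint dker x1 x2 y1 y2).
Proof.
move=> x12 y12 e0 C0 cker cdker kerC; apply/cdiffP => eps eps0.
pose K := 4 * C * ((x2 - x1) + (y2 - y1)) + 1.
have K0 : 0 < K by rewrite ltr_wpDl// !mulr_ge0// addr_ge0// subr_ge0.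
exists (Num.min e (eps / K)); first by rewrite lt_min e0 divr_gt0.
move=> w; rewrite lt_min => /andP[we wk].
have ca := cker a; rewrite subrr cmod0 in ca; have {}ca := ca e0.
have cw := cker w we.
have cM c u : bdcont u x1 x2 y1 y2 -> bdcont (fun z => c * u z) x1 x2 y1 y2.
  by move=> cu z /cu; apply: ccontM; exact: ccont_cst.
have c1 := cM (-1) _ ca; have c2 := cM (- (w - a)) _ cdker.
have c3 : bdcont (fun z => -1 * ker a z + - (w - a) * dker z) x1 x2 y1 y2.
  by move=> z zb; apply: ccontD; [exact: c1|exact: c2].
have c4 : bdcont (fun z => ker w z + (-1 * ker a z + - (w - a) * dker z)) x1 x2 y1 y2.
  by move=> z zb; apply: ccontD; [exact: cw|exact: c3].
have E4 := rectintD cw c3; have E3 := rectintD c1 c2.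
have E1 := rectintM (-1) ca; have E2 := rectintM (- (w - a)) cdker.
rewrite E3 E1 E2 in E4.
have -> : rectint (ker w) x1 x2 y1 y2 - rectint (ker a) x1 x2 y1 y2 -
    rectint dker x1 x2 y1 y2 * (w - a) =
    rectint (fun z => ker w z + (-1 * ker a z + - (w - a) * dker z)) x1 x2 y1 y2.
  by rewrite E4; ring.
have B := @rectint_bound _ _ _ _ _ _ (C * cmod (w - a) ^+ 2) x12 y12 c4.
apply: (le_trans (B _)).
  move=> z /(kerC w z we); apply: le_trans.
  by rewrite le_eqVlt; apply/orP; left; apply/eqP; congr cmod; ring.
have -> : 4 * (C * cmod (w - a) ^+ 2) * (x2 - x1 + (y2 - y1)) =
  (4 * C * (x2 - x1 + (y2 - y1))) * cmod (w - a) * cmod (w - a) by ring.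
rewrite ler_wpM2r ?cmod_ge0//.
rewrite ltr_pdivlMr// in wk; apply: le_trans (ltW wk).
by rewrite mulrC ler_wpM2l ?cmod_ge0// /K lerDl.
Qed.

(** The Cauchy integral of order [k] without the factor [1 / (2 pi i)], which would cancel in the
    quotients formed later. *)
Definition cauchy_int u (k : nat) a x1 x2 y1 y2 :=
  rectint (fun z => u z * (z - a)^-1 ^+ k) x1 x2 y1 y2.

Lemma cdiff_pole a z : z != a -> cdiff (fun z => (z - a)^-1) z (- (1 / (z - a) ^+ 2)).
Proof.
move=> za; apply: (@cdiffV _ (fun z => z - a) z 1); first by rewrite subr_eq0.
by apply: (cdiff_eq (cdiffB (cdiff_id z) (cdiff_cst a z))); rewrite subr0.
Qed.

Lemma cont_cauchy_kernel u k a z : z != a -> {for z, continuous u} ->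
  {for z, continuous (fun z => u z * (z - a)^-1 ^+ k)}.
Proof.
move=> za cu; apply: (@ccontM _ u (fun z => (z - a)^-1 ^+ k)); first exact: cu.
apply: (@ccontX _ (fun z => (z - a)^-1)).
exact: (cdiff_cont (cdiff_pole za)).
Qed.

(** Orders 1 and 2 are what two differentiations require. With [V = 1 / (z - w)] and
    [W = 1 / (z - a)], applying [V - W = (w - a) V W] twice exposes the factor [(w - a)^2] of the
    remainder. *)
Lemma cdiff_cauchy_int u k a x1 x2 y1 y2 (B e : R) : (k == 1%N) || (k == 2%N) ->
  x1 <= x2 -> y1 <= y2 -> 0 < e ->
  bdcont u x1 x2 y1 y2 -> (forall z, rectbd x1 x2 y1 y2 z -> cmod (u z) <= B) ->
  (forall z, rectbd x1 x2 y1 y2 z -> e <= cmod (z - a)) ->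
  cdiff (fun w => cauchy_int u k w x1 x2 y1 y2) a (k%:R * cauchy_int u k.+1 a x1 x2 y1 y2).
Proof.
move=> k12 x12 y12 e0 cu uB ze.
have e20 : 0 < e / 2 by rewrite divr_gt0.
have zw w z : cmod (w - a) < e / 2 -> rectbd x1 x2 y1 y2 z -> e / 2 <= cmod (z - w).
  by move=> wa /ze zae; have := cmod_subD z a w; lra.
have ne w z : cmod (w - a) < e / 2 -> rectbd x1 x2 y1 y2 z -> z != w.
  by move=> wa /(zw w z wa); apply: contraTneq => ->; rewrite subrr cmod0 -ltNge.
have cz : bdcont (fun z => u z * (z - a)^-1 ^+ k.+1) x1 x2 y1 y2.
  by move=> z zb; apply: cont_cauchy_kernel (cu z zb); apply: ne; rewrite ?subrr ?cmod0.
pose q := 2 / e; have q0 : 0 < q by rewrite divr_gt0.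
have iq w z : cmod (w - a) < e / 2 -> rectbd x1 x2 y1 y2 z -> cmod (z - w)^-1 <= q.
  by move=> wa /(zw w z wa) H; rewrite cmodV /q -invf_div lef_pV2// posrE (lt_le_trans e20).
have B0 : rectbd x1 x2 y1 y2 (x1 +i* y1) by left; split; rewrite /= ?lexx//; left.
have {}B0 : 0 <= B by apply: le_trans (cmod_ge0 _) (uB _ B0).
rewrite /cauchy_int -(rectintM k%:R cz).
have qn n : 0 <= q ^+ n by rewrite exprn_ge0// ltW.
(* [q ^+ 3] bounds the cofactor [V W^2] that remains for order 1, and [3 * q ^+ 4] bounds
   [V W^2 (V + 2 W)], which remains for order 2. *)
have C0 : 0 <= B * (q ^+ 3 + 3 * q ^+ 4).
  by rewrite mulr_ge0// addr_ge0// mulr_ge0.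
have ck w : cmod (w - a) < e / 2 ->
    bdcont (fun z => u z * (z - w)^-1 ^+ k) x1 x2 y1 y2.
  by move=> wa z zb; apply: cont_cauchy_kernel (cu z zb); exact: ne.
have cdk : bdcont (fun z => k%:R * (u z * (z - a)^-1 ^+ k.+1)) x1 x2 y1 y2.
  move=> z zb; apply: (@ccontM _ (fun=> k%:R)); first exact: ccont_cst.
  exact: cz.
apply: (@cdiff_rectint_param (fun w z => u z * (z - w)^-1 ^+ k) _ a _ _ _ _ _ _
  x12 y12 e20 C0 ck cdk).
move=> w z wa zb.
have aa : cmod (a - a) < e / 2 by rewrite subrr cmod0.
have zw0 : z - w != 0 by rewrite subr_eq0 ne.
have za0 : z - a != 0 by rewrite subr_eq0 ne.
have qw := iq _ _ wa zb; have qa := iq _ _ aa zb.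
have eqB : (z - w)^-1 - (z - a)^-1 = (w - a) * (z - w)^-1 * (z - a)^-1.
  by field; rewrite za0.
move: eqB qw qa; set V := (z - w)^-1; set W := (z - a)^-1 => eqB qw qa.
have h2 := cmod_ge0 (w - a).
have VW : cmod (V * W ^+ 2) <= q ^+ 3.
  by rewrite cmodM cmodX [q ^+ 3]exprS ler_pM ?exprn_ge0 ?cmod_ge0// lerXn2r// nnegrE ?cmod_ge0// ltW.
have V2W : cmod (V + 2 * W) <= 3 * q.
  apply: (le_trans (cmodD _ _)); rewrite cmodM.
  have -> : cmod (2 : R[i]) = 2 by rewrite (_ : 2 = 2%:C) ?cmod_real ?normr_nat// rmorph_nat.
  lra.
have -> : B * (q ^+ 3 + 3 * q ^+ 4) * cmod (w - a) ^+ 2 =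
   B * ((q ^+ 3 + q ^+ 3 * (3 * q)) * cmod (w - a) ^+ 2) by ring.
have uzB := uB _ zb.
have fin (X : R[i]) : cmod X <= q ^+ 3 + q ^+ 3 * (3 * q) ->
    cmod (u z * (X * (w - a) ^+ 2)) <= B * ((q ^+ 3 + q ^+ 3 * (3 * q)) * cmod (w - a) ^+ 2).
  move=> XB; rewrite cmodM ler_pM ?cmod_ge0// cmodM cmodX ler_wpM2r// exprn_ge0//.
case/orP: k12 => /eqP ->.
- have -> : u z * V ^+ 1 - u z * W ^+ 1 - 1 * (u z * W ^+ 2) * (w - a) =
     u z * ((V * W ^+ 2) * (w - a) ^+ 2).
    have -> : u z * V ^+ 1 - u z * W ^+ 1 - 1 * (u z * W ^+ 2) * (w - a) =
      u z * (V - W - W ^+ 2 * (w - a)) by ring.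
    rewrite eqB.
    have -> : (w - a) * V * W - W ^+ 2 * (w - a) = (w - a) * W * (V - W) by ring.
    by rewrite eqB; ring.
  by apply: fin; apply: (le_trans VW); rewrite lerDl mulr_ge0// mulr_ge0// ltW.
- have E2 : (u z * V ^+ 2 - u z * W ^+ 2) - 2%:R * (u z * W ^+ 3) * (w - a) =
     u z * ((V * W ^+ 2 * (V + 2 * W)) * (w - a) ^+ 2).
    have -> : u z * V ^+ 2 - u z * W ^+ 2 - 2%:R * (u z * W ^+ 3) * (w - a) =
      u z * ((V - W) * (V + W) - 2%:R * W ^+ 3 * (w - a)) by ring.
    rewrite eqB.
    have -> : (w - a) * V * W * (V + W) - 2%:R * W ^+ 3 * (w - a) =
      (w - a) * W * ((V - W) * (V + 2 * W)) by ring.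
    by rewrite eqB; ring.
  rewrite E2.
  apply: fin; rewrite cmodM; apply: (@le_trans _ _ (q ^+ 3 * (3 * q))).
    by rewrite ler_pM ?cmod_ge0.
  by rewrite lerDr.
Qed.

Lemma Rintegral_ge_cst (v : R -> R) x y m : x <= y ->
  (forall t, x <= t <= y -> {for t, continuous v}) ->
  (forall t, x <= t <= y -> m <= v t) ->
  m * (y - x) <= \int[mu]_(t in `[x, y]) v t.
Proof.
move=> xy cv mv.
have -> : m * (y - x) = \int[mu]_(t in `[x, y]) m.
  rewrite Rintegral_cst//= lebesgue_measure_itv/= lte_fin.
  by case: ltP => //= yx; congr (_ * _); apply/eqP; rewrite subr_eq0 eq_le xy yx.
have ic : mu.-integrable `[x, y] (EFin \o fun=> m).
  by apply: rcont_integrable => t _; exact: cst_continuous.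
have iv := rcont_integrable cv.
by apply: le_Rintegral => // t; rewrite /= in_itv/= => /mv.
Qed.

Lemma Re_inv z : Re z^-1 = Re z / cmod z ^+ 2.
Proof. by rewrite sqr_cmod; case: z. Qed.

Lemma Im_inv z : Im z^-1 = - Im z / cmod z ^+ 2.
Proof. by rewrite sqr_cmod mulNr; case: z. Qed.

(** The integral is [2 pi i], but its positive imaginary part is enough. On each side the integrand
    contributes to it with a fixed sign, at least [1 / (2 L)] in size because [|z - p|^2 <= 2 L^2],
    and the orientation makes all four contributions positive. *)
Lemma rectint_inv_neq0 p (L : R) : 0 < L ->
  rectint (fun z => (z - p)^-1) (Re p - L) (Re p + L)
    (Im p - L) (Im p + L) != 0.
Proof.
move=> L0; set x0 := Re p; set y0 := Im p.
have far z : rectbd (x0 - L) (x0 + L) (y0 - L) (y0 + L) z -> z != p /\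
   cmod (z - p) ^+ 2 <= 2 * L ^+ 2.
  have sq t c : c - L <= t <= c + L -> (t - c) ^+ 2 <= L ^+ 2.
    move=> tc; rewrite -real_normK ?num_real// ler_pXn2r ?nnegrE ?(ltW L0)//.
    by rewrite ler_norml; lra.
  have E t c : t = c - L \/ t = c + L -> t != c /\ (t - c) ^+ 2 = L ^+ 2.
    by move=> [] ->; (split; [|by ring]); [rewrite lt_eqF// gtrDl oppr_lt0|
      rewrite gt_eqF// ltrDl].
  move=> zb; rewrite sqr_cmod ReB ImB -/x0 -/y0 mulr_natl mulr2n.
  case: zb => -[h1 /E[h2 h3]]; split.
  - by apply: contra h2 => /eqP ->; rewrite eqxx.
  - by rewrite h3 lerD2r sq.
  - by apply: contra h2 => /eqP ->; rewrite eqxx.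
  - by rewrite h3 lerD2l sq.
have cinv : bdcont (fun z => (z - p)^-1) (x0 - L) (x0 + L) (y0 - L) (y0 + L).
  by move=> z /far[zp _]; exact: (cdiff_cont (cdiff_pole zp)).
have [c1 c2 c3 c4] := bdcont_on cinv.
have pos z : z != p -> 0 < cmod (z - p) ^+ 2 by move=> zp; rewrite exprn_gt0// cmod_gt0 subr_eq0.
have lower z : rectbd (x0 - L) (x0 + L) (y0 - L) (y0 + L) z ->
   (2 * L)^-1 <= L / cmod (z - p) ^+ 2.
  move=> /far[/pos z0 zL].
  rewrite ler_pdivlMr// ler_pdivrMl ?mulr_gt0//; apply: (le_trans zL).
  by rewrite expr2 mulrA.
have key (v : R -> R) c : (forall t, c - L <= t <= c + L -> {for t, continuous v}) ->
    (forall t, c - L <= t <= c + L -> (2 * L)^-1 <= v t) ->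
    0 < \int[mu]_(t in `[c - L, c + L]) v t.
  move=> cv lv; have cL : c - L <= c + L by lra.
  apply: lt_le_trans (Rintegral_ge_cst cL cv lv).
  by rewrite mulr_gt0 ?invr_gt0 ?mulr_gt0// subr_gt0; lra.
have keyN (v : R -> R) c : (forall t, c - L <= t <= c + L -> {for t, continuous v}) ->
    (forall t, c - L <= t <= c + L -> (2 * L)^-1 <= - v t) ->
    \int[mu]_(t in `[c - L, c + L]) v t < 0.
  move=> cv lv.
  have cNv t : c - L <= t <= c + L -> {for t, continuous (fun s => -1 * v s)}.
    by move=> /cv cvt; exact: (cvgM (cvg_cst (-1 : R)) cvt).
  have : 0 < \int[mu]_(t in `[c - L, c + L]) (-1 * v t).
    by apply: (key (fun t => -1 * v t)) => [|t /lv]; rewrite ?mulN1r.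
  rewrite RintegralZl ?mulN1r ?oppr_gt0//.
  exact: rcont_integrable.
rewrite -cmod_gt0; apply: lt_le_trans (Im_cmod _); rewrite normr_gt0 gt_eqF//.
rewrite /rectint ImD ImB ImM ReB /cint /= mul0r mul1r add0r.
have H1 : 0 < \int[mu]_(t in `[x0 - L, x0 + L]) Im ((t +i* (y0 - L)) - p)^-1.
  apply: key => [t /c1 ct|t tx].
    by apply: continuous_comp; [exact: ct|exact: continuous_Im].
  apply: (le_trans (@lower (t +i* (y0 - L)) _)); first by left; split => //; left.
  by rewrite Im_inv ImB -/y0 /= (_ : - (y0 - L - y0) = L)//; ring.
have H2 : \int[mu]_(t in `[x0 - L, x0 + L]) Im ((t +i* (y0 + L)) - p)^-1 < 0.
  apply: keyN => [t /c2 ct|t tx].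
    by apply: continuous_comp; [exact: ct|exact: continuous_Im].
  apply: (le_trans (@lower (t +i* (y0 + L)) _)); first by left; split => //; right.
  by rewrite Im_inv ImB -/y0 /= -mulNr (_ : - - (y0 + L - y0) = L)//; ring.
have H3 : 0 < \int[mu]_(t in `[y0 - L, y0 + L]) Re (((x0 + L) +i* t) - p)^-1.
  apply: key => [t /c3 ct|t tx].
    by apply: continuous_comp; [exact: ct|exact: continuous_Re].
  apply: (le_trans (@lower ((x0 + L) +i* t) _)); first by right; split => //; right.
  by rewrite Re_inv ReB -/x0 /= (_ : x0 + L - x0 = L)//; ring.
have H4 : \int[mu]_(t in `[y0 - L, y0 + L]) Re (((x0 - L) +i* t) - p)^-1 < 0.
  apply: keyN => [t /c4 ct|t tx].
    by apply: continuous_comp; [exact: ct|exact: continuous_Re].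
  apply: (le_trans (@lower ((x0 - L) +i* t) _)); first by right; split => //; left.
  by rewrite Re_inv ReB -/x0 /= -mulNr (_ : - (x0 - L - x0) = L)//; ring.
rewrite addr_gt0// subr_gt0; [exact: lt_trans H2 H1|exact: lt_trans H4 H3].
Qed.

(* With [F k w] and [U k w] the integrals of [f z / (z - w)^k] and [1 / (z - w)^k] over
   the boundary of a square, Goursat's theorem gives [F 1 = f * U 1] near [p].  Since
   [U 1 p != 0], [f] is the quotient [F 1 / U 1], which is twice differentiable because
   [F k] and [U k] can be differentiated under the integral. *)
Lemma holomorphic_derivative f f' p (r : R) : 0 < r ->
  (forall z, cmod (z - p) < r -> cdiff f z (f' z)) -> exists d, cdiff f' p d.
Proof.
move=> r0 df.
have dfp : cdiff f p (f' p) by apply: df; rewrite subrr cmod0.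
have [r1 r10 fr1] := (ccontP _ _).1 (cdiff_cont dfp) _ ltr01.
(* Points of the square of half-side [L] lie within [2 L] of [p], where [f] is differentiable and
   bounded by [cmod (f p) + 1]. *)
pose L := Num.min r r1 / 4.
have L0 : 0 < L by rewrite divr_gt0// lt_min r0.
have Lr : 2 * L < r.
  have : Num.min r r1 <= r by rewrite ge_min lexx.
  have : 4 * L = Num.min r r1 by rewrite /L; field.
  move=> ? ?; lra.
have Lr1 : 2 * L < r1.
  have : Num.min r r1 <= r1 by rewrite ge_min lexx orbT.
  have : 4 * L = Num.min r r1 by rewrite /L; field.
  move=> ? ?; lra.
set x0 := Re p; set y0 := Im p.
have inQ z : x0 - L <= Re z <= x0 + L -> y0 - L <= Im z <= y0 + L ->
    cmod (z - p) <= 2 * L.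
  move=> h1 h2; apply: (le_trans (cmod_ReIm _)); rewrite ReB ImB -/x0 -/y0 mulr_natl mulr2n.
  by apply: lerD; rewrite ler_norml; lra.
have L2 c : c - L <= c + L by lra.
have bdP z : rectbd (x0 - L) (x0 + L) (y0 - L) (y0 + L) z ->
    cmod (z - p) <= 2 * L /\ L <= cmod (z - p).
  have nL t c : t = c - L \/ t = c + L -> L <= `|t - c|.
    by move=> [] ->; [rewrite (_ : _ - _ = - L) ?normrN ?ler_norm//; ring|
      rewrite (_ : _ - _ = L) ?ler_norm//; ring].
  case=> -[h1 h2]; split.
  - by apply: inQ => //; case: h2 => ->; rewrite lexx ?L2.
  - by apply: le_trans (Im_cmod _); rewrite ImB nL.
  - by apply: inQ => //; case: h2 => ->; rewrite lexx ?L2.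
  - by apply: le_trans (Re_cmod _); rewrite ReB nL.
have L20 : 0 < L / 2 by rewrite divr_gt0.
have bdfar a z : cmod (a - p) < L / 2 -> rectbd (x0 - L) (x0 + L) (y0 - L) (y0 + L) z ->
    L / 2 <= cmod (z - a).
  by move=> ap /bdP[_ zL]; have := cmod_subD z p a; lra.
have bdne a z : cmod (a - p) < L / 2 -> rectbd (x0 - L) (x0 + L) (y0 - L) (y0 + L) z ->
    z != a.
  by move=> ap /(bdfar _ _ ap); apply: contraTneq => ->; rewrite subrr cmod0 -ltNge.
have cf : bdcont f (x0 - L) (x0 + L) (y0 - L) (y0 + L).
  by move=> z /bdP[zL _]; apply: (cdiff_cont (df z (le_lt_trans zL Lr))).
have cu : bdcont (fun=> 1 : R[i]) (x0 - L) (x0 + L) (y0 - L) (y0 + L).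
  by move=> z _; exact: ccont_cst.
have fB z : rectbd (x0 - L) (x0 + L) (y0 - L) (y0 + L) z -> cmod (f z) <= cmod (f p) + 1.
  move=> /bdP[zL _]; have := fr1 z (le_lt_trans zL Lr1).
  by have := cmod_sub_ge (f z) (f p); lra.
have uB z : rectbd (x0 - L) (x0 + L) (y0 - L) (y0 + L) z -> cmod (1 : R[i]) <= 1.
  by rewrite cmod1.
pose F k a := cauchy_int f k a (x0 - L) (x0 + L) (y0 - L) (y0 + L).
pose U k a := cauchy_int (fun=> 1) k a (x0 - L) (x0 + L) (y0 - L) (y0 + L).
have dF k a : (k == 1%N) || (k == 2%N) -> cmod (a - p) < L / 2 ->
    cdiff (F k) a (k%:R * F k.+1 a).
  move=> k12 ap.
  exact: (cdiff_cauchy_int k12 (L2 x0) (L2 y0) L20 cf fB (fun z => @bdfar a z ap)).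
have dU k a : (k == 1%N) || (k == 2%N) -> cmod (a - p) < L / 2 ->
    cdiff (U k) a (k%:R * U k.+1 a).
  move=> k12 ap.
  exact: (cdiff_cauchy_int k12 (L2 x0) (L2 y0) L20 cu uB (fun z => @bdfar a z ap)).
have FU a : cmod (a - p) < L / 2 -> F 1%N a = f a * U 1%N a.
  move=> ap.
  have aL : cmod (a - p) < 2 * L by lra.
  have dfa : cdiff f a (f' a) by apply: df; exact: lt_trans Lr.
  (* The difference quotient is bounded near [a] by [1 + cmod (f' a)], so its contour integral
     vanishes in spite of the puncture; expanding it gives the claim. *)
  pose m z := (f z - f a) * (z - a)^-1.
  have cF : bdcont (fun z => f z * (z - a)^-1 ^+ 1) (x0 - L) (x0 + L) (y0 - L) (y0 + L).
    by move=> z zb; apply: cont_cauchy_kernel (cf z zb); exact: bdne zb.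
  have cU : bdcont (fun z => 1 * (z - a)^-1 ^+ 1) (x0 - L) (x0 + L) (y0 - L) (y0 + L).
    by move=> z zb; exact: (@cont_cauchy_kernel (fun=> 1) 1%N a z (bdne a z ap zb) (cu z zb)).
  have cU' : bdcont (fun z => - f a * (1 * (z - a)^-1 ^+ 1)) (x0 - L) (x0 + L) (y0 - L) (y0 + L).
    move=> z zb; apply: (@ccontM _ (fun=> - f a) (fun z => 1 * (z - a)^-1 ^+ 1)).
      exact: ccont_cst.
    exact: cU.
  have E1 := rectintD cF cU'; have E2 := rectintM (- f a) cU.
  rewrite E2 in E1.
  suff m0 : rectint m (x0 - L) (x0 + L) (y0 - L) (y0 + L) = 0.
    apply/eqP; rewrite -subr_eq0 -mulNr; apply/eqP.
    rewrite /F /U /cauchy_int -E1 -m0; apply: (eq_rectint (L2 x0) (L2 y0)) => z _.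
    by rewrite /m; ring.
  have [r2 r20 fr2] := (cdiffP _ _ _).1 dfa _ ltr01.
  have ax : `|Re a - x0| < L / 2.
    by rewrite -ReB; apply: le_lt_trans (Re_cmod _) ap.
  have ay : `|Im a - y0| < L / 2.
    by rewrite -ImB; apply: le_lt_trans (Im_cmod _) ap.
  have inx : x0 - L < Re a < x0 + L.
    by move: ax; rewrite ltr_norml; lra.
  have iny : y0 - L < Im a < y0 + L.
    by move: ay; rewrite ltr_norml; lra.
  apply: (@goursat_punctured m a (1 + cmod (f' a)) r2 _ _ _ _ inx iny _ r20).
    move=> z zx zy za; eexists.
    apply: (@cdiffM _ (fun z => f z - f a) (fun z => (z - a)^-1)).
      apply: (@cdiffB _ f (fun=> f a)); last exact: cdiff_cst.
      by apply: df; apply: le_lt_trans Lr; exact: inQ.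
    exact: cdiff_pole.
  move=> z za zr; rewrite /m cmodM cmodV ler_pdivrMr ?cmod_gt0 ?subr_eq0//.
  have -> : f z - f a = (f z - f a - f' a * (z - a)) + f' a * (z - a) by ring.
  apply: (le_trans (cmodD _ _)); rewrite mulrDl; apply: lerD; first exact: fr2.
  by rewrite cmodM.
have U0 : U 1%N p != 0.
  rewrite /U /cauchy_int.
  rewrite (@eq_rectint _ _ (fun z => (z - p)^-1) _ _ _ _ (L2 x0) (L2 y0)).
    exact: rectint_inv_neq0.
  by move=> z _; rewrite mul1r expr1.
have pp : cmod (p - p) < L / 2 by rewrite subrr cmod0.
have cUp : 0 < cmod (U 1%N p) by rewrite cmod_gt0.
have [s s0 Us] := (ccontP _ _).1 (cdiff_cont (dU 1%N p isT pp)) _ cUp.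
have Une w : cmod (w - p) < s -> U 1%N w != 0.
  by move=> /Us; apply: contraTneq => ->; rewrite sub0r cmodN ltxx.
pose D w := F 1%N w * (- ((1 * U 2%N w) / U 1%N w ^+ 2)) + (U 1%N w)^-1 * (1 * F 2%N w).
have quot w : cmod (w - p) < Num.min s (L / 2) -> cdiff (fun w => F 1%N w * (U 1%N w)^-1) w (D w).
  rewrite lt_min => /andP[ws wL].
  apply: (@cdiffM _ (F 1%N) (fun w => (U 1%N w)^-1)); first exact: (dF 1%N).
  by apply: (@cdiffV _ (U 1%N)); [exact: Une|exact: (dU 1%N)].
have sL0 : 0 < Num.min s (L / 2) by rewrite lt_min s0.
have f'D w : cmod (w - p) < Num.min s (L / 2) -> D w = f' w.
  move=> ws; have wsE := ws; move: wsE; rewrite lt_min => /andP[ws' wL].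
  have wr : cmod (w - p) < r by lra.
  apply: cdiff_uniq (df w wr).
  have e0 : 0 < Num.min s (L / 2) - cmod (w - p) by rewrite subr_gt0.
  apply: (cdiff_near e0 _ (quot w ws)) => v vw.
  have : cmod (v - p) < Num.min s (L / 2) by apply: le_lt_trans (cmod_subD v p w) _; rewrite -ltrBrDr.
  rewrite lt_min => /andP[vs vL].
  by rewrite FU// mulfK// Une.
eexists; apply: (cdiff_near sL0 f'D).
apply: (@cdiffD _ (fun w => F 1%N w * (- ((1 * U 2%N w) / U 1%N w ^+ 2)))
  (fun w => (U 1%N w)^-1 * (1 * F 2%N w))).
- apply: (@cdiffM _ (F 1%N)); first exact: (dF 1%N).
  apply: (@cdiffN _ (fun w => (1 * U 2%N w) / U 1%N w ^+ 2)).
  apply: (@cdiffM _ (fun w => 1 * U 2%N w) (fun w => (U 1%N w ^+ 2)^-1)).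
    by apply: (@cdiff_cmul _ 1 (U 2%N)); exact: (dU 2%N).
  apply: (@cdiffV _ (fun w => U 1%N w * U 1%N w)); first by rewrite mulf_neq0.
  by apply: (@cdiffM _ (U 1%N) (U 1%N)); exact: (dU 1%N).
- apply: (@cdiffM _ (fun w => (U 1%N w)^-1) (fun w => 1 * F 2%N w)).
    by apply: (@cdiffV _ (U 1%N)); [exact: U0|exact: (dU 1%N)].
  by apply: (@cdiff_cmul _ 1 (F 2%N)); exact: (dF 2%N).
Qed.

End Cauchy.

(** * Green's formula on discs *)

Section PlaneMeasure.
Variable R : realType.
Notation mu := (@lebesgue_measure R).
Notation mu2 := (mu \x mu)%E.
Notation R2 := (measurableTypeR R * measurableTypeR R)%type.

(** The sigma-algebra is the product one, so an open set is written as a countable union of boxes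
    with rational centres and radii [1 / (n + 1)]. *)
Lemma measurable_open_plane (U : set (R * R)) : open U -> measurable (U : set R2).
Proof.
move=> oU.
pose bx (a b : R) (n : nat) : set R2 := ball a n.+1%:R^-1 `*` ball b n.+1%:R^-1.
have mbx a b n : measurable (bx a b n).
  by rewrite /bx !ball_itv; apply: measurableX; exact: measurable_itv.
pose F (a b : rat) (n : nat) : set R2 :=
  [set p | bx (ratr a) (ratr b) n `<=` U /\ bx (ratr a) (ratr b) n p].
have mF a b n : measurable (F a b n).
  have [sub|nsub] := pselect (bx (ratr a) (ratr b) n `<=` U).
    rewrite (_ : F a b n = bx (ratr a) (ratr b) n)//.
    by apply/seteqP; split => [p []|p].
  by rewrite (_ : F a b n = set0)//; apply/seteqP; split => [p []|p].
have -> : U = (\bigcup_a \bigcup_b \bigcup_n F a b n : set R2).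
  apply/seteqP; split => [p Up|p [a _ [b _ [n _ [sub Fp]]]]]; last exact: sub.
  have /nbhs_ballP[e /= e0 eU] : nbhs p U by exact: open_nbhs_nbhs.
  have [n ne] : exists n : nat, n.+1%:R^-1 < e / 2 :> R.
    have e20 : 0 < e / 2 by rewrite divr_gt0.
    by have [n] := ltr_add_invr e20; rewrite add0r; exists n.
  pose d : R := n.+1%:R^-1; have d0 : 0 < d by rewrite invr_gt0.
  have rt x : exists a : rat, ball (ratr a : R) d x.
    have [|a] := @rat_in_itvoo R (x - d) (x + d).
      by rewrite ltrBlDr -addrA ltrDl addr_gt0.
    rewrite in_itv/= => /andP[h1 h2]; exists a; rewrite /ball/= ltr_norml; apply/andP; split; lra.
  have [a ap] := rt p.1; have [b bp] := rt p.2.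
  exists a => //; exists b => //; exists n => //; split; last by split.
  move=> q [/= q1 q2]; apply: eU; move: ap bp q1 q2; rewrite /ball/= -/d !ltr_norml => ap bp q1 q2.
  split; rewrite /ball/= ltr_norml; apply/andP; split; move: ne; rewrite -/d => ne; lra.
apply: bigcupT_measurable_rat => a; apply: bigcupT_measurable_rat => b.
by apply: bigcupT_measurable => n.
Qed.

Definition disc (c : R[i]) (s : R) : set R[i] := [set z | cmod (z - c) < s].

Definition plane (A : set R[i]) : set R2 := [set p | A (toC p)].

Lemma open_disc c s : open (disc c s).
Proof.
rewrite openE => z zs; apply/nbhs_cmodP; exists (s - cmod (z - c)).
  by rewrite subr_gt0.
move=> w; rewrite ltrBrDr; apply: le_lt_trans.
by have := cmod_subD w c z.
Qed.

Lemma open_plane (A : set R[i]) : open A -> open (plane A : set (R * R)).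
Proof. by move=> oA; apply: (open_comp _ oA) => p _; exact: continuous_toC. Qed.

Lemma measurable_plane (A : set R[i]) : open A -> measurable (plane A).
Proof. by move=> /open_plane/measurable_open_plane. Qed.

Lemma measurable_fun_plane (A : set R[i]) (u : R[i] -> R) : open A ->
  (forall z, A z -> {for z, continuous u}) ->
  measurable_fun (plane A) (u \o @toC R : R2 -> R).
Proof.
move=> oA cu; apply: (measurability _ (RGenOpens.measurableE R)).
move=> _ [_ [a [b ->] <-]].
rewrite (_ : _ `&` _ = plane (A `&` u @^-1` `]a, b[%classic)); last first.
  by apply/seteqP; split => p [].
apply: measurable_plane; rewrite openE => z [Az uz]; rewrite /interior.
have Az' : nbhs z A by exact: open_nbhs_nbhs.
have uz' : nbhs z (u @^-1` `]a, b[%classic).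
  by apply: cu => //; apply: open_nbhs_nbhs; split => //; exact: interval_open.
exact: filterI.
Qed.

Lemma disc_rect c s : plane (disc c s) `<=`
  (`](Re c - s), (Re c + s)[%classic `*`
   `](Im c - s), (Im c + s)[%classic : set R2).
Proof.
move=> p pc; split; rewrite /= in_itv/=.
- have := le_lt_trans (Re_cmod _) pc; rewrite ReB/= ltr_norml; lra.
- have := le_lt_trans (Im_cmod _) pc; rewrite ImB/= ltr_norml; lra.
Qed.

Lemma disc_finite c s : (mu2 (plane (disc c s)) < +oo)%E.
Proof.
apply: (@le_lt_trans _ _ (mu2 (`](Re c - s), (Re c + s)[%classic `*`
   `](Im c - s), (Im c + s)[%classic : set R2))).
  apply: le_measure; [apply/mem_set|apply/mem_set|exact: disc_rect].
    exact: (measurable_plane (@open_disc c s)).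
  by apply: measurableX; exact: measurable_itv.
rewrite product_measure1E; [|exact: measurable_itv..].
have fin (x y : R) : (mu `]x, y[%classic < +oo)%E.
  by rewrite lebesgue_measure_itv/=; case: ifP => _; rewrite ?ltry.
apply: lte_mul_pinfty; [exact: measure_ge0| |exact: fin].
by rewrite ge0_fin_numE; [exact: fin|exact: measure_ge0].
Qed.

Lemma disc_integrable (A : set R[i]) c s (u : R[i] -> R) M : open A ->
  A `<=` disc c s ->
  (forall z, A z -> {for z, continuous u}) -> (forall z, A z -> `|u z| <= M) ->
  mu2.-integrable (plane A) (EFin \o (u \o @toC R)).
Proof.
move=> oA Ac cu uM; apply: measurable_bounded_integrable.
- exact: measurable_plane.
- apply: (le_lt_trans _ (disc_finite c s)).
  apply: le_measure; [apply/mem_set|apply/mem_set|by move=> p /Ac].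
    exact: measurable_plane.
  by apply: measurable_plane; exact: open_disc.
- exact: measurable_fun_plane.
- exists `|M|; split; first exact: num_real.
  move=> K MK p Ap; apply: le_trans (uM _ Ap) _.
  by apply: le_trans (ler_norm _) (ltW MK).
Qed.

(** A line at distance [d] from the centre meets the disc in an interval of half-length [l] or not
    at all. In the second case the root of a nonpositive number is 0, so the area computation uses
    one integrand for both. *)
Lemma chord (d s c : R) : 0 < s ->
  (exists l, [/\ 0 < l /\ l = Num.sqrt (s ^+ 2 - d ^+ 2),
     forall x, (Num.sqrt ((x - c) ^+ 2 + d ^+ 2) < s) = (c - l < x < c + l),
     forall x, (Num.sqrt ((x - c) ^+ 2 + d ^+ 2) <= s) = (c - l <= x <= c + l) &
     forall x, x = c - l \/ x = c + l -> Num.sqrt ((x - c) ^+ 2 + d ^+ 2) = s]) \/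
  (Num.sqrt (s ^+ 2 - d ^+ 2) = 0 /\
   forall x, (Num.sqrt ((x - c) ^+ 2 + d ^+ 2) < s) = false).
Proof.
move=> s0; have ss : Num.sqrt (s ^+ 2) = s by rewrite sqrtr_sqr gtr0_norm.
have s20 : 0 < s ^+ 2 by rewrite exprn_gt0.
have [ds|sd] := ltP (d ^+ 2) (s ^+ 2); last first.
  right; split=> [|x]; first by apply: ler0_sqrtr; rewrite subr_le0.
  apply/negbTE; rewrite -leNgt -{1}ss ler_wsqrtr//.
  by apply: (le_trans sd); rewrite lerDr sqr_ge0.
left; pose l := Num.sqrt (s ^+ 2 - d ^+ 2).
have l0 : 0 < l by rewrite sqrtr_gt0 subr_gt0.
have l2 : l ^+ 2 = s ^+ 2 - d ^+ 2 by rewrite sqr_sqrtr// subr_ge0 ltW.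
have pos x : 0 <= (x - c) ^+ 2 + d ^+ 2 by rewrite addr_ge0// sqr_ge0.
exists l; split => //.
- move=> x; rewrite -{1}ss ltr_sqrt// -ltrBrDr -l2 -[(x - c) ^+ 2]real_normK ?num_real//.
  rewrite ltr_pXn2r ?nnegrE ?(ltW l0)// ltr_norml ltrBlDr ltrBrDr.
  by rewrite addrC [l + c]addrC.
- move=> x; rewrite -{1}ss ler_sqrt ?(ltW s20)// -lerBrDr -l2 -[(x - c) ^+ 2]real_normK ?num_real//.
  rewrite ler_pXn2r ?nnegrE ?(ltW l0)// ler_norml lerBlDr lerBrDr.
  by rewrite addrC [l + c]addrC.
- move=> x xl; have -> : (x - c) ^+ 2 = l ^+ 2 by case: xl => ->; ring.
  by rewrite l2 subrK.
Qed.

Lemma integral_open_itv_FTC (v F : R -> R) x y : x < y ->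
  (forall t : R, x <= t <= y -> is_derive t (1 : R) F (v t)) ->
  (forall t, x <= t <= y -> {for t, continuous v}) -> F x = 0 -> F y = 0 ->
  (\int[mu]_(t in `]x, y[) (v t)%:E = 0)%E.
Proof.
move=> xy dF cv Fx Fy.
have iv := rcont_integrable cv.
have mv := measurable_int _ iv.
have mo : measurable_fun `]x, y[ (EFin \o v).
  by apply: measurable_funS mv; [exact: measurable_itv|apply: subset_itvW].
rewrite integral_itv_obnd_cbnd; last first.
  exact: mo.
rewrite integral_itv_bndo_bndc; last first.
  apply: measurable_funS mv; [exact: measurable_itv|].
  by apply: subset_itvl; rewrite bnd_simp.
have fi : (\int[mu]_(t in `[x, y]) (v t)%:E)%E \is a fin_num.
  by apply: integrable_fin_num => //; exact: iv.
rewrite -(fineK fi); congr EFin.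
have := Rintegral_FTC (ltW xy) dF cv.
by rewrite /Rintegral Fx Fy subrr.
Qed.

(** This discards the one horizontal or vertical line that passes through a singular point. *)
Lemma integral_point_zero (g : R -> \bar R) (y0 : R) : measurable_fun setT g ->
  (forall y, y != y0 -> g y = 0)%E -> (\int[mu]_y g y = 0)%E.
Proof.
move=> mg g0; rewrite -(integral0 mu setT).
apply: ae_eq_integral => //.
exists [set y0]; split; [exact: measurable_set1|exact: lebesgue_measure_set1|].
move=> y /= ny; apply: contrapT => yy0; apply: ny => _.
by apply: g0; apply/eqP.
Qed.

(** By Fubini the integral is taken along horizontal chords, and [U] vanishes at both ends of each.
    The excluded height [y0] is that of a singular point. *)
Lemma green_x (U Ux : R[i] -> R) c s y0 : 0 < s ->
  (forall z, cmod (z - c) <= s -> Im z != y0 ->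
    is_derive (Re z) (1 : R) (fun t : R => U (t +i* Im z)) (Ux z)) ->
  (forall z, cmod (z - c) <= s -> Im z != y0 -> {for z, continuous Ux}) ->
  (forall z, cmod (z - c) = s -> U z = 0) ->
  mu2.-integrable (plane (disc c s)) (EFin \o (Ux \o @toC R)) ->
  (\int[mu2]_(p in plane (disc c s)) (Ux (toC p))%:E = 0)%E.
Proof.
move=> s0 dU cU U0 iU.
have mD : measurable (plane (disc c s)) by apply: measurable_plane; exact: open_disc.
rewrite integral_mkcond.
have iU' := (integrable_mkcond _ mD).1 iU.
rewrite -(integral21_prod_meas1 iU').
apply: (@integral_point_zero _ y0); first exact: (measurable_fubini_G iU').
move=> y yy0; rewrite /fubini_G.
pose S : set R := [set x | cmod ((x +i* y) - c) < s].
rewrite (_ : (fun x => _) = ((fun x : R => (Ux (x +i* y))%:E) \_ S)); last first.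
  by apply/funext => x; rewrite !patchE /= /toC; congr (if _ then _ else _);
    apply/idP/idP; rewrite !in_setE.
rewrite -integral_mkcond.
have E x : cmod ((x +i* y) - c) = Num.sqrt ((x - Re c) ^+ 2 + (y - Im c) ^+ 2).
  by rewrite cmodE ReB ImB.
have [[l [[l0 _] H1 H2 H3]]|[_ no]] := chord (y - Im c) (Re c) s0; last first.
  by rewrite (_ : S = set0) ?integral_set0//; apply/seteqP; split => x //; rewrite /S/= E no.
have -> : S = `](Re c - l), (Re c + l)[%classic.
  by apply/seteqP; split => x; rewrite /S/= in_itv/= E H1.
apply: (@integral_open_itv_FTC _ (fun t => U (t +i* y))).
- by rewrite ltrBlDr -addrA ltrDl addr_gt0.
- by move=> t; rewrite -H2 -E => tc; exact: (dU (t +i* y) tc yy0).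
- move=> t; rewrite -H2 -E => tc.
  apply: (@continuous_comp _ _ _ (fun t : R => t +i* y) Ux); first exact: continuous_horizontal.
  exact: cU.
- by apply: U0; rewrite E H3//; left.
- by apply: U0; rewrite E H3//; right.
Qed.

Lemma green_y (U Uy : R[i] -> R) c s x0 : 0 < s ->
  (forall z, cmod (z - c) <= s -> Re z != x0 ->
    is_derive (Im z) (1 : R) (fun t : R => U (Re z +i* t)) (Uy z)) ->
  (forall z, cmod (z - c) <= s -> Re z != x0 -> {for z, continuous Uy}) ->
  (forall z, cmod (z - c) = s -> U z = 0) ->
  mu2.-integrable (plane (disc c s)) (EFin \o (Uy \o @toC R)) ->
  (\int[mu2]_(p in plane (disc c s)) (Uy (toC p))%:E = 0)%E.
Proof.
move=> s0 dU cU U0 iU.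
have mD : measurable (plane (disc c s)) by apply: measurable_plane; exact: open_disc.
rewrite integral_mkcond.
have iU' := (integrable_mkcond _ mD).1 iU.
rewrite -(integral12_prod_meas1 iU').
apply: (@integral_point_zero _ x0); first exact: (measurable_fubini_F iU').
move=> x xx0; rewrite /fubini_F.
pose S : set R := [set y | cmod ((x +i* y) - c) < s].
rewrite (_ : (fun y => _) = ((fun y : R => (Uy (x +i* y))%:E) \_ S)); last first.
  by apply/funext => y; rewrite !patchE /= /toC; congr (if _ then _ else _);
    apply/idP/idP; rewrite !in_setE.
rewrite -integral_mkcond.
have E y : cmod ((x +i* y) - c) = Num.sqrt ((y - Im c) ^+ 2 + (x - Re c) ^+ 2).
  by rewrite cmodE ReB ImB addrC.
have [[l [[l0 _] H1 H2 H3]]|[_ no]] := chord (x - Re c) (Im c) s0; last first.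
  by rewrite (_ : S = set0) ?integral_set0//; apply/seteqP; split => y //; rewrite /S/= E no.
have -> : S = `](Im c - l), (Im c + l)[%classic.
  by apply/seteqP; split => y; rewrite /S/= in_itv/= E H1.
apply: (@integral_open_itv_FTC _ (fun t => U (x +i* t))).
- by rewrite ltrBlDr -addrA ltrDl addr_gt0.
- by move=> t; rewrite -H2 -E => tc; exact: (dU (x +i* t) tc xx0).
- move=> t; rewrite -H2 -E => tc.
  apply: (@continuous_comp _ _ _ (fun t : R => x +i* t) Uy); first exact: continuous_vertical.
  exact: cU.
- by apply: U0; rewrite E H3//; left.
- by apply: U0; rewrite E H3//; right.
Qed.

(** The substitution [x = c + s sin t] gives the integrand [2 s^2 cos^2 t], with primitive
    [s^2 (t + sin t cos t)]. *)
Lemma integral_half_circle (c s : R) : 0 < s ->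
  (\int[mu]_(x in `[(c - s)%R, (c + s)%R]) (2 * Num.sqrt (s ^+ 2 - (x - c) ^+ 2))%R%:E = (pi * s ^+ 2)%R%:E)%E.
Proof.
move=> s0.
pose F (t : R) : R := c + s * sin t.
pose G (x : R) : R := 2 * Num.sqrt (s ^+ 2 - (x - c) ^+ 2).
have dF (t : R) : is_derive t (1 : R) F (s * cos t).
  by apply: is_derive_eq; rewrite /GRing.scale/=; ring.
have F'E : derive1 F = (fun t => s * cos t).
  by apply/funext => t; rewrite derive1E; have [_ ->] := dF t.
have cF : continuous F.
  by move=> t; apply/differentiable_continuous/derivable1_diffP; have [] := dF t.
have cF' : continuous (derive1 F).
  by rewrite F'E => t; apply: cvgM; [exact: cvg_cst|exact: continuous_cos].
have Fa : F (- (pi / 2)) = c - s by rewrite /F sinN sin_pihalf; ring.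
have Fb : F (pi / 2) = c + s by rewrite /F sin_pihalf; ring.
have ab : - (pi / 2) < pi / 2 :> R by have := @pi_gt0 R; lra.
have cG : continuous G.
  move=> x; apply: cvgM; first exact: cvg_cst.
  apply: (@continuous_comp _ _ _ (fun x : R => s ^+ 2 - (x - c) ^+ 2) Num.sqrt).
    apply: cvgB; first exact: cvg_cst.
    rewrite [X in X @ _](_ : _ = (fun x : R => (x - c) * (x - c))); last first.
      by apply/funext => t; rewrite expr2.
    by apply: cvgM; (apply: cvgB; [exact: cvg_id|exact: cvg_cst]).
  exact: sqrt_continuous.
rewrite -Fa -Fb (@integration_by_substitution_increasing _ F G _ _ (ltW ab)); first last.
- exact: continuous_subspaceT.
- split => [t _||]; first by have [] := dF t.
  + exact/cvg_at_right_filter/cF.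
  + exact/cvg_at_left_filter/cF.
- by apply/cvg_ex; eexists; apply: cvg_at_left_filter; exact: cF'.
- by apply/cvg_ex; eexists; apply: cvg_at_right_filter; exact: cF'.
- by move=> t _; exact: cF'.
- by move=> x y xi yi xy; rewrite /F ltrD2l ltr_pM2l// ltr_sin.
pose H (t : R) : R := s ^+ 2 * (t + sin t * cos t).
pose h (t : R) : R := 2 * s ^+ 2 * cos t ^+ 2.
have dH (t : R) : is_derive t (1 : R) H (h t).
  apply: is_derive_eq; rewrite /GRing.scale/= /h.
  have := cos2Dsin2 t; set C := cos t; set S := sin t => CS.
  have S2 : S * S = 1 - C * C by rewrite -CS; ring.
  transitivity (s ^+ 2 * (1 + (C * C - S * S))); [by ring|by rewrite S2; ring].
have ch : continuous h.
  move=> t; apply: cvgM; first exact: cvg_cst.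
  rewrite [X in X @ _](_ : _ = (fun t : R => cos t * cos t)); last first.
    by apply/funext => u; rewrite expr2.
  by apply: cvgM; exact: continuous_cos.
have ih : mu.-integrable `[(- (pi / 2)), (pi / 2)] (EFin \o h).
  by apply: rcont_integrable => t _; exact: ch.
transitivity (\int[mu]_(x in `[(- (pi / 2))%R, (pi / 2)%R]) (h x)%:E)%E.
  apply: eq_integral => t; rewrite inE/= in_itv/= => tp.
  congr EFin; rewrite F'E /G /F /h !fctE.
  have -> : s ^+ 2 - (c + s * sin t - c) ^+ 2 = (s * cos t) ^+ 2.
    have := cos2Dsin2 t; set C := cos t; set S := sin t => CS.
    have -> : (s * C) ^+ 2 = s ^+ 2 * C ^+ 2 by ring.
    have -> : C ^+ 2 = 1 - S ^+ 2 by rewrite -CS; ring.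
    ring.
  rewrite sqrtr_sqr ger0_norm; first by ring.
  by rewrite mulr_ge0 ?(ltW s0)// cos_ge0_pihalf.
have fi : (\int[mu]_(t in `[(- (pi / 2))%R, (pi / 2)%R]) (h t)%:E)%E \is a fin_num.
  by apply: integrable_fin_num => //; exact: ih.
rewrite -(fineK fi); congr EFin.
have := Rintegral_FTC (ltW ab) (fun t _ => dH t) (fun t _ => ch t).
by rewrite /Rintegral => ->; rewrite /H sinN cosN sin_pihalf cos_pihalf; field.
Qed.

Lemma disc_area c s : 0 < s -> mu2 (plane (disc c s)) = (pi * s ^+ 2)%:E.
Proof.
move=> s0; rewrite -(@integral_half_circle (Re c))// integral_mkcond.
apply: eq_integral => x _ /=.
have -> : xsection (plane (disc c s)) x = [set y | cmod ((x +i* y) - c) < s].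
  by apply/seteqP; split => y; rewrite /xsection/= ?inE.
have E y : cmod ((x +i* y) - c) = Num.sqrt ((y - Im c) ^+ 2 + (x - Re c) ^+ 2).
  by rewrite cmodE ReB ImB addrC.
rewrite patchE.
have [[l [[l0 lE] H1 H2 H3]]|[sq0 no]] := chord (x - Re c) (Im c) s0; last first.
  rewrite sq0 mulr0 if_same (_ : mkset _ = set0) ?measure0//.
  by apply/seteqP; split => y //=; rewrite E no.
rewrite (_ : mkset _ = `](Im c - l), (Im c + l)[%classic); last first.
  by apply/seteqP; split => y; rewrite /= in_itv/= E H1.
rewrite ifT; last first.
  apply/mem_set; rewrite /= in_itv/=.
  have d2 : (x - Re c) ^+ 2 < s ^+ 2.
    by rewrite -subr_gt0 -sqrtr_gt0 -lE.
  have : `|x - Re c| < s.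
    by rewrite -(ltr_pXn2r (_ : 0 < 2)%N) ?nnegrE ?(ltW s0)// real_normK ?num_real.
  by rewrite ltr_norml => /andP[h1 h2]; apply/andP; split; lra.
rewrite lebesgue_measure_itv/= lte_fin ifT; last by lra.
by rewrite -lE; congr EFin; ring.
Qed.

Lemma open_punctured_disc (c p : R[i]) (s : R) : open (disc c s `\ p).
Proof.
rewrite openE => z [zc /eqP zp]; apply/nbhs_cmodP.
exists (Num.min (s - cmod (z - c)) (cmod (z - p))).
  by rewrite lt_min subr_gt0 cmod_gt0 subr_eq0 zp andbT.
move=> w; rewrite lt_min ltrBrDr => /andP[wz wp]; split.
  by apply: le_lt_trans wz; exact: cmod_subD.
by move=> /= wpE; move: wp; rewrite wpE cmodB ltxx.
Qed.

Lemma disc_integrable_punctured (c p : R[i]) (s : R) (u : R[i] -> R) M :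
  (forall z, disc c s z -> z != p -> {for z, continuous u}) ->
  (forall z, disc c s z -> z != p -> `|u z| <= M) ->
  mu2.-integrable (plane (disc c s)) (EFin \o (u \o @toC R)).
Proof.
move=> cu uM; apply: measurable_bounded_integrable.
- by apply: measurable_plane; exact: open_disc.
- exact: disc_finite.
- have mp : measurable ([set (Re p, Im p)] : set R2).
    rewrite (_ : [set _] = [set Re p] `*` [set Im p]).
      by apply: measurableX; exact: measurable_set1.
    by apply/seteqP; split => -[q1 q2] [/= -> ->].
  have mA : measurable (plane (disc c s `\ p)) by apply: measurable_plane; exact: open_punctured_disc.
  apply: (@measurable_funS _ _ _ _ (plane (disc c s `\ p) `|` [set (Re p, Im p)])).
  + exact: measurableU.
  + move=> q qc; have [qp|qp] := eqVneq (toC q) p; last by left; split=> //; exact/eqP.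
    by right; rewrite -qp /=; case: q {qc qp}.
  + apply/measurable_funU => //; split; last exact: measurable_fun_set1.
    apply: measurable_fun_plane; first exact: open_punctured_disc.
    by move=> z [zc /eqP zp]; exact: cu.
(* At [p] itself the total function has some unspecified value, which must enter the bound. *)
- exists (Num.max M `|u p|); split; first exact: num_real.
  move=> K; rewrite gt_max => /andP[MK uK] q qc.
  have [qp|qp] := eqVneq (toC q) p; first by rewrite /= qp ltW.
  by apply: le_trans (uM _ qc qp) (ltW MK).
Qed.

Lemma is_derive_mul_comp (M A B G : R -> R) (t dM dA dB dG : R) :
  is_derive t (1 : R) M dM -> is_derive t (1 : R) A dA -> is_derive t (1 : R) B dB ->
  is_derive (A t ^+ 2 + B t ^+ 2) (1 : R) G dG ->
  is_derive t (1 : R) (fun x => M x * G (A x ^+ 2 + B x ^+ 2))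
   (dM * G (A t ^+ 2 + B t ^+ 2) + M t * (dG * (2 * (A t * dA + B t * dB)))).
Proof.
move=> HM HA HB HG.
have H2 : is_derive t (1 : R) (fun x => A x ^+ 2 + B x ^+ 2) (2 * (A t * dA + B t * dB)).
  by apply: is_derive_eq; rewrite /GRing.scale/=; ring.
have H3 := @is_derive1_comp R G (fun x => A x ^+ 2 + B x ^+ 2) t _ _ HG H2.
have H4 := is_deriveM HM H3.
by apply: is_derive_eq; rewrite /GRing.scale/=; ring.
Qed.

Definition dint (c : R[i]) (s : R) (u : R[i] -> R) : R := \int[mu2]_(q in plane (disc c s)) u (toC q).

(** * Green's formula for [m G(|phi|^2)] with a possible singularity of [m] *)

Section Green.
Variables (c p : R[i]) (s : R) (m dm phi dphi : R[i] -> R[i]) (G dG : R -> R).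
Variables (C1 C2 C3 C4 : R).
Hypothesis s0 : 0 < s.
Hypothesis dphiP : forall z, cmod (z - c) <= s -> cdiff phi z (dphi z).
Hypothesis dphi_cont : forall z, cmod (z - c) <= s -> {for z, continuous dphi}.
Hypothesis dmP : forall z, cmod (z - c) <= s -> z != p -> cdiff m z (dm z).
Hypothesis dm_cont : forall z, cmod (z - c) <= s -> z != p -> {for z, continuous dm}.
Hypothesis dGP : forall z, cmod (z - c) <= s ->
  is_derive (cmod (phi z) ^+ 2) (1 : R) G (dG (cmod (phi z) ^+ 2)).
Hypothesis dG_cont : forall z, cmod (z - c) <= s -> {for cmod (phi z) ^+ 2, continuous dG}.
Hypothesis G_bd : forall z, cmod (z - c) = s -> G (cmod (phi z) ^+ 2) = 0.
Hypothesis bound1 : forall z, disc c s z -> z != p ->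
  cmod (dm z) * `|G (cmod (phi z) ^+ 2)| <= C1.
Hypothesis bound2 : forall z, disc c s z -> z != p -> cmod (m z) * cmod (phi z) <= C2.
Hypothesis bound3 : forall z, disc c s z -> cmod (dphi z) <= C3.
Hypothesis bound4 : forall z, disc c s z -> `|dG (cmod (phi z) ^+ 2)| <= C4.

(** [Ux] is the horizontal derivative of [Re m * G(|phi|^2)] and, below, [Vy] is the vertical
    derivative of [Im m * G(|phi|^2)]. By the Cauchy-Riemann equations both contain the same term in
    [dm]. *)
Let Ux z := Re (dm z) * G (cmod (phi z) ^+ 2) +
  Re (m z) * (dG (cmod (phi z) ^+ 2) *
    (2 * Re (phi z * (dphi z)^*))).
Let Vy z := Re (dm z) * G (cmod (phi z) ^+ 2) +
  Im (m z) * (dG (cmod (phi z) ^+ 2) *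
    (2 * Im (phi z * (dphi z)^*))).

Let cont_phi2 z : cmod (z - c) <= s -> {for z, continuous (fun z => cmod (phi z) ^+ 2)}.
Proof.
move=> zc; have cphi := cdiff_cont (dphiP zc).
apply: (@continuous_comp _ _ _ (fun z => cmod (phi z)) (fun t : R => t ^+ 2)).
  by apply: (@continuous_comp _ _ _ phi (@cmod R)); [exact: cphi|exact: continuous_cmod].
exact: exprn_continuous.
Qed.

Let cont_G z : cmod (z - c) <= s -> {for z, continuous (fun z => G (cmod (phi z) ^+ 2))}.
Proof.
move=> zc; apply: (@continuous_comp _ _ _ (fun z => cmod (phi z) ^+ 2) G); first exact: cont_phi2.
by apply/differentiable_continuous/derivable1_diffP; have [] := dGP zc.
Qed.

Let cont_dG z : cmod (z - c) <= s -> {for z, continuous (fun z => dG (cmod (phi z) ^+ 2))}.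
Proof.
move=> zc; apply: (@continuous_comp _ _ _ (fun z => cmod (phi z) ^+ 2) dG); first exact: cont_phi2.
exact: dG_cont.
Qed.

Let rcontM (u v : R[i] -> R) z : {for z, continuous u} -> {for z, continuous v} ->
  {for z, continuous (fun w => u w * v w)}.
Proof. by move=> cu cv; exact: (cvgM cu cv). Qed.

Let rcontD (u v : R[i] -> R) z : {for z, continuous u} -> {for z, continuous v} ->
  {for z, continuous (fun w => u w + v w)}.
Proof. by move=> cu cv; exact: (cvgD cu cv). Qed.

Let cont_Re (f : R[i] -> R[i]) z : {for z, continuous f} -> {for z, continuous (fun w => Re (f w))}.
Proof. by move=> cf; apply: (@continuous_comp _ _ _ f (@Re R)); [exact: cf|exact: continuous_Re]. Qed.

Let cont_Im (f : R[i] -> R[i]) z : {for z, continuous f} -> {for z, continuous (fun w => Im (f w))}.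
Proof. by move=> cf; apply: (@continuous_comp _ _ _ f (@Im R)); [exact: cf|exact: continuous_Im]. Qed.

Let cont_phidphi z : cmod (z - c) <= s -> {for z, continuous (fun z => phi z * (dphi z)^*)}.
Proof.
move=> zc; apply: (@ccontM _ phi (fun z => (dphi z)^*)); first exact: (cdiff_cont (dphiP zc)).
apply/ccontP => e e0; have [x x0 xP] := (ccontP _ _).1 (dphi_cont zc) e e0.
by exists x => // w /xP; rewrite -rmorphB cmodJ.
Qed.

Let cont_Ux z : cmod (z - c) <= s -> z != p -> {for z, continuous Ux}.
Proof.
move=> zc zp; have cm := cdiff_cont (dmP zc zp).
apply: (@rcontD (fun z => Re (dm z) * G (cmod (phi z) ^+ 2))
  (fun z => Re (m z) * (dG (cmod (phi z) ^+ 2) * (2 * Re (phi z * (dphi z)^*))))).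
  by apply: rcontM; [apply/cont_Re/dm_cont|exact: cont_G].
apply: rcontM; first exact: cont_Re.
apply: rcontM; first exact: cont_dG.
by apply: rcontM; [exact: cst_continuous|apply/(@cont_Re (fun z => phi z * (dphi z)^*))/cont_phidphi].
Qed.

Let cont_Vy z : cmod (z - c) <= s -> z != p -> {for z, continuous Vy}.
Proof.
move=> zc zp; have cm := cdiff_cont (dmP zc zp).
apply: (@rcontD (fun z => Re (dm z) * G (cmod (phi z) ^+ 2))
  (fun z => Im (m z) * (dG (cmod (phi z) ^+ 2) * (2 * Im (phi z * (dphi z)^*))))).
  by apply: rcontM; [apply/cont_Re/dm_cont|exact: cont_G].
apply: rcontM; first exact: cont_Im.
apply: rcontM; first exact: cont_dG.
by apply: rcontM; [exact: cst_continuous|apply/(@cont_Im (fun z => phi z * (dphi z)^*))/cont_phidphi].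
Qed.

Let M := C1 + C2 * (C4 * (2 * C3)).

Let boundUV (r1 r2 r3 : R) z : disc c s z -> z != p ->
  `|r1| <= cmod (dm z) -> `|r2| <= cmod (m z) -> `|r3| <= cmod (phi z * (dphi z)^*) ->
  `|r1 * G (cmod (phi z) ^+ 2) + r2 * (dG (cmod (phi z) ^+ 2) * (2 * r3))| <= M.
Proof.
move=> zc zp h1 h2 h3; apply: (le_trans (ler_normD _ _)); apply: lerD.
  by rewrite normrM; apply: le_trans (bound1 zc zp); rewrite ler_wpM2r.
rewrite !normrM normr_nat.
apply: (@le_trans _ _ ((cmod (m z) * cmod (phi z)) * (`|dG (cmod (phi z) ^+ 2)| * (2 * cmod (dphi z))))).
  rewrite cmodM cmodJ in h3.
  rewrite (_ : _ * _ * (_ * _) = cmod (m z) * (`|dG (cmod (phi z) ^+ 2)| * (2 * (cmod (phi z) * cmod (dphi z))))); last by ring.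
  by apply: ler_pM => //; rewrite ?mulr_ge0// ler_wpM2l// ler_wpM2l.
apply: ler_pM; rewrite ?mulr_ge0 ?cmod_ge0//; first exact: bound2.
apply: ler_pM; rewrite ?mulr_ge0 ?cmod_ge0//; first exact: bound4.
by rewrite ler_wpM2l// bound3.
Qed.

Let int_Ux : mu2.-integrable (plane (disc c s)) (EFin \o (Ux \o @toC R)).
Proof.
apply: (@disc_integrable_punctured _ p _ _ M) => z zc zp.
  by apply: cont_Ux => //; exact: ltW.
by apply: boundUV; rewrite ?Re_cmod.
Qed.

Let int_Vy : mu2.-integrable (plane (disc c s)) (EFin \o (Vy \o @toC R)).
Proof.
apply: (@disc_integrable_punctured _ p _ _ M) => z zc zp.
  by apply: cont_Vy => //; exact: ltW.
by apply: boundUV; rewrite ?Re_cmod ?Im_cmod.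
Qed.

(** Half of [Ux - Vy] is the real part of the zbar-derivative of [m G(|phi|^2)]: the terms in [dm]
    cancel and the integrand remains. The integrals of [Ux] and [Vy] vanish separately, since [G] is
    0 on the circle. *)
Lemma green_formula : dint c s (fun z =>
  Re (m z * phi z * (dphi z)^*) * dG (cmod (phi z) ^+ 2)) = 0.
Proof.
have HU : (\int[mu2]_(q in plane (disc c s)) (Ux (toC q))%:E = 0)%E.
  apply: (@green_x (fun z => Re (m z) * G (cmod (phi z) ^+ 2)) _ _ _ (Im p)) => //.
  - move=> z zc zp.
    have zp' : z != p by apply: contra zp => /eqP ->.
    have hphi : cdiff phi (Re z +i* Im z) (dphi z).
      by rewrite -cplxE; exact: dphiP.
    have hm : cdiff m (Re z +i* Im z) (dm z).
      by rewrite -cplxE; exact: dmP.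
    have [h1 h2] := cdiff_partialx hphi; have [h3 h4] := cdiff_partialx hm.
    have HG : is_derive (Re (phi (Re z +i* Im z)) ^+ 2 +
        Im (phi (Re z +i* Im z)) ^+ 2) (1 : R) G (dG (cmod (phi z) ^+ 2)).
      by rewrite -cplxE -sqr_cmod; exact: dGP.
    have H := is_derive_mul_comp h3 h1 h2 HG.
    rewrite [X in is_derive _ _ X _](_ : _ = (fun x => Re (m (x +i* Im z)) *
      G (Re (phi (x +i* Im z)) ^+ 2 + Im (phi (x +i* Im z)) ^+ 2))); last first.
      by apply/funext => t; rewrite sqr_cmod.
    apply: (@is_derive_eq _ _ _ _ _ _ _ _ H).
    rewrite /Ux -!cplxE -sqr_cmod ReM ReJ ImJ; ring.
  - move=> z zc zp; apply: cont_Ux => //; by apply: contra zp => /eqP ->.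
  - by move=> z zc; rewrite G_bd// mulr0.
have HV : (\int[mu2]_(q in plane (disc c s)) (Vy (toC q))%:E = 0)%E.
  apply: (@green_y (fun z => Im (m z) * G (cmod (phi z) ^+ 2)) _ _ _ (Re p)) => //.
  - move=> z zc zp.
    have zp' : z != p by apply: contra zp => /eqP ->.
    have hphi : cdiff phi (Re z +i* Im z) (dphi z).
      by rewrite -cplxE; exact: dphiP.
    have hm : cdiff m (Re z +i* Im z) (dm z).
      by rewrite -cplxE; exact: dmP.
    have [h1 h2] := cdiff_partialy hphi; have [h3 h4] := cdiff_partialy hm.
    have HG : is_derive (Re (phi (Re z +i* Im z)) ^+ 2 +
        Im (phi (Re z +i* Im z)) ^+ 2) (1 : R) G (dG (cmod (phi z) ^+ 2)).
      by rewrite -cplxE -sqr_cmod; exact: dGP.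
    have H := is_derive_mul_comp h4 h1 h2 HG.
    rewrite [X in is_derive _ _ X _](_ : _ = (fun x => Im (m (Re z +i* x)) *
      G (Re (phi (Re z +i* x)) ^+ 2 + Im (phi (Re z +i* x)) ^+ 2))); last first.
      by apply/funext => t; rewrite sqr_cmod.
    apply: (@is_derive_eq _ _ _ _ _ _ _ _ H).
    rewrite /Vy -!cplxE -sqr_cmod ImM ReJ ImJ; ring.
  - move=> z zc zp; apply: cont_Vy => //; by apply: contra zp => /eqP ->.
  - by move=> z zc; rewrite G_bd// mulr0.
have mD : measurable (plane (disc c s)) by apply: measurable_plane; exact: open_disc.
have : \int[mu2]_(q in plane (disc c s)) (Ux (toC q) - Vy (toC q)) = 0.
  by rewrite (RintegralB mD int_Ux int_Vy) /Rintegral HU HV subrr.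
have iUV : mu2.-integrable (plane (disc c s)) (EFin \o (fun q => Ux (toC q) - Vy (toC q))).
  exact: (integrableB mD int_Ux int_Vy).
move=> H0; rewrite /dint.
transitivity (\int[mu2]_(q in plane (disc c s)) (2^-1 * (Ux (toC q) - Vy (toC q)))).
  by apply: eq_Rintegral => q _; rewrite /Ux /Vy -[m _ * _ * _]mulrA ReM; field.
by have := RintegralZl 2^-1 mD iUV; rewrite H0 mulr0.
Qed.
End Green.

End PlaneMeasure.

(** * Analytic functions on the disk *)

Section Disk.
Variable R : realType.
Implicit Types (f g h : R[i] -> R[i]) (a c z w : R[i]).
Notation mu := (@lebesgue_measure R).
Notation mu2 := (mu \x mu)%E.
Notation R2 := (measurableTypeR R * measurableTypeR R)%type.

(** * Compactness of closed discs and elementary facts on analytic functions *)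

Lemma closed_disc_max c (s : R) (u : R[i] -> R) : 0 <= s ->
  (forall z, cmod (z - c) <= s -> {for z, continuous u}) ->
  exists2 z0, cmod (z0 - c) <= s & forall z, cmod (z - c) <= s -> u z <= u z0.
Proof.
move=> s0 cu.
pose K : set (R * R) := [set p | cmod (toC p - c) <= s].
have cK : compact K.
  pose A : set R := `[(Re c - s), (Re c + s)]%classic.
  pose B : set R := `[(Im c - s), (Im c + s)]%classic.
  apply: (@subclosed_compact _ K (A `*` B)).
  - have -> : K = (fun p : R * R => cmod (toC p - c)) @^-1` [set x | x <= s] by [].
    apply: closed_comp; last exact: closed_le.
    move=> p _.
    apply: (@continuous_comp _ _ _ (fun p : R * R => toC p - c) (@cmod R)).
      apply: (@continuous_comp _ _ _ (@toC R) (fun z => z - c)); first exact: continuous_toC.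
      by apply: (@ccontD _ id (fun=> - c)); [exact: (cdiff_cont (cdiff_id _))|exact: ccont_cst].
    exact: continuous_cmod.
  - by apply: compact_setX; exact: segment_compact.
  - move=> p pK; split; rewrite /A /B /= in_itv/=.
    + by have := le_trans (Re_cmod _) pK; rewrite ReB/= ler_norml; lra.
    + by have := le_trans (Im_cmod _) pK; rewrite ImB/= ler_norml; lra.
have K0 : K !=set0.
  by exists (Re c, Im c); rewrite /K/= /toC/= -cplxE subrr cmod0.
have [] := @compact_EVT_max _ R (u \o @toC R) K K0 cK.
  apply: continuous_in_subspaceT => p; rewrite inE => pK.
  by apply: continuous_comp; [exact: continuous_toC|exact: cu].
move=> p pK pmax; exists (toC p); first by move: pK; rewrite inE.
move=> z zc; have := pmax (Re z, Im z).
by rewrite /= /toC/= -cplxE; apply; rewrite inE /K/= /toC/= -cplxE.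
Qed.

Lemma closed_disc_bounded c (s : R) f :
  (forall z, cmod (z - c) <= s -> {for z, continuous f}) ->
  exists2 M, 0 <= M & forall z, cmod (z - c) <= s -> cmod (f z) <= M.
Proof.
move=> cf; have [s0|s0] := leP 0 s; last first.
  exists 0 => // z zs; have := cmod_ge0 (z - c).
  by rewrite leNgt (le_lt_trans zs).
have [|z0 _ H] := @closed_disc_max c s (fun z => cmod (f z)) s0.
  move=> z /cf cfz; apply: (@continuous_comp _ _ _ f (@cmod R)); first exact: cfz.
  exact: continuous_cmod.
by exists (cmod (f z0)); rewrite ?cmod_ge0.
Qed.

Lemma closed_disc_rbounded c (s : R) (u : R[i] -> R) :
  (forall z, cmod (z - c) <= s -> {for z, continuous u}) ->
  exists2 M, 0 <= M & forall z, cmod (z - c) <= s -> `|u z| <= M.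
Proof.
move=> cu; have [s0|s0] := leP 0 s; last first.
  exists 0 => // z zs; have := cmod_ge0 (z - c).
  by rewrite leNgt (le_lt_trans zs).
have [|z0 _ H] := @closed_disc_max c s (fun z => `|u z|) s0.
  move=> z /cu cuz; apply: (@continuous_comp _ _ _ u Num.Def.normr); first exact: cuz.
  exact: norm_continuous.
by exists `|u z0|.
Qed.

(** The mean value theorem is applied to the real and imaginary parts along the segment, at possibly
    different points, whence the factor 2. *)
Lemma cdiff_segment_lipschitz f (f' : R[i] -> R[i]) a z (L : R) :
  (forall t : R, 0 <= t <= 1 -> cdiff f (a + t%:C * (z - a)) (f' (a + t%:C * (z - a)))) ->
  (forall t : R, 0 <= t <= 1 -> cmod (f' (a + t%:C * (z - a))) <= L) ->
  cmod (f z - f a) <= 2 * (L * cmod (z - a)).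
Proof.
move=> df fL.
have e1 : a + 1%:C * (z - a) = z by rewrite mul1r addrC subrK.
have e0 : a + 0%:C * (z - a) = a by rewrite mul0r addr0.
have key (u du : R -> R) : (forall t : R, 0 <= t <= 1 -> is_derive t (1 : R) u (du t)) ->
   (forall t, 0 <= t <= 1 -> `|du t| <= L * cmod (z - a)) -> `|u 1 - u 0| <= L * cmod (z - a).
  move=> du1 duL.
  have [t| |t t01 ->] := @MVT_segment R u du 0 1 ler01.
  - by rewrite in_itv/= => /andP[/ltW t0 /ltW t1]; apply: du1; rewrite t0.
  - apply: continuous_in_subspaceT => t; rewrite inE/= in_itv/= => /du1[dt _].
    exact/differentiable_continuous/derivable1_diffP.
  - by rewrite subr0 mulr1; apply: duL; move: t01; rewrite in_itv.
have bd t : 0 <= t <= 1 -> cmod ((z - a) * f' (a + t%:C * (z - a))) <= L * cmod (z - a).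
  by move=> /fL H; rewrite cmodM mulrC ler_wpM2r ?cmod_ge0.
have HR := key (fun t => Re (f (a + t%:C * (z - a))))
  (fun t => Re ((z - a) * f' (a + t%:C * (z - a))))
  (fun t t01 => (cdiff_line (df t t01)).1) (fun t t01 => le_trans (Re_cmod _) (bd t t01)).
have HI := key (fun t => Im (f (a + t%:C * (z - a))))
  (fun t => Im ((z - a) * f' (a + t%:C * (z - a))))
  (fun t t01 => (cdiff_line (df t t01)).2) (fun t t01 => le_trans (Im_cmod _) (bd t t01)).
rewrite e1 e0 in HR HI.
by apply: (le_trans (cmod_ReIm _)); rewrite mulr_natl mulr2n ReB ImB; apply: lerD.
Qed.

Lemma segment_closed_disc c (s : R) a z (t : R) : 0 <= t <= 1 ->
  cmod (a - c) <= s -> cmod (z - c) <= s -> cmod (a + t%:C * (z - a) - c) <= s.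
Proof.
move=> /andP[t0 t1] ac zc.
have -> : a + t%:C * (z - a) - c = (1 - t)%:C * (a - c) + t%:C * (z - c).
  by rewrite rmorphB/=; ring.
apply: (le_trans (cmodD _ _)); rewrite !cmodM !cmod_real !ger0_norm ?subr_ge0//.
have -> : s = (1 - t) * s + t * s by ring.
by apply: lerD; rewrite ler_wpM2l// subr_ge0.
Qed.

Lemma analytic_cdiff f z : analytic_disk f -> disk z -> cdiff f z (derive1 f z).
Proof. by move=> af /af; exact: derivable_cdiff. Qed.

Lemma analytic_cont f z : analytic_disk f -> disk z -> {for z, continuous f}.
Proof. by move=> af /(analytic_cdiff af)/cdiff_cont. Qed.

Lemma disk_nbhs z : disk z -> 0 < 1 - cmod z /\ forall w, cmod (w - z) < 1 - cmod z -> disk w.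
Proof.
move=> dz; split; first by rewrite subr_gt0.
move=> w wz; rewrite /disk/=; have := cmod_sub_ge w z; move: wz => /[swap]; lra.
Qed.

Lemma analytic_derive1 f : analytic_disk f -> analytic_disk (derive1 f).
Proof.
move=> af z dz; have [r0 rD] := disk_nbhs dz.
have [w|d dP] := @holomorphic_derivative _ f (derive1 f) z _ r0; last exact: (cdiff_derivable dP).
by move=> /rD; exact: analytic_cdiff.
Qed.

Lemma analytic_zero_derive f : analytic_disk f -> (forall z, disk z -> derive1 f z = 0) ->
  forall z, disk z -> f z = f 0.
Proof.
move=> af f0 z dz; apply/eqP; rewrite -subr_eq0 -cmod_eq0 eq_le cmod_ge0 andbT.
have dt (t : R) : 0 <= t <= 1 -> disk (0 + t%:C * (z - 0)).
  move=> /andP[t0 t1]; rewrite add0r subr0 /disk/= cmodM cmod_real ger0_norm//.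
  by apply: le_lt_trans dz; rewrite ler_piMl ?cmod_ge0.
have := @cdiff_segment_lipschitz f (derive1 f) 0 z 0.
rewrite mul0r mulr0; apply.
- by move=> t /dt; exact: analytic_cdiff.
- by move=> t /dt /f0 ->; rewrite cmod0.
Qed.

Lemma closed_disc_disk c (s : R) z : cmod c + s < 1 -> cmod (z - c) <= s -> disk z.
Proof. by move=> cs zc; rewrite /disk/=; have := cmod_sub_ge z c; move: zc cs; lra. Qed.

Lemma eq_dint c (s : R) (u v : R[i] -> R) : (forall z, cmod (z - c) < s -> u z = v z) ->
  dint c s u = dint c s v.
Proof. by move=> uv; apply: eq_Rintegral => q; rewrite inE => /uv. Qed.

Lemma continuous_conjc : continuous (@conjc R).
Proof.
move=> z; apply/ccontP => e e0; exists e => // w.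
by rewrite -rmorphB cmodJ.
Qed.

(** Integrability of [u] is inherited from [v]: near every point other than [p] the two coincide, so
    [u] is continuous there. *)
Lemma eq_dint_punctured c p (s : R) (u v : R[i] -> R) M :
  (forall z, cmod (z - c) < s -> z != p -> {for z, continuous v}) ->
  (forall z, cmod (z - c) < s -> z != p -> `|v z| <= M) ->
  (forall z, cmod (z - c) < s -> z != p -> u z = v z) ->
  dint c s u = dint c s v.
Proof.
move=> cv vM uv; rewrite /dint /Rintegral; congr fine.
have mD : measurable (plane (disc c s)) by apply: measurable_plane; exact: open_disc.
have iv := disc_integrable_punctured cv vM.
have iu : mu2.-integrable (plane (disc c s)) (EFin \o (u \o @toC R)).
  apply: (@disc_integrable_punctured _ c p s u M) => z zc zp; last by rewrite uv// vM.
  have oA := @open_punctured_disc _ c p s.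
  have zA : (disc c s `\ p) z by split=> //; exact/eqP.
  have /nbhs_cmodP[r r0 rA] : nbhs z (disc c s `\ p) by exact: open_nbhs_nbhs.
  apply/rcontP => e e0; have [x x0 xP] := (rcontP _ _).1 (cv z zc zp) e e0.
  exists (Num.min r x); first by rewrite lt_min r0.
  move=> w; rewrite lt_min => /andP[/rA[wc /eqP wp] /xP].
  by rewrite -!uv.
apply: ae_eq_integral => //; [exact: measurable_int iu|exact: measurable_int iv|].
exists [set (Re p, Im p)]; split.
- rewrite (_ : [set _] = [set Re p] `*` [set Im p]).
    by apply: measurableX; exact: measurable_set1.
  by apply/seteqP; split => -[q1 q2] [/= -> ->].
- rewrite (_ : [set _] = [set Re p] `*` [set Im p]).
    have : mu2 ([set Re p] `*` [set Im p]) = 0%E.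
      rewrite product_measure1E; [|exact: measurable_set1..].
      by apply/eqP; rewrite mule_eq0; apply/orP; left; apply/eqP; exact: lebesgue_measure_set1.
    exact.
  by apply/seteqP; split => -[q1 q2] [/= -> ->].
- move=> q /= /not_implyP[qc uvq]; have [qp|qp] := eqVneq (toC q) p.
    by rewrite -qp /=; case: q {qc uvq qp}.
  by case: uvq; rewrite uv.
Qed.

(* The [zbar]-derivative of [(h / phi) G(|phi|^2)] is [h (phi')^* G'(|phi|^2)], and
   [(h / phi) G(|phi|^2)] vanishes on the circle; the last hypothesis bounds its
   derivatives near the point [a], where [phi] vanishes. *)
Lemma dint_quotient c a (s K : R) h E (G dG : R -> R) :
  let phi z := (z - a) * E z in
  let dphi z := (z - a) * derive1 E z + E z in
  0 < s -> cmod c + s < 1 ->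
  analytic_disk h -> analytic_disk E -> (forall z, disk z -> E z != 0) ->
  (forall z, cmod (z - c) <= s ->
    is_derive (cmod (phi z) ^+ 2) (1 : R) G (dG (cmod (phi z) ^+ 2))) ->
  (forall z, cmod (z - c) <= s -> {for cmod (phi z) ^+ 2, continuous dG}) ->
  (forall z, cmod (z - c) = s -> G (cmod (phi z) ^+ 2) = 0) ->
  (forall z, cmod (z - c) <= s -> z != a ->
    cmod (derive1 h z * phi z - h z * dphi z) * `|G (cmod (phi z) ^+ 2)| <= K * cmod (phi z) ^+ 2) ->
  dint c s (fun z => Re (h z * (dphi z)^*) * dG (cmod (phi z) ^+ 2)) = 0.
Proof.
move=> phi dphi s0 cs ah aE E0 dGP dG_cont G0 hK.
have inD z : cmod (z - c) <= s -> disk z by exact: closed_disc_disk.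
have ah1 := analytic_derive1 ah.
have aE1 := analytic_derive1 aE.
pose ddphi z := (z - a) * derive1 (derive1 E) z + 2 * derive1 E z.
have did z : cdiff (fun z => z - a) z 1.
  by apply: (cdiff_eq (cdiffB (cdiff_id z) (cdiff_cst a z))); rewrite subr0.
have dphiP z : disk z -> cdiff phi z (dphi z).
  move=> dz; apply: (cdiff_eq (cdiffM (did z) (analytic_cdiff aE dz))).
  by rewrite /dphi mulr1.
have ddphiP z : disk z -> cdiff dphi z (ddphi z).
  move=> dz; apply: (cdiff_eq (cdiffD (cdiffM (did z) (analytic_cdiff aE1 dz)) (analytic_cdiff aE dz))).
  by rewrite /ddphi; move: (derive1 (derive1 E) z) (derive1 E z) => u v; ring.
pose m z := h z * (phi z)^-1.
pose dm z := h z * - (dphi z / phi z ^+ 2) + (phi z)^-1 * derive1 h z.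
have phi0 z : disk z -> z != a -> phi z != 0.
  by move=> dz za; rewrite mulf_neq0 ?subr_eq0// E0.
have dmP z : disk z -> z != a -> cdiff m z (dm z).
  move=> dz za; apply: (cdiffM (analytic_cdiff ah dz)).
  by apply: cdiffV; [exact: phi0|exact: dphiP].
have dm_cont z : disk z -> z != a -> {for z, continuous dm}.
  move=> dz za; have cphi := cdiff_cont (dphiP z dz).
  have dinv := cdiffV (phi0 z dz za) (dphiP z dz).
  have dinv2 : cdiff (fun w => (phi w ^+ 2)^-1) z (- ((phi z * dphi z + phi z * dphi z) / (phi z * phi z) ^+ 2)).
    apply: (@cdiffV _ (fun w => phi w * phi w)); first by rewrite mulf_neq0// phi0.
    by apply: cdiffM; exact: dphiP.
  apply: (@ccontD _ (fun z => h z * - (dphi z / phi z ^+ 2)) (fun z => (phi z)^-1 * derive1 h z)).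
    apply: (@ccontM _ h (fun z => - (dphi z / phi z ^+ 2))); first exact: (analytic_cont ah dz).
    apply: cdiff_cont; apply: (@cdiffN _ (fun z => dphi z / phi z ^+ 2)).
    exact: (cdiffM (ddphiP z dz) dinv2).
  apply: (@ccontM _ (fun z => (phi z)^-1) (derive1 h)); first exact: (cdiff_cont dinv).
  exact: (analytic_cont ah1 dz).
have [M0 M00 hM0] : exists2 M, 0 <= M & forall z, cmod (z - c) <= s -> cmod (h z) <= M.
  by apply: closed_disc_bounded => z /inD; exact: analytic_cont.
have [P1 P10 dphiP1] : exists2 M, 0 <= M & forall z, cmod (z - c) <= s -> cmod (dphi z) <= M.
  by apply: closed_disc_bounded => z /inD dz; exact: (cdiff_cont (ddphiP z dz)).
have cphi2 z : cmod (z - c) <= s -> {for z, continuous (fun z => cmod (phi z) ^+ 2)}.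
  move=> /inD dz; have cphi := cdiff_cont (dphiP z dz).
  apply: (@continuous_comp _ _ _ (fun z => cmod (phi z)) (fun t : R => t ^+ 2)).
    by apply: (@continuous_comp _ _ _ phi (@cmod R)); [exact: cphi|exact: continuous_cmod].
  exact: exprn_continuous.
have [K1 K10 GK1] : exists2 M, 0 <= M & forall z, cmod (z - c) <= s -> `|dG (cmod (phi z) ^+ 2)| <= M.
  apply: closed_disc_rbounded => z zc.
  by apply: (@continuous_comp _ _ _ (fun z => cmod (phi z) ^+ 2) dG); [exact: cphi2|exact: dG_cont].
have mphi z : disk z -> z != a -> m z * phi z = h z.
  by move=> dz za; rewrite /m divfK// phi0.
pose v z := Re (h z * (dphi z)^*) * dG (cmod (phi z) ^+ 2).
pose u z := Re (m z * phi z * (dphi z)^*) * dG (cmod (phi z) ^+ 2).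
have uv z : disk z -> z != a -> u z = v z by move=> dz za; rewrite /u /v mphi.
have cv z : cmod (z - c) <= s -> {for z, continuous v}.
  move=> zc; have dz := inD z zc.
  have cRe : {for z, continuous (fun z => Re (h z * (dphi z)^*))}.
    apply: (@continuous_comp _ _ _ (fun z => h z * (dphi z)^*) (@Re R)); last exact: continuous_Re.
    apply: (@ccontM _ h (fun z => (dphi z)^*)); first exact: (analytic_cont ah dz).
    apply: (@continuous_comp _ _ _ dphi (@conjc R)); first exact: (cdiff_cont (ddphiP z dz)).
    exact: continuous_conjc.
  have cdG : {for z, continuous (fun z => dG (cmod (phi z) ^+ 2))}.
    by apply: (@continuous_comp _ _ _ (fun z => cmod (phi z) ^+ 2) dG); [exact: cphi2|exact: dG_cont].
  exact: (cvgM cRe cdG).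
have vB z : cmod (z - c) <= s -> `|v z| <= M0 * P1 * K1.
  move=> zc; rewrite /v normrM; apply: ler_pM => //; last exact: GK1.
  apply: le_trans (Re_cmod _) _; rewrite cmodM cmodJ.
  by apply: ler_pM; rewrite ?cmod_ge0//; [exact: hM0|exact: dphiP1].
(* [m * phi] is [h] except possibly at [a], where the inverse of zero is 0; a single point does not
   affect the integral. *)
have <- : dint c s u = dint c s v.
  apply: (@eq_dint_punctured c a s _ _ (M0 * P1 * K1)) => z zc.
  - by move=> _; apply: cv; exact: ltW.
  - by move=> _; apply: vB; exact: ltW.
  - by apply: uv; apply: inD; exact: ltW.
apply: (@green_formula _ c a s m dm phi dphi G dG K M0 P1 K1) => //.
- by move=> z /inD; exact: dphiP.
- by move=> z /inD dz; exact: (cdiff_cont (ddphiP z dz)).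
- by move=> z /inD; exact: dmP.
- by move=> z /inD; exact: dm_cont.
- move=> z /ltW zc za; have p0 := phi0 z (inD z zc) za.
  have -> : dm z = (derive1 h z * phi z - h z * dphi z) / phi z ^+ 2.
    rewrite /dm; move: (derive1 h z) (h z) (phi z) (dphi z) p0 => t1 t2 t3 t4 t30.
    by field.
  rewrite cmodM cmodV cmodX mulrAC ler_pdivrMr ?exprn_gt0 ?cmod_gt0//; exact: hK.
- by move=> z /ltW zc za; rewrite -cmodM mphi//; [exact: hM0|exact: inD].
- by move=> z /ltW; exact: dphiP1.
- by move=> z /ltW; exact: GK1.
Qed.

(** If [h a = 0], then [h' phi - h phi'] vanishes to second order at [a], as does [phi^2], because
    [E] has no zero. The required bound then holds whatever the value of [G] at 0. *)
Lemma dint_vanish c a (s : R) h E (G dG : R -> R) :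
  let phi z := (z - a) * E z in
  let dphi z := (z - a) * derive1 E z + E z in
  0 < s -> cmod c + s < 1 -> cmod (a - c) <= s ->
  analytic_disk h -> analytic_disk E -> (forall z, disk z -> E z != 0) -> h a = 0 ->
  (forall z, cmod (z - c) <= s ->
    is_derive (cmod (phi z) ^+ 2) (1 : R) G (dG (cmod (phi z) ^+ 2))) ->
  (forall z, cmod (z - c) <= s -> {for cmod (phi z) ^+ 2, continuous dG}) ->
  (forall z, cmod (z - c) = s -> G (cmod (phi z) ^+ 2) = 0) ->
  dint c s (fun z => Re (h z * (dphi z)^*) * dG (cmod (phi z) ^+ 2)) = 0.
Proof.
move=> phi dphi s0 cs ac ah aE E0 ha dGP dG_cont G0.
have inD z : cmod (z - c) <= s -> disk z by exact: closed_disc_disk.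
have ah1 := analytic_derive1 ah; have ah2 := analytic_derive1 ah1.
have aE1 := analytic_derive1 aE.
have did z : cdiff (fun z => z - a) z 1.
  by apply: (cdiff_eq (cdiffB (cdiff_id z) (cdiff_cst a z))); rewrite subr0.
have dphiP z : disk z -> cdiff phi z (dphi z).
  move=> dz; apply: (cdiff_eq (cdiffM (did z) (analytic_cdiff aE dz))).
  by rewrite /dphi mulr1.
have [M1 M10 hM1] : exists2 M, 0 <= M & forall z, cmod (z - c) <= s -> cmod (derive1 h z) <= M.
  by apply: closed_disc_bounded => z /inD; exact: analytic_cont.
have [M2 M20 hM2] : exists2 M, 0 <= M & forall z, cmod (z - c) <= s -> cmod (derive1 (derive1 h) z) <= M.
  by apply: closed_disc_bounded => z /inD; exact: analytic_cont.
have [N0 N00 EN0] : exists2 M, 0 <= M & forall z, cmod (z - c) <= s -> cmod (E z) <= M.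
  by apply: closed_disc_bounded => z /inD; exact: analytic_cont.
have [N1 N10 EN1] : exists2 M, 0 <= M & forall z, cmod (z - c) <= s -> cmod (derive1 E z) <= M.
  by apply: closed_disc_bounded => z /inD; exact: analytic_cont.
have [NV NV0 ENV] : exists2 M, 0 <= M & forall z, cmod (z - c) <= s -> cmod (E z)^-1 <= M.
  apply: closed_disc_bounded => z /inD dz.
  exact: (cdiff_cont (cdiffV (E0 z dz) (analytic_cdiff aE dz))).
have [K0 K00 GK0] : exists2 M, 0 <= M & forall z, cmod (z - c) <= s -> `|G (cmod (phi z) ^+ 2)| <= M.
  apply: closed_disc_rbounded => z zc; have cphi := cdiff_cont (dphiP z (inD z zc)).
  apply: (@continuous_comp _ _ _ (fun z => cmod (phi z) ^+ 2) G); last first.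
    by apply/differentiable_continuous/derivable1_diffP; have [] := dGP z zc.
  apply: (@continuous_comp _ _ _ (fun z => cmod (phi z)) (fun t : R => t ^+ 2)).
    by apply: (@continuous_comp _ _ _ phi (@cmod R)); [exact: cphi|exact: continuous_cmod].
  exact: exprn_continuous.
have hlin z : cmod (z - c) <= s -> cmod (h z) <= 2 * (M1 * cmod (z - a)).
  move=> zc; rewrite -[h z]subr0 -ha.
  apply: (@cdiff_segment_lipschitz h (derive1 h)) => t t01.
  - by apply: analytic_cdiff => //; apply: inD; exact: segment_closed_disc.
  - by apply: hM1; exact: segment_closed_disc.
have hquad z : cmod (z - c) <= s ->
    cmod (derive1 h z * (z - a) - h z) <= 2 * (M2 * cmod (z - a) * cmod (z - a)).
  move=> zc.
  (* [k] vanishes at [a] and its derivative is [h'' (w - a)]; the factor [w - a] gains the second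
     order. *)
  pose k w := derive1 h w * (w - a) - h w.
  have ka : k a = 0 by rewrite /k subrr mulr0 ha subrr.
  rewrite -[derive1 h z * (z - a) - h z]/(k z) -[k z]subr0 -ka.
  apply: (@cdiff_segment_lipschitz k (fun w => derive1 (derive1 h) w * (w - a))) => t t01.
  - have dw : disk (a + t%:C * (z - a)) by apply: inD; exact: segment_closed_disc.
    apply: (cdiff_eq (cdiffB (cdiffM (analytic_cdiff ah1 dw) (did _)) (analytic_cdiff ah dw))).
    by move: (derive1 (derive1 h) _) (derive1 h _) => u v; ring.
  - rewrite cmodM; apply: ler_pM; rewrite ?cmod_ge0//; first by apply: hM2; exact: segment_closed_disc.
    have /andP[t0 t1] := t01.
    rewrite [a + _]addrC addrK cmodM cmod_real ger0_norm//.
    by rewrite ler_piMl ?cmod_ge0.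
pose L := N0 * (2 * M2) + 2 * M1 * N1.
apply: (@dint_quotient c a s (L * NV ^+ 2 * K0)) => // z zc za.
have dz := inD z zc; have Ez := E0 z dz.
rewrite mulrAC; apply: ler_pM; rewrite ?cmod_ge0//; last exact: GK0.
have quad : cmod (derive1 h z * ((z - a) * E z) - h z * ((z - a) * derive1 E z + E z)) <=
    L * cmod (z - a) ^+ 2.
  have -> : derive1 h z * ((z - a) * E z) - h z * ((z - a) * derive1 E z + E z) =
    E z * (derive1 h z * (z - a) - h z) - h z * (derive1 E z * (z - a)).
    by move: (derive1 h z) (derive1 E z) (h z) (E z) => t1 t2 t3 t4; ring.
  apply: (le_trans (cmodBD _ _)); rewrite /L mulrDl; apply: lerD.
    rewrite cmodM -mulrA; apply: ler_pM; rewrite ?cmod_ge0//; first exact: EN0.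
    by rewrite expr2 -mulrA mulrA -mulrA; apply: le_trans (hquad z zc) _; rewrite -mulrA.
  rewrite !cmodM (_ : 2 * M1 * N1 * _ = 2 * (M1 * cmod (z - a)) * (N1 * cmod (z - a))); last by ring.
  apply: ler_pM; rewrite ?mulr_ge0 ?cmod_ge0//; first exact: hlin.
  by rewrite ler_wpM2r ?cmod_ge0// EN1.
apply: (le_trans quad).
have L0 : 0 <= L by rewrite /L addr_ge0// !mulr_ge0.
have pE : cmod (phi z) ^+ 2 = cmod (z - a) ^+ 2 * cmod (E z) ^+ 2 by rewrite /phi cmodM exprMn.
have H1 : 1 <= NV ^+ 2 * cmod (E z) ^+ 2.
  rewrite -exprMn exprn_ege1//.
  have -> : 1 = cmod (E z)^-1 * cmod (E z) by rewrite -cmodM mulVf// cmod1.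
  by rewrite ler_wpM2r ?cmod_ge0// ENV.
rewrite pE (_ : _ * _ * (_ * _) = L * cmod (z - a) ^+ 2 * (NV ^+ 2 * cmod (E z) ^+ 2)); last by ring.
by rewrite ler_peMr// mulr_ge0// exprn_ge0// cmod_ge0.
Qed.

(** * Integrals over discs of functions continuous on the closed disc *)

Definition closed_continuous c (s : R) (u : R[i] -> R) :=
  forall z, cmod (z - c) <= s -> {for z, continuous u}.

Lemma dint_integrable c (s : R) (u : R[i] -> R) : closed_continuous c s u ->
  mu2.-integrable (plane (disc c s)) (EFin \o (u \o @toC R)).
Proof.
move=> cu; have [M M0 uM] := closed_disc_rbounded cu.
apply: (@disc_integrable _ _ c s _ M) => //; first exact: open_disc.
- by move=> z /ltW; exact: cu.
- by move=> z /ltW; exact: uM.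
Qed.

Lemma dintB c (s : R) (u v : R[i] -> R) : closed_continuous c s u -> closed_continuous c s v ->
  dint c s (fun z => u z - v z) = dint c s u - dint c s v.
Proof.
move=> /dint_integrable iu /dint_integrable iv.
have mD : measurable (plane (disc c s)) by apply: measurable_plane; exact: open_disc.
exact: (RintegralB mD iu iv).
Qed.

Lemma dintZ c (s k : R) (u : R[i] -> R) : closed_continuous c s u ->
  dint c s (fun z => k * u z) = k * dint c s u.
Proof.
move=> /dint_integrable iu.
have mD : measurable (plane (disc c s)) by apply: measurable_plane; exact: open_disc.
exact: (RintegralZl k mD iu).
Qed.

Lemma dint_cst c (s k : R) : 0 < s -> dint c s (fun=> k) = k * (pi * s ^+ 2).
Proof.
move=> s0; have mD : measurable (plane (disc c s)) by apply: measurable_plane; exact: open_disc.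
rewrite /dint (Rintegral_cst mu2 mD); congr (_ * _).
by have := disc_area c s0 => /= ->.
Qed.

Lemma closed_continuous_Re c (s : R) f : (forall z, cmod (z - c) <= s -> {for z, continuous f}) ->
  closed_continuous c s (fun z => Re (f z)).
Proof.
by move=> cf z /cf cfz; apply: (@continuous_comp _ _ _ f (@Re R));
  [exact: cfz|exact: continuous_Re].
Qed.

Lemma closed_continuousM c (s : R) (u v : R[i] -> R) : closed_continuous c s u ->
  closed_continuous c s v -> closed_continuous c s (fun z => u z * v z).
Proof. by move=> cu cv z zc; exact: (cvgM (cu z zc) (cv z zc)). Qed.

Lemma closed_continuousB c (s : R) (u v : R[i] -> R) : closed_continuous c s u ->
  closed_continuous c s v -> closed_continuous c s (fun z => u z - v z).
Proof. by move=> cu cv z zc; exact: (cvgB (cu z zc) (cv z zc)). Qed.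

Lemma closed_continuous_cst c (s k : R) : closed_continuous c s (fun=> k).
Proof. by move=> z _; exact: cst_continuous. Qed.

(** The case [phi = z - c] of [dint_vanish], applied to [h - h c] with [G t = t - s^2]: its
    derivative is 1 and it vanishes on the circle. *)
Lemma mean_value c (s : R) h : 0 < s -> cmod c + s < 1 -> analytic_disk h ->
  dint c s (fun z => Re (h z)) = Re (h c) * (pi * s ^+ 2).
Proof.
move=> s0 cs ah.
have inD z : cmod (z - c) <= s -> disk z by exact: closed_disc_disk.
have a1 : analytic_disk (fun=> 1 : R[i]).
  by move=> z _; exact: (cdiff_derivable (cdiff_cst 1 z)).
have ahc : analytic_disk (fun z => h z - h c).
  by move=> z dz; exact: (cdiff_derivable (cdiffB (analytic_cdiff ah dz) (cdiff_cst (h c) z))).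
have cc : cmod (c - c) <= s by rewrite subrr cmod0 ltW.
have := @dint_vanish c c s (fun z => h z - h c) (fun=> 1) (fun t => t - s ^+ 2) (fun=> 1) s0 cs cc ahc a1.
rewrite subrr => /(_ (fun _ _ => oner_neq0 _) erefl) H.
have : dint c s (fun z => Re (h z) - Re (h c)) = 0.
  rewrite -[RHS]H.
  - apply: eq_dint => z _.
    rewrite (cdiff_derive1 (cdiff_cst 1 z)) mulr0 add0r mulr1 -ReB.
    congr Re; rewrite -[LHS]mulr1; congr (_ * _).
    by apply: cplx_eq => /=; rewrite ?oppr0.
  - move=> z _; apply: is_derive_eq; rewrite subr0//.
  - by move=> z _; exact: cst_continuous.
  - by move=> z zc; rewrite mulr1 zc subrr.
rewrite dintB; last 2 first.
- by apply: closed_continuous_Re => z /inD; exact: analytic_cont.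
- exact: closed_continuous_cst.
by rewrite dint_cst// => /eqP; rewrite subr_eq0 => /eqP.
Qed.

(** * Moebius maps and their derivatives *)

Definition moebius_factor (a z : R[i]) : R[i] := - (1 - a^* * z)^-1.

Definition dmoebius (a z : R[i]) : R[i] := - ((1 - cmod a ^+ 2)%:C / (1 - a^* * z) ^+ 2).

Lemma moebiusE a z : moebius a z = (z - a) * moebius_factor a z.
Proof. by rewrite /moebius /moebius_factor mulrN -mulNr opprB. Qed.

Lemma disk0 : disk (0 : R[i]).
Proof. by rewrite /disk/= cmod0 ltr01. Qed.

Lemma moebius_den_neq0 a z : disk a -> disk z -> 1 - a^* * z != 0.
Proof.
move=> da dz; rewrite -cmod_gt0; apply: lt_le_trans (cmod_sub_ge _ _).
rewrite cmod1 subr_gt0 cmodM cmodJ.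
by apply: le_lt_trans dz; rewrite ler_piMl ?cmod_ge0// ltW.
Qed.

Lemma one_sub_sqr_gt0 a : disk a -> 0 < 1 - cmod a ^+ 2.
Proof. by move=> da; rewrite subr_gt0 expr_lt1// cmod_ge0. Qed.

Lemma cdiff_moebius_den a z : cdiff (fun z => 1 - a^* * z) z (- a^*).
Proof.
apply: (cdiff_eq (cdiffB (cdiff_cst 1 z) (cdiff_cmul a^* (cdiff_id z)))).
by rewrite mulr1 sub0r.
Qed.

Lemma cdiff_moebius_factor a z : disk a -> disk z ->
  cdiff (moebius_factor a) z (- (a^* / (1 - a^* * z) ^+ 2)).
Proof.
move=> da dz; have d0 := moebius_den_neq0 da dz.
apply: (cdiff_eq (cdiffN (@cdiffV _ (fun z => 1 - a^* * z) z _ d0 (cdiff_moebius_den a z)))).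
by rewrite mulNr opprK.
Qed.

Lemma conj_mul a : a^* * a = (cmod a ^+ 2)%:C.
Proof. by rewrite mulrC mulcJ. Qed.

Lemma dmoebiusE a z : disk a -> disk z ->
  (z - a) * derive1 (moebius_factor a) z + moebius_factor a z = dmoebius a z.
Proof.
move=> da dz; rewrite (cdiff_derive1 (cdiff_moebius_factor da dz)).
have d0 := moebius_den_neq0 da dz.
rewrite /dmoebius /moebius_factor rmorphB rmorph1/= -conj_mul.
by move: d0; move: (a^*) => b d0; field.
Qed.

Lemma cdiff_moebius a z : disk a -> disk z -> cdiff (moebius a) z (dmoebius a z).
Proof.
move=> da dz; rewrite -dmoebiusE//.
have -> : moebius a = (fun z => (z - a) * moebius_factor a z).
  by apply/funext => w; exact: moebiusE.
have H := cdiffM (cdiffB (cdiff_id z) (cdiff_cst a z)) (cdiff_moebius_factor da dz).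
apply: (cdiff_eq H); rewrite (cdiff_derive1 (cdiff_moebius_factor da dz)).
by rewrite subr0 mulr1.
Qed.

Lemma analytic_moebius_factor a : disk a -> analytic_disk (moebius_factor a).
Proof. by move=> da z dz; exact: (cdiff_derivable (cdiff_moebius_factor da dz)). Qed.

Lemma analytic_moebius a : disk a -> analytic_disk (moebius a).
Proof. by move=> da z dz; exact: (cdiff_derivable (cdiff_moebius da dz)). Qed.

Lemma derive1_moebius a z : disk a -> disk z -> derive1 (moebius a) z = dmoebius a z.
Proof. by move=> da dz; exact: (cdiff_derive1 (cdiff_moebius da dz)). Qed.

Lemma cdiff_dmoebius a z : disk a -> disk z ->
  cdiff (dmoebius a) z (- ((1 - cmod a ^+ 2)%:C * (2 * a^* / (1 - a^* * z) ^+ 3))).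
Proof.
move=> da dz; have d0 := moebius_den_neq0 da dz.
have d20 : (1 - a^* * z) * (1 - a^* * z) != 0 by rewrite mulf_neq0.
have H := @cdiffV _ (fun z => (1 - a^* * z) * (1 - a^* * z)) z _ d20 (cdiffM (cdiff_moebius_den a z) (cdiff_moebius_den a z)).
apply: (cdiff_eq (cdiffN (cdiff_cmul (1 - cmod a ^+ 2)%:C H))).
by move: d0; move: (a^*) ((1 - cmod a ^+ 2)%:C) => b t d0; field.
Qed.

Lemma analytic_dmoebius a : disk a -> analytic_disk (dmoebius a).
Proof. by move=> da z dz; exact: (cdiff_derivable (cdiff_dmoebius da dz)). Qed.

Lemma moebius_defect a z : disk a -> disk z ->
  1 - cmod (moebius a z) ^+ 2 = (1 - cmod a ^+ 2) * (1 - cmod z ^+ 2) / cmod (1 - a^* * z) ^+ 2.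
Proof.
move=> da dz; have d0 : cmod (1 - a^* * z) ^+ 2 != 0.
  by rewrite expf_neq0// cmod_eq0 moebius_den_neq0.
apply: (mulIf d0); rewrite mulfVK// mulrBl mul1r cmodM cmodV exprMn exprVn mulfVK//.
by rewrite !sqr_cmod; case: a {da d0} => a1 a2; case: z {dz} => x y /=; ring.
Qed.

Lemma cmod_dmoebius a z : disk a -> disk z ->
  cmod (dmoebius a z) * (1 - cmod z ^+ 2) = 1 - cmod (moebius a z) ^+ 2.
Proof.
move=> da dz; rewrite moebius_defect// /dmoebius cmodN cmodM cmodV cmodX cmod_real.
by rewrite ger0_norm ?ltW ?one_sub_sqr_gt0// mulrAC.
Qed.

Lemma cmod_moebius_lt1 a z : disk a -> disk z -> cmod (moebius a z) < 1.
Proof.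
move=> da dz; have : 0 < 1 - cmod (moebius a z) ^+ 2.
  rewrite moebius_defect//; apply: divr_gt0.
    by apply: mulr_gt0; exact: one_sub_sqr_gt0.
  by rewrite exprn_gt0// cmod_gt0 moebius_den_neq0.
by rewrite subr_gt0 expr_lt1// cmod_ge0.
Qed.

Lemma dmoebius_neq0 a z : disk a -> disk z -> dmoebius a z != 0.
Proof.
move=> da dz; rewrite oppr_eq0 mulf_neq0//.
  by rewrite -cmod_gt0 cmod_real normr_gt0 gt_eqF// one_sub_sqr_gt0.
by rewrite invr_eq0 expf_neq0// moebius_den_neq0.
Qed.

(** Together with [pseudo_radius], the Euclidean description of the pseudo-hyperbolic disc
    [cmod (moebius a z) < r]. *)
Definition pseudo_center a (r : R) : R[i] := ((1 - r ^+ 2) / (1 - r ^+ 2 * cmod a ^+ 2))%:C * a.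
Definition pseudo_radius a (r : R) : R := r * (1 - cmod a ^+ 2) / (1 - r ^+ 2 * cmod a ^+ 2).

(** * Pseudo-hyperbolic discs as Euclidean discs *)

Section PseudoDisc.
Variables (a : R[i]) (r : R).
Hypotheses (da : disk a) (r01 : 0 < r < 1).
Let c := pseudo_center a r.
Let s := pseudo_radius a r.
Let k := 1 - r ^+ 2 * cmod a ^+ 2.

Let r0 : 0 < r. Proof. by case/andP: r01. Qed.
Let r1 : r < 1. Proof. by case/andP: r01. Qed.
Let r21 : r ^+ 2 < 1. Proof. by rewrite expr_lt1// ltW. Qed.
Let a1 : 0 < 1 - cmod a ^+ 2. Proof. exact: one_sub_sqr_gt0. Qed.

Let k0 : 0 < k.
Proof.
rewrite /k subr_gt0; apply: le_lt_trans r21.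
by rewrite ler_piMr ?sqr_ge0//; move: a1; rewrite subr_gt0 => /ltW.
Qed.

Lemma pseudo_radius_gt0 : 0 < s.
Proof. by rewrite /s /pseudo_radius divr_gt0// mulr_gt0. Qed.

(** Expanding the two moduli and completing the square in [z]; the formulas for centre and radius
    originate here. *)
Lemma pseudo_disc_eq z : cmod (a - z) ^+ 2 - r ^+ 2 * cmod (1 - a^* * z) ^+ 2 =
  k * (cmod (z - c) ^+ 2 - s ^+ 2).
Proof.
have kn0 : k != 0 by rewrite gt_eqF.
move: kn0; rewrite /s /c /pseudo_radius /pseudo_center /k !sqr_cmod.
case: a => x y; case: z => u v /= kn0.
by field.
Qed.

Lemma pseudo_center_radius : cmod c + s < 1.
Proof.
have kn0 : k != 0 by rewrite gt_eqF.
have r2 : 0 <= 1 - r ^+ 2 by rewrite subr_ge0 ltW.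
rewrite /c /s /pseudo_center /pseudo_radius -/k cmodM cmod_real ger0_norm ?divr_ge0 ?(ltW k0)//.
rewrite mulrAC -mulrDl ltr_pdivrMr// mul1r /k.
(* Cleared of its denominator [k], the difference [1 - (cmod c + s)] factors as the product shown
   positive next. *)
have ha := cmod_ge0 a; have ha1 : cmod a < 1 by [].
have : 0 < (1 - r) * (1 - cmod a) * (1 - r * cmod a).
  rewrite !mulr_gt0 ?subr_gt0//; apply: le_lt_trans ha1.
  by rewrite ler_piMl// ltW.
set A := cmod a; move=> H; rewrite -subr_gt0; move: H.
by congr (0 < _); ring.
Qed.

Lemma pseudo_center_close : cmod (a - c) <= s.
Proof.
have kn0 : k != 0 by rewrite gt_eqF.
have -> : a - c = (r ^+ 2 * (1 - cmod a ^+ 2) / k)%:C * a.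
  have -> : r ^+ 2 * (1 - cmod a ^+ 2) / k = 1 - (1 - r ^+ 2) / k.
    by move: kn0; rewrite /k; move: (cmod a) => A kn0; field; rewrite exprMn.
  rewrite /c /pseudo_center -/k; move: (_ / k) => t.
  by rewrite rmorphB mulrBl rmorph1 mul1r.
rewrite cmodM cmod_real ger0_norm; last by rewrite divr_ge0 ?(ltW k0)// mulr_ge0 ?sqr_ge0 ?ltW.
rewrite /s /pseudo_radius -/k mulrAC ler_pM2r ?invr_gt0//.
rewrite mulrAC ler_pM2r// [r ^+ 2]expr2 -mulrA ler_piMr ?(ltW r0)//.
by apply: mulr_ile1; rewrite ?cmod_ge0 ?(ltW r0) ?(ltW r1)//; exact: ltW.
Qed.

Lemma pseudo_disc_disk z : cmod (z - c) <= s -> disk z.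
Proof. exact: closed_disc_disk pseudo_center_radius. Qed.

Let sqr_moebius z : disk z -> cmod (moebius a z) ^+ 2 - r ^+ 2 =
  k * (cmod (z - c) ^+ 2 - s ^+ 2) / cmod (1 - a^* * z) ^+ 2.
Proof.
move=> dz; rewrite -pseudo_disc_eq /moebius cmodM cmodV exprMn exprVn.
have d0 : cmod (1 - a^* * z) ^+ 2 != 0 by rewrite expf_neq0// cmod_eq0 moebius_den_neq0.
by rewrite mulrBl mulfK.
Qed.

Lemma pseudo_disc_bd z : cmod (z - c) = s -> cmod (moebius a z) ^+ 2 = r ^+ 2.
Proof.
move=> zc; have dz : disk z by apply: pseudo_disc_disk; rewrite zc.
by apply/eqP; rewrite -subr_eq0 sqr_moebius// zc subrr mulr0 mul0r.
Qed.

Lemma pseudo_disc_le z : cmod (z - c) <= s -> cmod (moebius a z) ^+ 2 <= r ^+ 2.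
Proof.
move=> zc; have dz := pseudo_disc_disk zc.
rewrite -subr_le0 sqr_moebius// pmulr_lle0 ?invr_gt0 ?exprn_gt0 ?cmod_gt0 ?moebius_den_neq0//.
rewrite pmulr_rle0// subr_le0 lerXn2r ?nnegrE ?cmod_ge0//.
exact: ltW pseudo_radius_gt0.
Qed.

Lemma pseudo_discP z : disk z -> (cmod (moebius a z) < r) = (cmod (z - c) < s).
Proof.
move=> dz; have s0 := pseudo_radius_gt0.
have -> : (cmod (moebius a z) < r) = (cmod (moebius a z) ^+ 2 - r ^+ 2 < 0).
  by rewrite subr_lt0 ltr_pXn2r ?nnegrE ?cmod_ge0// ltW.
rewrite sqr_moebius// pmulr_llt0 ?invr_gt0 ?exprn_gt0 ?cmod_gt0 ?moebius_den_neq0//.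
by rewrite pmulr_rlt0// subr_lt0 ltr_pXn2r ?nnegrE ?cmod_ge0// ltW.
Qed.

End PseudoDisc.

(** The constant [K] is left free: [(1 - r^2)^(al + 1)] makes the primitive vanish on the circle,
    and 1 makes it vanish at 0. *)
Lemma is_derive_defect_powR (al K t : R) : -1 < al -> t < 1 ->
  is_derive t (1 : R) (fun t : R => (K - (1 - t) `^ (al + 1)) / (al + 1)) ((1 - t) `^ al).
Proof.
move=> al1 t1.
have t0 : 0 < 1 - t by rewrite subr_gt0.
have al0 : al + 1 != 0 by rewrite gt_eqF//; lra.
have H1 : is_derive t (1 : R) (fun t : R => 1 - t) (-1).
  by apply: is_derive_eq; ring.
have H2 := @is_derive1_comp R _ (fun t : R => 1 - t) t _ _ (is_derive1_powR (al + 1) t0) H1.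
have H3 : is_derive t (1 : R) (fun t : R => K - (1 - t) `^ (al + 1))
    (0 - (al + 1) * (1 - t) `^ (al + 1 - 1) * -1).
  exact: (is_deriveB (is_derive_cst K t 1) H2).
have H4 := is_deriveM H3 (is_derive_cst (al + 1)^-1 t 1).
apply: (@is_derive_eq _ _ _ _ _ _ _ _ H4).
by rewrite addrK /GRing.scale/=; move: (_ `^ al) => u; field.
Qed.

Lemma continuous_defect_powR (al t : R) : t < 1 ->
  {for t, continuous (fun t : R => (1 - t) `^ al)}.
Proof.
move=> t1; have t0 : 0 < 1 - t by rewrite subr_gt0.
apply: (@continuous_comp _ _ _ (fun t : R => 1 - t) (fun u => u `^ al)).
  by apply: cvgB; [exact: cvg_cst|exact: cvg_id].
by have [d _] := is_derive1_powR al t0; apply/differentiable_continuous/derivable1_diffP.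
Qed.

(** * Weighted integrals over pseudo-hyperbolic discs *)

Section PseudoDiscIntegrals.
Variables (a : R[i]) (r al : R).
Hypotheses (da : disk a) (r01 : 0 < r < 1) (al1 : -1 < al).
Let c := pseudo_center a r.
Let s := pseudo_radius a r.
Let s0 : 0 < s. Proof. exact: pseudo_radius_gt0. Qed.
Let cs : cmod c + s < 1. Proof. exact: pseudo_center_radius. Qed.
Let ac : cmod (a - c) <= s. Proof. exact: pseudo_center_close. Qed.
Let inD z : cmod (z - c) <= s -> disk z. Proof. exact: closed_disc_disk. Qed.
Let r21 : r ^+ 2 < 1.
Proof. by case/andP: r01 => r0 r1; rewrite expr_lt1// ltW. Qed.
Let phi1 z : cmod (z - c) <= s -> cmod (moebius a z) ^+ 2 < 1.
Proof. by move=> zc; apply: le_lt_trans r21; exact: pseudo_disc_le. Qed.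
Let E0 z : disk z -> moebius_factor a z != 0.
Proof. by move=> dz; rewrite oppr_eq0 invr_eq0 moebius_den_neq0. Qed.

(** The exponent [al = q - 2] serves the linear term of the tangent inequality, and [al = 0] serves
    the computation of an area. *)
Lemma pseudo_disc_orthogonality h : analytic_disk h -> h a = 0 ->
  dint c s (fun z => Re (h z * (dmoebius a z)^*) *
    (1 - cmod (moebius a z) ^+ 2) `^ al) = 0.
Proof.
move=> ah ha.
pose G (t : R) : R := ((1 - r ^+ 2) `^ (al + 1) - (1 - t) `^ (al + 1)) / (al + 1).
have := @dint_vanish c a s h (moebius_factor a) G (fun t => (1 - t) `^ al) s0 cs ac ah
  (analytic_moebius_factor da) E0 ha.
move=> H; rewrite -[RHS]H.
- by apply: eq_dint => z /ltW/inD dz; rewrite dmoebiusE// -moebiusE.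
- by move=> z zc; rewrite -moebiusE; apply: is_derive_defect_powR => //; exact: phi1.
- by move=> z zc; rewrite -moebiusE; apply: continuous_defect_powR; exact: phi1.
- move=> z zc; rewrite -moebiusE (pseudo_disc_bd da r01 zc).
  by rewrite /G subrr mul0r.
Qed.

Let weight_cont (be : R) : closed_continuous c s (fun z => (1 - cmod (moebius a z) ^+ 2) `^ be).
Proof.
move=> z zc; have dz := inD zc.
have cm := cdiff_cont (cdiff_moebius da dz).
apply: (@continuous_comp _ _ _ (fun z => cmod (moebius a z) ^+ 2) (fun t : R => (1 - t) `^ be)).
  apply: (@continuous_comp _ _ _ (fun z => cmod (moebius a z)) (fun t : R => t ^+ 2)).
    by apply: (@continuous_comp _ _ _ (moebius a) (@cmod R)); [exact: cm|exact: continuous_cmod].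
  exact: exprn_continuous.
by apply: continuous_defect_powR; exact: phi1.
Qed.

Let dmoeb_cont z : cmod (z - c) <= s -> {for z, continuous (dmoebius a)}.
Proof. by move=> /inD dz; exact: (analytic_cont (analytic_dmoebius da) dz). Qed.

Let norm2_cont : closed_continuous c s (fun z => cmod (dmoebius a z) ^+ 2).
Proof.
move=> z /dmoeb_cont cd.
apply: (@continuous_comp _ _ _ (fun z => cmod (dmoebius a z)) (fun t : R => t ^+ 2)).
  by apply: (@continuous_comp _ _ _ (dmoebius a) (@cmod R)); [exact: cd|exact: continuous_cmod].
exact: exprn_continuous.
Qed.

Let kap : R := (1 - (1 - r ^+ 2) `^ (al + 1)) / (al + 1) / r ^+ 2.

(** Green's formula with [h = dmoebius a], which does not vanish at [a]; hence [G] has to vanish at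
    0 as well as at [r^2]. Subtracting [kap * t] achieves this, [kap] being the average of
    [(1 - t)^al] on [[0, r^2]]. *)
Lemma pseudo_disc_weight_average : dint c s (fun z => cmod (dmoebius a z) ^+ 2 *
    (1 - cmod (moebius a z) ^+ 2) `^ al) =
  (1 - (1 - r ^+ 2) `^ (al + 1)) / (al + 1) / r ^+ 2 * dint c s (fun z => cmod (dmoebius a z) ^+ 2).
Proof.
rewrite -/kap; pose G (t : R) : R := (1 - (1 - t) `^ (al + 1)) / (al + 1) - kap * t.
pose dG (t : R) : R := (1 - t) `^ al - kap.
have r0 : 0 < r by case/andP: r01.
have dGP (t : R) : t < 1 -> is_derive t (1 : R) G (dG t).
  move=> t1; have H := is_derive_defect_powR 1 al1 t1.
  have H2 : is_derive t (1 : R) (fun t : R => kap * t) kap.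
    by apply: is_derive_eq; rewrite /GRing.scale/=; ring.
  exact: (is_deriveB H H2).
have cdG (t : R) : t < 1 -> {for t, continuous dG}.
  by move=> t1; apply: cvgB; [exact: continuous_defect_powR|exact: cvg_cst].
have G0 : G 0 = 0 by rewrite /G subr0 powR1 subrr mul0r mulr0 subrr.
have Gr : G (r ^+ 2) = 0 by rewrite /G /kap mulfVK ?subrr// expf_neq0// gt_eqF.
(* Here [G 0 = 0] supplies the factor [|phi|^2] that the zero of [h] at [a] supplies in
   [dint_vanish]. *)
have [L GL] : exists L, forall t, 0 <= t <= r ^+ 2 -> `|G t| <= L * t.
  have [|t0 _ tmax] := @EVT_max R (fun t => `|dG t|) 0 (r ^+ 2) (sqr_ge0 r).
    apply: continuous_in_subspaceT => t; rewrite inE/= in_itv/= => /andP[_ tr].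
    apply: (@continuous_comp _ _ _ dG Num.Def.normr); last exact: norm_continuous.
    by apply: cdG; exact: le_lt_trans r21.
  exists `|dG t0| => t /andP[t00 tr].
  have [u| |u ut] := @MVT_segment R G dG 0 t t00.
  - by rewrite in_itv/= => /andP[_ ut]; apply: dGP; apply: lt_le_trans ut (le_trans tr (ltW r21)).
  - apply: continuous_in_subspaceT => u; rewrite inE/= in_itv/= => /andP[_ ut].
    have [d _] := dGP u (le_lt_trans (le_trans ut tr) r21).
    exact/differentiable_continuous/derivable1_diffP.
  rewrite G0 !subr0 => ->; rewrite normrM (ger0_norm t00) ler_wpM2r//.
  apply: tmax; move: ut; rewrite !in_itv/= => /andP[-> ut].
  exact: le_trans ut tr.
have adm := analytic_dmoebius da.
have [B B0 HB] : exists2 M, 0 <= M & forall z, cmod (z - c) <= s ->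
    cmod (derive1 (dmoebius a) z * moebius a z + - 1 * (dmoebius a z * dmoebius a z)) <= M.
  apply: closed_disc_bounded => z /inD dz.
  apply: (@ccontD _ (fun z => derive1 (dmoebius a) z * moebius a z)
    (fun z => - 1 * (dmoebius a z * dmoebius a z))).
    apply: (@ccontM _ (derive1 (dmoebius a)) (moebius a)).
      exact: (analytic_cont (analytic_derive1 adm) dz).
    exact: (analytic_cont (analytic_moebius da) dz).
  apply: (@ccontM _ (fun=> -1) (fun z => dmoebius a z * dmoebius a z)); first exact: ccont_cst.
  by apply: (@ccontM _ (dmoebius a) (dmoebius a)); exact: (analytic_cont adm dz).
have := @dint_quotient c a s (B * L) (dmoebius a) (moebius_factor a) G dG s0 cs adm
  (analytic_moebius_factor da) E0.
move=> H.
have : dint c s (fun z => cmod (dmoebius a z) ^+ 2 * (1 - cmod (moebius a z) ^+ 2) `^ al -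
    kap * cmod (dmoebius a z) ^+ 2) = 0.
  rewrite -[RHS]H.
  - apply: eq_dint => z /ltW/inD dz; rewrite dmoebiusE// -moebiusE mulcJ.
    by rewrite /dG mulrBr [kap * _]mulrC.
  - by move=> z zc; rewrite -moebiusE; apply: dGP; exact: phi1.
  - by move=> z zc; rewrite -moebiusE; apply: cdG; exact: phi1.
  - by move=> z zc; rewrite -moebiusE (pseudo_disc_bd da r01 zc).
  - move=> z zc za; rewrite (dmoebiusE da (inD zc)) -!moebiusE -mulrA.
    apply: ler_pM; rewrite ?cmod_ge0//.
      by apply: le_trans (HB z zc); rewrite mulN1r.
    by apply: GL; rewrite sqr_ge0/=; exact: pseudo_disc_le.
rewrite dintB; last 2 first.
- by apply: closed_continuousM => //; exact: weight_cont.
- by apply: closed_continuousM => //; exact: closed_continuous_cst.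
by rewrite dintZ// => /eqP; rewrite subr_eq0 => /eqP.
Qed.

End PseudoDiscIntegrals.

(** Orthogonality with exponent 0 for [dmoebius a z - dmoebius a a] turns [|phi_a'|^2] into the real
    number [phi_a'(a)] times [Re phi_a'], which the mean value property evaluates at the Euclidean
    centre. *)
Lemma pseudo_disc_area a (r : R) : disk a -> 0 < r < 1 ->
  dint (pseudo_center a r) (pseudo_radius a r) (fun z => cmod (dmoebius a z) ^+ 2) =
  pi * r ^+ 2.
Proof.
move=> da r01; set c := pseudo_center a r; set s := pseudo_radius a r.
have s0 : 0 < s by exact: pseudo_radius_gt0.
have cs : cmod c + s < 1 by exact: pseudo_center_radius.
have inD z : cmod (z - c) <= s -> disk z by exact: closed_disc_disk.
have dc : disk c by apply: inD; rewrite subrr cmod0 ltW.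
have adm := analytic_dmoebius da.
have cdm z : cmod (z - c) <= s -> {for z, continuous (dmoebius a)}.
  by move=> /inD dz; exact: (analytic_cont adm dz).
have ah : analytic_disk (fun z => dmoebius a z - dmoebius a a).
  move=> z dz.
  exact: (cdiff_derivable (cdiffB (analytic_cdiff adm dz) (cdiff_cst (dmoebius a a) z))).
have ltN10 : -1 < 0 :> R by rewrite ltrN10.
have H := pseudo_disc_orthogonality da r01 ltN10 ah (subrr _).
rewrite -/c -/s in H.
pose q := 1 - cmod a ^+ 2; have q0 : 0 < q by exact: one_sub_sqr_gt0.
have qn0 : q != 0 by rewrite gt_eqF.
have daa : dmoebius a a = (- q^-1)%:C.
  have qc0 : q%:C != 0 :> R[i] by rewrite -cmod_eq0 cmod_real normr_eq0.
  rewrite /dmoebius conj_mul -/q.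
  have -> : 1 - (cmod a ^+ 2)%:C = q%:C :> R[i] by rewrite /q rmorphB rmorph1.
  by rewrite rmorphN fmorphV/=; move: qc0; move: q%:C => t t0; field.
have H2 : dint c s (fun z => cmod (dmoebius a z) ^+ 2 - - q^-1 * Re (dmoebius a z)) = 0.
  rewrite -[RHS]H; apply: eq_dint => z _.
  rewrite powRr0 mulr1 mulrBl mulcJ daa ReB; congr (_ - _).
  by rewrite ReM/= mul0r subr0 ReJ.
have cRe : closed_continuous c s (fun z => Re (dmoebius a z)).
  exact: closed_continuous_Re.
have cn : closed_continuous c s (fun z => cmod (dmoebius a z) ^+ 2).
  move=> z zc; have cd := cdm z zc.
  apply: (@continuous_comp _ _ _ (fun z => cmod (dmoebius a z)) (fun t : R => t ^+ 2)).
    by apply: (@continuous_comp _ _ _ (dmoebius a) (@cmod R)); [exact: cd|exact: continuous_cmod].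
  exact: exprn_continuous.
have H3 := mean_value s0 cs adm.
rewrite dintB// in H2; last first.
  by apply: closed_continuousM => //; exact: closed_continuous_cst.
rewrite dintZ// H3 in H2; move/eqP: H2; rewrite subr_eq0 => /eqP ->.
pose k := 1 - r ^+ 2 * cmod a ^+ 2.
have k0 : k != 0.
  have /andP[r0 r1] := r01.
  rewrite gt_eqF// subr_gt0; apply: (@le_lt_trans _ _ (r ^+ 2)); last by rewrite expr_lt1// ltW.
  by rewrite ler_piMr ?sqr_ge0//; move: q0; rewrite subr_gt0 => /ltW.
have -> : dmoebius a c = (- (k ^+ 2 / q))%:C.
  have den : 1 - a^* * c = (q / k)%:C.
    have tE : q / k = 1 - (1 - r ^+ 2) / k * cmod a ^+ 2.
      by move: k0; rewrite /q /k; move: (cmod a) => A k0; field; rewrite exprMn.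
    rewrite /c /pseudo_center -/k mulrCA conj_mul tE; move: (cmod a ^+ 2) (_ / k) => A2 t.
    by rewrite rmorphB rmorphM rmorph1.
  rewrite /dmoebius den -/q -rmorphXn -fmorphV -rmorphM -rmorphN/=; congr _%:C.
  by move: k0 qn0; clearbody k q => k0 qn0; field; rewrite k0 qn0.
rewrite /s /pseudo_radius -/k -/q /=.
by move: k0 qn0; clearbody k q => k0 qn0; field; rewrite k0 qn0.
Qed.

Lemma pseudo_disc_weighted_area a (r al : R) : disk a -> 0 < r < 1 -> -1 < al ->
  dint (pseudo_center a r) (pseudo_radius a r) (fun z => cmod (dmoebius a z) ^+ 2 *
    (1 - cmod (moebius a z) ^+ 2) `^ al) =
  pi * (1 - (1 - r ^+ 2) `^ (al + 1)) / (al + 1).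
Proof.
move=> da r01 al1; rewrite pseudo_disc_weight_average// pseudo_disc_area//.
have al0 : al + 1 != 0 by rewrite gt_eqF//; lra.
have r0 : r != 0 by rewrite gt_eqF//; case/andP: r01.
by move: (_ `^ _) => u; field; rewrite al0 r0.
Qed.

(** Bernoulli's inequality, read off from Young's inequality for the product [x * 1] with exponents
    [q] and [q / (q - 1)]. *)
Lemma powR_tangent (q x : R) : 1 < q -> 0 <= x -> 1 + q * (x - 1) <= x `^ q.
Proof.
move=> q1 x0; have q0 : 0 < q by lra.
have p0 : 0 < q / (q - 1) by rewrite divr_gt0// subr_gt0.
have qn0 : q != 0 by rewrite gt_eqF.
have E : q^-1 + (q / (q - 1))^-1 = 1.
  by rewrite invf_div; field.
have := conjugate_powR x0 ler01 q0 p0 E; rewrite mulr1 powR1 => H.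
have q10 : q - 1 != 0 by rewrite gt_eqF// subr_gt0.
have E2 : q * (x `^ q / q + 1 / (q / (q - 1))) = x `^ q + (q - 1).
  by move: (x `^ q) => X; field; rewrite q10 qn0.
have : q * x <= q * (x `^ q / q + 1 / (q / (q - 1))) by rewrite ler_pM2l.
by rewrite E2; move: (x `^ q) => X; lra.
Qed.

(** Strictness follows from the inequality itself, applied at [s = sqrt x] and squared: the square
    of the tangent value at [s] exceeds the tangent value at [s^2] by [(q^2 - q) (s - 1)^2]. *)
Lemma powR_tangent_eq (q x : R) : 1 < q -> 0 <= x -> x `^ q = 1 + q * (x - 1) -> x = 1.
Proof.
move=> q1 x0 E; apply/eqP; apply: contraT => x1.
pose s := Num.sqrt x; have s0 : 0 <= s by exact: sqrtr_ge0.
have s2 : s ^+ 2 = x by rewrite sqr_sqrtr.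
have s1 : s != 1 by apply: contra x1 => /eqP sE; rewrite -s2 sE expr1n.
have Hs := powR_tangent q1 s0; set B := 1 + _ in Hs.
have xq : x `^ q = (s `^ q) ^+ 2.
  by rewrite -s2 [s ^+ 2]expr2 powRM// expr2.
have sq : 0 < (s - 1) ^+ 2 by rewrite exprn_even_gt0//= subr_eq0.
have [B0|B0] := leP 0 B.
  have : B ^+ 2 <= x `^ q by rewrite xq lerXn2r// nnegrE powR_ge0.
  rewrite E -s2 => H.
  have : 0 < (q ^+ 2 - q) * (s - 1) ^+ 2.
    by rewrite mulr_gt0// expr2 -{3}[q]mulr1 -mulrBr mulr_gt0//; lra.
  have -> : (q ^+ 2 - q) * (s - 1) ^+ 2 = B ^+ 2 - (1 + q * (s ^+ 2 - 1)).
    by rewrite /B; ring.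
  by rewrite subr_gt0 => H2; have := lt_le_trans H2 H; rewrite ltxx.
have sl1 : s < 1.
  move: B0; rewrite /B => B0; rewrite -subr_lt0 -(pmulr_rlt0 _ (_ : 0 < q)); lra.
have : s ^+ 2 <= s by rewrite expr2 ler_piMr// ltW.
have := powR_ge0 x q; rewrite E s2 => h1 h2.
have : q * (x - 1) <= q * (s - 1) by rewrite ler_pM2l; lra.
by move: B0; rewrite /B; lra.
Qed.

(** This is the scalar inequality at [x = |g| / |k|] combined with [Re (g conj k) <= |g| |k|].
    Equality forces [x = 1] and [Re (g conj k) = |k|^2], and then [|g - k|^2 = 0]. *)
Lemma cmod_powR_tangent (q : R) (g k : R[i]) : 1 < q -> k != 0 ->
  cmod k `^ q + q * (cmod k `^ (q - 2) * Re ((g - k) * k^*)) <= cmod g `^ q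
  /\ (cmod k `^ q + q * (cmod k `^ (q - 2) * Re ((g - k) * k^*)) = cmod g `^ q -> g = k).
Proof.
move=> q1 k0; have K0 : 0 < cmod k by rewrite cmod_gt0.
have q0 : 0 < q by lra.
have Kn0 : cmod k != 0 by rewrite gt_eqF.
pose x := cmod g / cmod k; have x0 : 0 <= x by rewrite divr_ge0 ?cmod_ge0.
have gE : cmod g = x * cmod k by rewrite divfK.
have kq : cmod k `^ q = cmod k `^ (q - 2) * cmod k ^+ 2.
  rewrite -powR_mulrn ?cmod_ge0// -powRD ?subrK//.
  by rewrite Kn0 implybT.
have A0 : 0 < cmod k `^ (q - 2) by exact: powR_gt0.
have ReE : Re ((g - k) * k^*) = Re (g * k^*) - cmod k ^+ 2.
  by rewrite mulrBl mulcJ ReB.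
have Rle : Re (g * k^*) <= x * cmod k ^+ 2.
  apply: (le_trans (ler_norm _)); apply: (le_trans (Re_cmod _)).
  by rewrite cmodM cmodJ gE -mulrA.
have T := powR_tangent q1 x0.
have gq : cmod g `^ q = x `^ q * (cmod k `^ (q - 2) * cmod k ^+ 2).
  by rewrite gE powRM ?cmod_ge0// kq.
set A := cmod k `^ (q - 2) in A0 kq gq *; set K2 := cmod k ^+ 2 in kq gq ReE Rle *.
have K20 : 0 < K2 by rewrite exprn_gt0.
have step1 : A * K2 + q * (A * Re ((g - k) * k^*)) <= A * K2 * (1 + q * (x - 1)).
  have -> : A * K2 * (1 + q * (x - 1)) = A * K2 + q * (A * (x * K2 - K2)) by ring.
  by rewrite lerD2l ler_pM2l// ler_pM2l// ReE lerD2r.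
have step2 : A * K2 * (1 + q * (x - 1)) <= x `^ q * (A * K2).
  by rewrite mulrC ler_pM2r// mulr_gt0.
rewrite kq gq; split; first exact: le_trans step1 step2.
move=> E.
have E2 : x `^ q = 1 + q * (x - 1).
  have AK0 : 0 < A * K2 by rewrite mulr_gt0.
  move: step1; rewrite E [leRHS]mulrC ler_pM2r// => T2.
  by apply/eqP; rewrite eq_le T2 T.
have x1 := powR_tangent_eq q1 x0 E2.
have Re1 : Re (g * k^*) = K2.
  move: E; rewrite x1 powR1 mul1r => /eqP; rewrite -subr_eq0 addrC addKr.
  by rewrite mulf_eq0 mulf_eq0 (gt_eqF q0) (gt_eqF A0)/= ReE subr_eq0 => /eqP.
apply/eqP; rewrite -subr_eq0 -cmod_eq0 -sqrf_eq0.
have -> : cmod (g - k) ^+ 2 = cmod g ^+ 2 + K2 - 2 * Re (g * k^*).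
  by rewrite /K2 !sqr_cmod; case: g {ReE Rle Re1 gE gq E x x0 T step1 step2 x1 E2} => g1 g2; case: k {k0 K0 Kn0 kq A A0 K2 K20} => k1 k2 /=; ring.
by rewrite Re1 gE x1 mul1r -/K2; apply/eqP; ring.
Qed.

Lemma continuous_cmod_powR (q : R) g z : 0 < q -> {for z, continuous g} ->
  {for z, continuous (fun w => cmod (g w) `^ q)}.
Proof.
move=> q0 cg.
have cc : {for z, continuous (fun w => cmod (g w))}.
  by apply: (@continuous_comp _ _ _ g (@cmod R)); [exact: cg|exact: continuous_cmod].
have [g0|g0] := eqVneq (g z) 0; last first.
  have gz : 0 < cmod (g z) by rewrite cmod_gt0.
  apply: (@continuous_comp _ _ _ (fun w => cmod (g w)) (fun t => t `^ q)); first exact: cc.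
  by have [d _] := is_derive1_powR q gz; apply/differentiable_continuous/derivable1_diffP.
apply/rcontP => e e0.
have e1 : 0 < e `^ q^-1 by exact: powR_gt0.
have [x x0 xP] := (rcontP _ _).1 cc _ e1.
exists x => // w /xP; rewrite g0 cmod0 subr0 ger0_norm ?cmod_ge0// => we.
rewrite powR0 ?gt_eqF// subr0 ger0_norm ?powR_ge0//.
have -> : e = (e `^ q^-1) `^ q by rewrite -powRrM mulVf ?gt_eqF// powRr1// ltW.
by apply: gt0_ltr_powR; rewrite ?nnegrE ?cmod_ge0 ?powR_ge0.
Qed.

Lemma continuous_disk_weight (al : R) z : disk z ->
  {for z, continuous (fun w => (1 - cmod w ^+ 2) `^ al)}.
Proof.
move=> dz; apply: (@continuous_comp _ _ _ (fun z => cmod z ^+ 2) (fun t : R => (1 - t) `^ al)).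
  apply: (@continuous_comp _ _ _ (@cmod R) (fun t : R => t ^+ 2)); first exact: continuous_cmod.
  exact: exprn_continuous.
by apply: continuous_defect_powR; rewrite -subr_gt0 one_sub_sqr_gt0.
Qed.

(** * The Bergman integral compared with its extremal function at one point *)

Section BergmanPoint.
Variables (q : R) (g : R[i] -> R[i]) (a : R[i]).
Hypotheses (q1 : 1 < q) (ag : analytic_disk g) (da : disk a) (ga : g a != 0).

Definition bergman_density (q : R) (g : R[i] -> R[i]) (z : R[i]) : R :=
  cmod (g z) `^ q * (1 - cmod z ^+ 2) `^ (q - 2).

Let lam := g a / dmoebius a a.
Let k z := lam * dmoebius a z.

Let lam0 : lam != 0.
Proof. by rewrite mulf_neq0// invr_eq0 dmoebius_neq0. Qed.

Let weight z := (1 - cmod (moebius a z) ^+ 2) `^ (q - 2).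

(** The gap in the tangent inequality between [g] and [k], times the area weight. Absorbing that
    weight into powers of [|phi_a'|] leaves two subtracted terms with known integrals. *)
Definition bergman_excess z : R := bergman_density q g z
  - cmod lam `^ q * (cmod (dmoebius a z) ^+ 2 * weight z)
  - q * cmod lam `^ (q - 2) * (Re (lam^* * (g z - k z) * (dmoebius a z)^*) * weight z).

Let cmod_lam : cmod lam = cmod (g a) * (1 - cmod a ^+ 2).
Proof.
rewrite /lam cmodM cmodV; congr (_ * _).
have H := cmod_dmoebius da da.
have m0 : moebius a a = 0 by rewrite /moebius subrr mul0r.
rewrite m0 cmod0 expr0n subr0 in H.
have d0 : cmod (dmoebius a a) != 0 by rewrite cmod_eq0 dmoebius_neq0.
by apply: (mulfI d0); rewrite divff// H.
Qed.

Let weight_dmoebius z (be : R) : disk z ->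
  cmod (dmoebius a z) `^ be * (1 - cmod z ^+ 2) `^ be = (1 - cmod (moebius a z) ^+ 2) `^ be.
Proof.
by move=> dz; rewrite -powRM ?cmod_ge0 ?(ltW (one_sub_sqr_gt0 dz))// cmod_dmoebius.
Qed.

Let excessE z : disk z -> bergman_excess z =
  (cmod (g z) `^ q - (cmod (k z) `^ q + q * (cmod (k z) `^ (q - 2) *
     Re ((g z - k z) * (k z)^*)))) * (1 - cmod z ^+ 2) `^ (q - 2).
Proof.
move=> dz; rewrite /bergman_excess /bergman_density /weight -(weight_dmoebius (q - 2) dz).
have dm0 : cmod (dmoebius a z) != 0 by rewrite cmod_eq0 dmoebius_neq0.
rewrite /k (cmodM lam) !(powRM _ (cmod_ge0 lam) (cmod_ge0 (dmoebius a z))).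
have -> : cmod (dmoebius a z) `^ q = cmod (dmoebius a z) ^+ 2 * cmod (dmoebius a z) `^ (q - 2).
  rewrite -powR_mulrn ?cmod_ge0// -powRD; first by congr (_ `^ _); ring.
  by rewrite dm0 implybT.
have -> : Re ((g z - lam * dmoebius a z) * (lam * dmoebius a z)^*) =
  Re (lam^* * (g z - lam * dmoebius a z) * (dmoebius a z)^*).
  by congr Re; rewrite rmorphM mulrCA mulrA.
move: (Re _) (cmod lam) (cmod (g z)) (cmod (dmoebius a z)) (cmod z) => X L G D Z.
by ring.
Qed.

Lemma bergman_excess_ge0 z : disk z -> 0 <= bergman_excess z.
Proof.
move=> dz; rewrite excessE// mulr_ge0 ?powR_ge0// subr_ge0.
have k0 : k z != 0 by rewrite mulf_neq0// dmoebius_neq0.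
by have [] := cmod_powR_tangent (g z) q1 k0.
Qed.

Lemma bergman_excess_eq0 z : disk z -> bergman_excess z = 0 -> g z = lam * dmoebius a z.
Proof.
move=> dz; rewrite excessE// => /eqP; rewrite mulf_eq0 => /orP[|].
  rewrite subr_eq0 => /eqP E.
  have k0 : k z != 0 by rewrite mulf_neq0// dmoebius_neq0.
  by have [_ ->] := cmod_powR_tangent (g z) q1 k0.
by rewrite gt_eqF// powR_gt0// one_sub_sqr_gt0.
Qed.

Let cg z : disk z -> {for z, continuous g}.
Proof. exact: analytic_cont. Qed.

Let cdm z : disk z -> {for z, continuous (dmoebius a)}.
Proof. exact: (analytic_cont (analytic_dmoebius da)). Qed.

Let cweight z : disk z -> {for z, continuous weight}.
Proof.
move=> dz; have cm := analytic_cont (analytic_moebius da) dz.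
apply: (@continuous_comp _ _ _ (fun z => cmod (moebius a z) ^+ 2) (fun t : R => (1 - t) `^ (q - 2))).
  apply: (@continuous_comp _ _ _ (fun z => cmod (moebius a z)) (fun t : R => t ^+ 2)).
    by apply: (@continuous_comp _ _ _ (moebius a) (@cmod R)); [exact: cm|exact: continuous_cmod].
  exact: exprn_continuous.
by apply: continuous_defect_powR; rewrite expr_lt1 ?cmod_ge0// cmod_moebius_lt1.
Qed.

Lemma continuous_bergman_density z : disk z -> {for z, continuous (bergman_density q g)}.
Proof.
move=> dz; have q0 : 0 < q := lt_trans ltr01 q1.
exact: (cvgM (continuous_cmod_powR q0 (cg dz)) (@continuous_disk_weight (q - 2) z dz)).
Qed.

Let part1 z := cmod (dmoebius a z) ^+ 2 * weight z.
Let part2 z := Re (lam^* * (g z - k z) * (dmoebius a z)^*) * weight z.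

Let cpart1 z : disk z -> {for z, continuous part1}.
Proof.
move=> dz; have c1 : {for z, continuous (fun z => cmod (dmoebius a z) ^+ 2)}.
  apply: (@continuous_comp _ _ _ (fun z => cmod (dmoebius a z)) (fun t : R => t ^+ 2)).
    by apply: (@continuous_comp _ _ _ (dmoebius a) (@cmod R)); [exact: cdm|exact: continuous_cmod].
  exact: exprn_continuous.
exact: (cvgM c1 (cweight dz)).
Qed.

Let h z := lam^* * (g z - k z).

Let ah : analytic_disk h.
Proof.
move=> z dz; have adm := analytic_dmoebius da.
exact: (cdiff_derivable (cdiff_cmul lam^* (cdiffB (analytic_cdiff ag dz)
  (cdiff_cmul lam (analytic_cdiff adm dz))))).
Qed.

Let cpart2 z : disk z -> {for z, continuous part2}.
Proof.
move=> dz; have c1 : {for z, continuous (fun z => Re (h z * (dmoebius a z)^*))}.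
  apply: (@continuous_comp _ _ _ (fun z => h z * (dmoebius a z)^*) (@Re R)); last exact: continuous_Re.
  apply: (@ccontM _ h (fun z => (dmoebius a z)^*)); first exact: (analytic_cont ah dz).
  by apply: (@continuous_comp _ _ _ (dmoebius a) (@conjc R)); [exact: cdm|exact: continuous_conjc].
exact: (cvgM c1 (cweight dz)).
Qed.

Lemma continuous_bergman_excess z : disk z -> {for z, continuous bergman_excess}.
Proof.
move=> dz; have c0 := continuous_bergman_density dz.
rewrite (_ : bergman_excess = fun z => bergman_density q g z - cmod lam `^ q * part1 z -
  q * cmod lam `^ (q - 2) * part2 z)//.
have cB (u v : R[i] -> R) : {for z, continuous u} -> {for z, continuous v} ->
    {for z, continuous (fun w => u w - v w)} by move=> cu cv; exact: (cvgB cu cv).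
have cM (k' : R) (v : R[i] -> R) : {for z, continuous v} ->
    {for z, continuous (fun w => k' * v w)}.
  move=> cv; have ck : {for z, continuous (fun _ : R[i] => k')} by exact: cst_continuous.
  exact: (cvgM ck cv).
apply: (cB (fun z => bergman_density q g z - cmod lam `^ q * part1 z)
  (fun z => q * cmod lam `^ (q - 2) * part2 z)); last exact/cM/cpart2.
by apply: (cB (bergman_density q g)); [exact: c0|exact/cM/cpart1].
Qed.

(** Since [|phi_a'(a)| (1 - |a|^2) = 1], the modulus of [lam] is the Bloch quantity of [g] at [a].
    The linear term integrates to 0 because [g - k] vanishes at [a]. *)
Lemma dint_bergman_density (r : R) : 0 < r < 1 ->
  dint (pseudo_center a r) (pseudo_radius a r) (bergman_density q g) =
  (cmod (g a) * (1 - cmod a ^+ 2)) `^ q * (pi * (1 - (1 - r ^+ 2) `^ (q - 1)) / (q - 1)) +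
  dint (pseudo_center a r) (pseudo_radius a r) bergman_excess.
Proof.
move=> r01; set c := pseudo_center a r; set s := pseudo_radius a r.
have inD z : cmod (z - c) <= s -> disk z by exact: pseudo_disc_disk.
have cc0 : closed_continuous c s (bergman_density q g).
  by move=> z /inD; exact: continuous_bergman_density.
have cc1 : closed_continuous c s part1 by move=> z /inD; exact: cpart1.
have cc2 : closed_continuous c s part2 by move=> z /inD; exact: cpart2.
have ck b u : closed_continuous c s u -> closed_continuous c s (fun z => b * u z).
  by move=> cu; apply: closed_continuousM => //; exact: closed_continuous_cst.
have al1 : -1 < q - 2 by have := q1; lra.
have A1 : dint c s part1 = pi * (1 - (1 - r ^+ 2) `^ (q - 1)) / (q - 1).
  have := pseudo_disc_weighted_area da r01 al1.
  by rewrite (_ : q - 2 + 1 = q - 1)//; ring.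
have h0 : h a = 0.
  rewrite /h /k /lam divfK; first by rewrite subrr mulr0.
  exact: dmoebius_neq0.
have A2 : dint c s part2 = 0 := pseudo_disc_orthogonality da r01 al1 ah h0.
have -> : dint c s bergman_excess = dint c s (bergman_density q g)
    - cmod lam `^ q * dint c s part1 - q * cmod lam `^ (q - 2) * dint c s part2.
  rewrite -(dintZ _ cc1) -(dintZ _ cc2) -dintB//; last exact: ck.
  rewrite -dintB//; last exact: ck.
  by apply: closed_continuousB => //; exact: ck.
by rewrite A2 A1 cmod_lam; move: (_ `^ q) (dint _ _ _) => u v; ring.
Qed.

End BergmanPoint.

Lemma dint_EFin c (s : R) (u : R[i] -> R) : closed_continuous c s u ->
  (\int[mu2]_(p in plane (disc c s)) (u (toC p))%:E = (dint c s u)%:E)%E.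
Proof.
move=> /dint_integrable iu; rewrite /dint /Rintegral fineK//.
apply: integrable_fin_num; last exact: iu.
by apply: measurable_plane; exact: open_disc.
Qed.

Lemma measurable_fun_disk (A : set R[i]) (u : R[i] -> R) : open A ->
  (forall z, A z -> {for z, continuous u}) ->
  measurable_fun (plane A) (fun p : R2 => (u (toC p))%:E).
Proof.
by move=> oA cu; apply/measurable_EFinP; exact: (measurable_fun_plane oA cu).
Qed.

Lemma dint_ge0 c (s : R) (u : R[i] -> R) : (forall z, cmod (z - c) < s -> 0 <= u z) ->
  0 <= dint c s u.
Proof. by move=> u0; apply: Rintegral_ge0 => p /u0. Qed.

Lemma dint_subset c (s : R) c' (s' : R) (u : R[i] -> R) :
  closed_continuous c s u -> closed_continuous c' s' u ->
  (forall z, cmod (z - c') < s' -> cmod (z - c) < s) ->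
  (forall z, cmod (z - c) < s -> 0 <= u z) -> dint c' s' u <= dint c s u.
Proof.
move=> cu cu' sub u0; rewrite -lee_fin -!dint_EFin//.
apply: ge0_subset_integral.
- by apply: measurable_plane; exact: open_disc.
- by apply: measurable_plane; exact: open_disc.
- by apply: measurable_fun_disk => [|z /ltW/cu//]; exact: open_disc.
- by move=> p /u0; rewrite lee_fin.
- by move=> p /sub.
Qed.

(** Otherwise [u] exceeds half of a positive value on a small disc, whose area is positive. *)
Lemma dint_eq0 c (s : R) (u : R[i] -> R) : closed_continuous c s u ->
  (forall z, cmod (z - c) < s -> 0 <= u z) -> dint c s u = 0 ->
  forall z, cmod (z - c) < s -> u z = 0.
Proof.
move=> cu u0 I0 z zs; apply/eqP; rewrite eq_le u0// andbT leNgt; apply/negP => uz.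
have uz2 : 0 < u z / 2 by rewrite divr_gt0.
have [x x0 xP] := (rcontP _ _).1 (cu z (ltW zs)) _ uz2.
pose d := Num.min x (s - cmod (z - c)) / 2.
have d0 : 0 < d by rewrite divr_gt0// lt_min x0 subr_gt0.
have dx : d < x.
  apply: (@lt_le_trans _ _ (Num.min x (s - cmod (z - c)))); last by rewrite ge_min lexx.
  by rewrite /d; move: d0; rewrite /d; lra.
have ds : d < s - cmod (z - c).
  apply: (@lt_le_trans _ _ (Num.min x (s - cmod (z - c)))); last by rewrite ge_min lexx orbT.
  by rewrite /d; move: d0; rewrite /d; lra.
have sub w : cmod (w - z) <= d -> cmod (w - c) < s.
  move=> wd; apply: le_lt_trans (cmod_subD w c z) _; rewrite -ltrBrDr.
  exact: le_lt_trans ds.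
have cu' : closed_continuous z d u by move=> w /sub/ltW; exact: cu.
have := dint_subset cu cu' (fun w wz => sub w (ltW wz)) u0; rewrite I0.
apply/negP; rewrite -ltNge.
have : 0 <= dint z d (fun w => u w - u z / 2).
  apply: dint_ge0 => w wd; have := xP w (lt_trans wd dx); rewrite ltr_norml; lra.
rewrite dintB//; last exact: closed_continuous_cst.
rewrite dint_cst// subr_ge0; apply: lt_le_trans.
by rewrite mulr_gt0// mulr_gt0 ?pi_gt0// exprn_gt0.
Qed.

(** * Pointwise bound by the Bergman norm, its equality case and its decay at the boundary *)

Section Bergman.
Variables (q : R) (g : R[i] -> R[i]).
Hypotheses (q1 : 1 < q) (ag : analytic_disk g) (Nfin : (bergman_norm q g < +oo)%E).

Let dens := bergman_density q g.
Let q10 : 0 < q - 1. Proof. by rewrite subr_gt0. Qed.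
Let q0 : 0 < q. Proof. exact: lt_trans ltr01 q1. Qed.
Let pi0 : 0 < pi :> R. Proof. exact: pi_gt0. Qed.
Let one_powR : 1 `^ (q - 1) = 1 :> R. Proof. by rewrite powR1. Qed.

Let dens_ge0 z : 0 <= dens z.
Proof. by rewrite mulr_ge0 ?powR_ge0. Qed.

Let cdens z : disk z -> {for z, continuous dens}.
Proof. exact: continuous_bergman_density. Qed.

Let odisk : open (@disk R).
Proof.
have -> : @disk R = disc 0 1 by apply/seteqP; split => z; rewrite /disk /disc /= subr0.
exact: open_disc.
Qed.

Let T := (\int[mu2]_(p in plane (@disk R)) (dens (toC p))%:E)%E.

Let T0 : (0 <= T)%E.
Proof. by apply: integral_ge0 => p _; rewrite lee_fin. Qed.

Let normE : bergman_norm q g = (((q - 1)%:E * (pi^-1%:E * T)) `^ q^-1)%E.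
Proof. by []. Qed.

Let Tfin : T \is a fin_num.
Proof.
rewrite ge0_fin_numE// ltNge leye_eq; apply/negP => /eqP Too.
move: Nfin; rewrite normE Too gt0_muley ?lte_fin ?invr_gt0// gt0_muley ?lte_fin//.
by rewrite poweRyr ?ltxx// invr_eq0 gt_eqF.
Qed.

Let t := fine T.
Let TE : T = t%:E. Proof. by rewrite fineK. Qed.
Let t0 : 0 <= t. Proof. by rewrite -lee_fin -TE. Qed.

Definition bergman_value : R := fine (bergman_norm q g).
Let N := bergman_value.

Let NE : N = ((q - 1) / pi * t) `^ q^-1.
Proof. by rewrite /N /bergman_value normE TE fine_poweR/= mulrA. Qed.

Lemma bergman_valueE : bergman_norm q g = N%:E.
Proof. by rewrite /N /bergman_value fineK// normE TE fin_num_poweR. Qed.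

Lemma bergman_value_ge0 : 0 <= N.
Proof. by rewrite NE powR_ge0. Qed.

Let Nq : N `^ q = (q - 1) / pi * t.
Proof.
by rewrite NE -powRrM mulVf ?gt_eqF// powRr1// mulr_ge0// divr_ge0// ltW.
Qed.

Let dint_le_t c s : (forall z, cmod (z - c) <= s -> disk z) -> dint c s dens <= t.
Proof.
move=> inD; rewrite -lee_fin -TE -dint_EFin; last by move=> z /inD; exact: cdens.
apply: ge0_subset_integral.
- by apply: measurable_plane; exact: open_disc.
- by apply: measurable_plane; exact: odisk.
- by apply: measurable_fun_disk => [|z]; [exact: odisk|exact: cdens].
- by move=> p _; rewrite lee_fin.
- by move=> p /ltW/inD.
Qed.

Definition bloch_value (a : R[i]) : R := cmod (g a) * (1 - cmod a ^+ 2).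
Let V := bloch_value.

Let V_ge0 a : disk a -> 0 <= V a.
Proof. by move=> /one_sub_sqr_gt0/ltW a0; rewrite mulr_ge0 ?cmod_ge0. Qed.

(** Radii are parametrised by the defect [eta] in the explicit integral, so that [r -> 1] becomes
    [eta -> 0] in plain inequalities. *)
Let radius_of (eta : R) : 0 < eta < 1 ->
  exists2 r, 0 < r < 1 & (1 - r ^+ 2) `^ (q - 1) = eta.
Proof.
move=> /andP[e0 e1]; pose x := eta `^ (q - 1)^-1.
have x0 : 0 < x by exact: powR_gt0.
have xq : x `^ (q - 1) = eta by rewrite /x -powRrM mulVf ?gt_eqF// powRr1// ltW.
have x1 : x < 1.
  rewrite ltNge; apply/negP => x1.
  have := @ge0_ler_powR R (q - 1) (ltW q10) 1 x; rewrite !nnegrE ler01 (ltW x0) => /(_ isT isT x1).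
  by rewrite powR1 xq leNgt e1.
have y0 : 0 <= 1 - x by rewrite subr_ge0 ltW.
exists (Num.sqrt (1 - x)); last by rewrite sqr_sqrtr// subKr.
rewrite sqrtr_gt0 subr_gt0 x1/= -[X in _ < X]sqrtr1 ltr_sqrt// ltrBlDr ltrDl//.
Qed.

(** The excess over the disc is the Bergman integral there minus the explicit term, and that
    integral is at most its value [t] over the whole disk. *)
Let point_ineq a eta : disk a -> g a != 0 -> 0 < eta < 1 ->
  exists r, [/\ 0 < r < 1, (1 - r ^+ 2) `^ (q - 1) = eta &
   dint (pseudo_center a r) (pseudo_radius a r) (bergman_excess q g a) <=
   t - V a `^ q * (pi * (1 - eta) / (q - 1))].
Proof.
move=> da ga e01; have [r r01 rE] := radius_of e01.
exists r; split => //.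
have := dint_bergman_density q1 ag da r01; rewrite rE.
have := @dint_le_t (pseudo_center a r) (pseudo_radius a r) (pseudo_disc_disk da r01).
rewrite /V /bloch_value /dens; move: (dint _ _ _) (dint _ _ _) (_ `^ q * _) => u v x; lra.
Qed.

Let excess_ge0 a (r : R) : disk a -> g a != 0 -> 0 < r < 1 ->
  0 <= dint (pseudo_center a r) (pseudo_radius a r) (bergman_excess q g a).
Proof.
move=> da ga r01; apply: dint_ge0 => z /ltW/(pseudo_disc_disk da r01) dz.
exact: bergman_excess_ge0.
Qed.

Lemma bloch_le_bergman a : disk a -> V a <= N.
Proof.
move=> da; have [ga|ga] := eqVneq (g a) 0.
  by rewrite /V /bloch_value ga cmod0 mul0r bergman_value_ge0.
suff H : V a `^ q <= N `^ q.
  rewrite leNgt; apply/negP => NV.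
  have := @gt0_ltr_powR R q q0 N (V a); rewrite !nnegrE bergman_value_ge0 V_ge0// => /(_ isT isT NV).
  by rewrite ltNge H.
have V0 := powR_ge0 (V a) q.
have key eta : 0 < eta < 1 -> V a `^ q * (1 - eta) <= N `^ q.
  move=> e01; have [r [r01 rE le1]] := point_ineq da ga e01.
  have := le_trans (excess_ge0 da ga r01) le1; rewrite subr_ge0 Nq => H.
  have -> : V a `^ q * (1 - eta) = (q - 1) / pi * (V a `^ q * (pi * (1 - eta) / (q - 1))).
    have pi1 : (pi : R) != 0 by rewrite gt_eqF.
    have q11 : q - 1 != 0 by rewrite gt_eqF.
    move: (V a `^ q) (pi : R) (q - 1) pi1 q11 => u v x v0 x0.
    by field; rewrite v0 x0.
  by rewrite ler_wpM2l// divr_ge0// ltW.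
apply/ler_addgt0Pr => e e0.
pose eta := Num.min (2^-1) (e / (V a `^ q + 1)).
have W0 : 0 < V a `^ q + 1 by lra.
have e01 : 0 < eta < 1.
  by rewrite /eta lt_min gt_min invr_gt0 ltr0n divr_gt0//= invf_lt1 ?ltr1n.
have H := key _ e01.
have : eta * V a `^ q <= e.
  have : eta <= e / (V a `^ q + 1) by rewrite /eta ge_min lexx orbT.
  rewrite ler_pdivlMr// => H2; apply: le_trans H2; rewrite ler_wpM2l ?lerDl//.
  by case/andP: e01 => /ltW.
by move: H; move: (V a `^ q) (N `^ q) => u v; lra.
Qed.

(** If [V a = N], the excess over the disc with defect [eta] is at most [t * eta]. The excess is
    nonnegative and these discs increase as [eta] decreases, so over any fixed one it is 0. *)
Lemma bloch_eq_bergman a : disk a -> g a != 0 -> V a = N ->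
  forall z, disk z -> g z = g a / dmoebius a a * dmoebius a z.
Proof.
move=> da ga VN z dz.
have m1 : cmod (moebius a z) < 1 by exact: cmod_moebius_lt1.
(* Any radius strictly between [cmod (moebius a z)] and 1 places [z] inside the disc. *)
pose r0 := (1 + cmod (moebius a z)) / 2.
have m0 := cmod_ge0 (moebius a z).
have r001 : 0 < r0 < 1 by apply/andP; rewrite /r0; split; lra.
have zr0 : cmod (z - pseudo_center a r0) < pseudo_radius a r0.
  by rewrite -(pseudo_discP da r001 dz) /r0; lra.
apply: (bergman_excess_eq0 q1 da ga dz).
have cex r : 0 < r < 1 -> closed_continuous (pseudo_center a r) (pseudo_radius a r) (bergman_excess q g a).
  by move=> r01 w /(pseudo_disc_disk da r01); exact: continuous_bergman_excess.
have ex0 r w : 0 < r < 1 -> cmod (w - pseudo_center a r) < pseudo_radius a r ->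
    0 <= bergman_excess q g a w.
  by move=> r01 /ltW/(pseudo_disc_disk da r01) dw; exact: bergman_excess_ge0.
apply: (dint_eq0 (cex r0 r001) _ _ zr0); first by move=> w; exact: ex0.
apply/eqP; rewrite eq_le excess_ge0// andbT.
have r02 : 0 < (1 - r0 ^+ 2) `^ (q - 1).
  by apply: powR_gt0; rewrite subr_gt0; case/andP: r001 => h1 h2; rewrite expr_lt1// ltW.
have r021 : (1 - r0 ^+ 2) `^ (q - 1) < 1.
  rewrite -[X in _ < X]one_powR; apply: gt0_ltr_powR => //; rewrite ?nnegrE ?ler01//.
  - by rewrite subr_ge0; case/andP: r001 => h1 h2; rewrite expr_le1// ltW.
  - by rewrite gtrBl exprn_gt0//; case/andP: r001.
have key eta : 0 < eta -> eta < (1 - r0 ^+ 2) `^ (q - 1) ->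
    dint (pseudo_center a r0) (pseudo_radius a r0) (bergman_excess q g a) <= t * eta.
  move=> e0 er; have e01 : 0 < eta < 1 by rewrite e0 (lt_trans er).
  have [r [r01 rE le1]] := point_ineq da ga e01.
  have r0r : r0 < r.
    rewrite ltNge; apply/negP => rr0; move: er; rewrite -rE ltNge => /negP; apply.
    apply: ge0_ler_powR; rewrite ?nnegrE ?(ltW q10)//.
    - by rewrite subr_ge0; case/andP: r001 => h1 h2; rewrite expr_le1// ltW.
    - by rewrite subr_ge0; case/andP: r01 => h1 h2; rewrite expr_le1// ltW.
    - rewrite lerD2l lerN2 lerXn2r// nnegrE; first by case/andP: r01 => /ltW.
      by case/andP: r001 => /ltW.
  apply: (@le_trans _ _ (dint (pseudo_center a r) (pseudo_radius a r) (bergman_excess q g a))).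
    apply: dint_subset; [exact: cex|exact: cex| |by move=> w; exact: ex0].
    move=> w wr; have dw := pseudo_disc_disk da r001 (ltW wr).
    by move: wr; rewrite -!pseudo_discP// => /lt_trans; apply.
  apply: (le_trans le1); rewrite VN Nq.
  rewrite (_ : _ - _ = t * eta)//.
  have pi1 : (pi : R) != 0 by rewrite gt_eqF.
  have q11 : q - 1 != 0 by rewrite gt_eqF.
  move: (pi : R) (q - 1) pi1 q11 => v x v0 x0.
  by field; rewrite v0 x0.
apply/ler_addgt0Pr => e e0; rewrite add0r.
pose eta := Num.min ((1 - r0 ^+ 2) `^ (q - 1) / 2) (e / (t + 1)).
have T1 : 0 < t + 1 by rewrite ltr_wpDl.
have eta0 : 0 < eta by rewrite /eta lt_min !divr_gt0.
apply: le_trans (key eta eta0 _) _.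
  apply: (@le_lt_trans _ _ ((1 - r0 ^+ 2) `^ (q - 1) / 2)); first by rewrite /eta ge_min lexx.
  by move: r02; move: (_ `^ _) => u; lra.
have : eta <= e / (t + 1) by rewrite /eta ge_min lexx orbT.
rewrite ler_pdivlMr//; apply: le_trans.
by rewrite mulrC ler_wpM2l ?lerDl// ltW.
Qed.

(** Concentric discs exhaust the disk, so by monotone convergence one of them carries all but [e] of
    the integral; a disc disjoint from it gets at most the rest. *)
Let tail (e : R) : 0 < e -> exists2 r, 0 < r < 1 & forall c s,
  (forall z, cmod (z - c) <= s -> disk z) -> (forall z, cmod (z - c) < s -> r <= cmod z) ->
  dint c s dens <= e.
Proof.
move=> e0.
(* The shift by 2 keeps the radius positive already at [n = 0]. *)
pose rn (n : nat) : R := 1 - n.+2%:R^-1.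
have rn01 n : 0 < rn n < 1.
  by rewrite /rn subr_gt0 invf_lt1 ?ltr1n//= gtrBl invr_gt0.
pose F (n : nat) : set R2 := plane (disc 0 (rn n)).
have oF n : open (disc (0 : R[i]) (rn n)) by exact: open_disc.
have FD n z : disc (0 : R[i]) (rn n) z -> disk z.
  by rewrite /disc /disk/= subr0 => /lt_trans; apply; case/andP: (rn01 n).
have ndF : nondecreasing_seq F.
  move=> m n mn; apply/subsetPset => p; rewrite /F /plane /disc/= => /lt_le_trans; apply.
  by rewrite /rn lerD2l lerN2 lef_pV2 ?posrE// ler_nat ltnS.
have mF n : measurable (F n) by exact: measurable_plane.
have mfF n : measurable_fun (F n) (fun p : R2 => (dens (toC p))%:E).
  by apply: measurable_fun_disk => // z /FD; exact: cdens.
have f0 n (p : R2) : F n p -> (0 <= (dens (toC p))%:E)%E by rewrite lee_fin.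
have FU : \bigcup_n F n = plane (@disk R).
  apply/seteqP; split => p; first by move=> [n _]; exact: FD.
  rewrite /plane/= => dp.
  have d0 : 0 < 1 - cmod (toC p) by rewrite subr_gt0.
  have [n] := ltr_add_invr d0; rewrite add0r => nd; exists n => //.
  rewrite /F /plane /disc/= subr0 /rn ltrBrDr addrC -ltrBrDr.
  apply: le_lt_trans nd; rewrite lef_pV2 ?posrE// ler_nat//.
have cvg : (\int[mu2]_(p in F n) (dens (toC p))%:E)%E @[n --> \oo] --> t%:E.
  by rewrite -TE /T -FU; exact: (ge0_nondecreasing_set_cvg_integral ndF mF mfF f0).
have E n : (\int[mu2]_(p in F n) (dens (toC p))%:E = (dint 0 (rn n) dens)%:E)%E.
  apply: dint_EFin => z; rewrite subr0 => zr; apply: cdens; apply: le_lt_trans zr _.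
  by case/andP: (rn01 n).
have {}cvg : dint 0 (rn n) dens @[n --> \oo] --> t.
  by apply/fine_cvg => //; move: cvg; congr (_ @ _ --> _); apply/funext => n; rewrite E.
have [n _ /(_ n (leqnn n)) nE] := (cvgrPdist_lt _ _).1 cvg e e0.
exists (rn n) => // c s inD far.
suff : dint c s dens + dint 0 (rn n) dens <= t.
  by move: nE; rewrite ltr_norml; move: (dint _ _ _) (dint _ _ _) => u v; lra.
have cc : closed_continuous c s dens by move=> z /inD; exact: cdens.
have oc : open (disc c s) by exact: open_disc.
suff : ((dint c s dens)%:E + (dint 0 (rn n) dens)%:E <= T)%E by rewrite TE -EFinD lee_fin.
rewrite -(E n) -(dint_EFin cc) /T.
rewrite -ge0_integral_setU.
- apply: ge0_subset_integral.
  + by apply: measurableU; exact: measurable_plane.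
  + by apply: measurable_plane; exact: odisk.
  + by apply: measurable_fun_disk => [|z]; [exact: odisk|exact: cdens].
  + by move=> p _; rewrite lee_fin.
  + by move=> p [/ltW/inD|/FD].
- exact: measurable_plane.
- exact: mF.
- apply/measurable_funU; [exact: measurable_plane|exact: mF|split; last exact: mfF].
  by apply: measurable_fun_disk => // z /ltW; exact: cc.
- by move=> p _; rewrite lee_fin.
- apply/disj_setPS => p [/far h1]; rewrite /F /plane /disc/= subr0.
  by rewrite ltNge h1.
Qed.

(** If [|phi_a(z)| < 1/2], then [3/4 |1 - conj a z|^2 <= 1 - |a|^2], while
    [|1 - conj a z| >= 1 - |z|]. So [1 - |a|^2 <= 3/4 (1 - rho)^2] pushes the whole
    pseudo-hyperbolic disc into [|z| >= rho]. The constant [K] is the explicit integral for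
    [r = 1/2], and the tail is taken below [e^q K]. *)
Lemma bloch_vanishing (e : R) : 0 < e -> exists2 d, 0 < d &
  forall a, disk a -> 1 - cmod a ^+ 2 <= d -> V a <= e.
Proof.
move=> e0.
pose K := pi * (1 - (3 / 4) `^ (q - 1)) / (q - 1).
have K0 : 0 < K.
  rewrite divr_gt0// mulr_gt0// subr_gt0 -[X in _ < X]one_powR.
  by apply: gt0_ltr_powR => //; rewrite ?nnegrE; lra.
have eK : 0 < e `^ q * K by rewrite mulr_gt0// powR_gt0.
have [rho /andP[rho0 rho1] tailP] := tail eK.
exists (3 / 4 * (1 - rho) ^+ 2).
  by rewrite mulr_gt0// exprn_gt0// subr_gt0.
move=> a da ad; have [ga|ga] := eqVneq (g a) 0.
  by rewrite /V /bloch_value ga cmod0 mul0r ltW.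
have h01 : 0 < (2^-1 : R) < 1 by rewrite invr_gt0 ltr0n invf_lt1 ?ltr1n.
have := dint_bergman_density q1 ag da h01.
have -> : 1 - 2^-1 ^+ 2 = 3 / 4 :> R by field.
move=> H.
have le1 : V a `^ q * K <= e `^ q * K.
  apply: (@le_trans _ _ (dint (pseudo_center a 2^-1) (pseudo_radius a 2^-1) dens)).
    by rewrite /dens H lerDl excess_ge0.
  apply: tailP; first by move=> z; exact: pseudo_disc_disk.
  move=> z zc; have dz := pseudo_disc_disk da h01 (ltW zc).
  move: zc; rewrite -pseudo_discP// => mz.
  have m34 : 3 / 4 <= 1 - cmod (moebius a z) ^+ 2.
    have : cmod (moebius a z) ^+ 2 <= 2^-1 ^+ 2 by rewrite lerXn2r ?nnegrE ?cmod_ge0 ?invr_ge0// ltW.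
    have -> : 2^-1 ^+ 2 = 1 / 4 :> R by field.
    by move: (_ ^+ 2) => u; lra.
  have den : (1 - cmod z) ^+ 2 <= cmod (1 - a^* * z) ^+ 2.
    have z1 : 0 <= 1 - cmod z by rewrite subr_ge0 ltW.
    rewrite lerXn2r ?nnegrE ?cmod_ge0//; apply: le_trans (cmod_sub_ge _ _).
    rewrite cmod1 lerD2l lerN2 cmodM cmodJ ler_piMl ?cmod_ge0//; exact: ltW.
  have den0 : 0 < cmod (1 - a^* * z) ^+ 2 by rewrite exprn_gt0// cmod_gt0 moebius_den_neq0.
  rewrite moebius_defect// ler_pdivlMr// in m34.
  have z21 : 1 - cmod z ^+ 2 <= 1 by rewrite gerBl sqr_ge0.
  have A0 := ltW (one_sub_sqr_gt0 da).
  have : (1 - cmod a ^+ 2) * (1 - cmod z ^+ 2) <= 3 / 4 * (1 - rho) ^+ 2.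
    by apply: le_trans ad; rewrite ler_piMr.
  move=> H1; have H2 := le_trans m34 H1.
  rewrite ler_pM2l// in H2; have H3 := le_trans den H2.
  rewrite ler_pXn2r ?nnegrE ?subr_ge0 ?(ltW rho1)// in H3; last exact: ltW.
  by move: H3; move: (cmod z) => u; lra.
rewrite ler_pM2r// in le1.
rewrite leNgt; apply/negP => eV.
have := @gt0_ltr_powR R q q0 e (V a); rewrite !nnegrE (ltW e0) V_ge0// => /(_ isT isT eV).
by rewrite ltNge le1.
Qed.

(** For [|z| > rho] the quantity [V] is at most [N / 2], so points where it is close to [N] lie in a
    compact disc, on which the maximum exists. *)
Lemma bloch_sup_attained : 0 < N -> (forall e, 0 < e -> exists2 a, disk a & N - e < V a) ->
  exists2 a, disk a & V a = N.
Proof.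
move=> N0 approx.
have N20 : 0 < N / 2 by rewrite divr_gt0.
have [d d0 far] := bloch_vanishing N20.
(* The minimum with 1/2 keeps the radicand positive, so that squaring [rho] recovers it. *)
pose rho := Num.sqrt (1 - Num.min d 2^-1).
have m0 : 0 < Num.min d 2^-1 by rewrite lt_min d0 invr_gt0 ltr0n.
have h1 : (2^-1 : R) < 1 by rewrite invf_lt1 ?ltr0n// ltr1n.
have m1 : Num.min d 2^-1 < 1 by rewrite gt_min h1 orbT.
have rho2 : rho ^+ 2 = 1 - Num.min d 2^-1 by rewrite sqr_sqrtr// subr_ge0 ltW.
have rho0 : 0 <= rho by exact: sqrtr_ge0.
have rho1 : rho < 1 by rewrite -(expr_lt1 (_ : 0 < 2)%N)// rho2 gtrBl.
have cV : closed_continuous 0 rho V.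
  move=> z; rewrite subr0 => zr; have dz : disk z := le_lt_trans zr rho1.
  have cg := analytic_cont ag dz.
  have c1 : {for z, continuous (fun z => cmod (g z))}.
    by apply: (@continuous_comp _ _ _ g (@cmod R)); [exact: cg|exact: continuous_cmod].
  have c2 : {for z, continuous (fun z => 1 - cmod z ^+ 2)}.
    apply: (@continuous_comp _ _ _ (@cmod R) (fun t : R => 1 - t ^+ 2)); first exact: continuous_cmod.
    by apply: cvgB; [exact: cvg_cst|exact: exprn_continuous].
  exact: (cvgM c1 c2).
have [a a_rho amax] := closed_disc_max rho0 cV.
have da : disk a by move: a_rho; rewrite subr0 => ar; exact: le_lt_trans ar rho1.
exists a => //; apply/eqP; rewrite eq_le bloch_le_bergman//=.
apply/ler_addgt0Pr => e e0.
have [b db Nb] : exists2 b, disk b & N - Num.min e (N / 2) < V b.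
  by apply: approx; rewrite lt_min e0.
have Nb2 : N / 2 < V b.
  have : Num.min e (N / 2) <= N / 2 by rewrite ge_min lexx orbT.
  by move: Nb; move: (Num.min _ _) => u; lra.
have br : cmod (b - 0) <= rho.
  rewrite subr0 leNgt; apply/negP => rb.
  have : 1 - cmod b ^+ 2 <= d.
    have : rho ^+ 2 <= cmod b ^+ 2 by rewrite lerXn2r ?nnegrE ?cmod_ge0// ltW.
    rewrite rho2; have : Num.min d 2^-1 <= d by rewrite ge_min lexx.
    by move: (Num.min _ _) (cmod b ^+ 2) => u v; lra.
  by move=> /(far b db); rewrite leNgt Nb2.
have := amax b br; have : Num.min e (N / 2) <= e by rewrite ge_min lexx.
by move: Nb; move: (Num.min _ _) => u; lra.
Qed.

End Bergman.

Lemma moebius0 z : moebius 0 z = - z.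
Proof. by rewrite /moebius rmorph0 mul0r subr0 divr1 sub0r. Qed.

(** Up to sign and an additive constant, the Moebius map is the extremal function [f_zeta] with
    [zeta = a] and [gamma = 1]. *)
Lemma moebius_partial_fraction a z : disk a -> disk z -> a != 0 ->
  moebius a z = 1 / a^* - (1 - cmod a ^+ 2)%:C / a^* * (1 / (1 - a^* * z)).
Proof.
move=> da dz a0; have d0 := moebius_den_neq0 da dz.
have aJ0 : a^* != 0 by rewrite -cmod_eq0 cmodJ cmod_eq0.
have -> : (1 - cmod a ^+ 2)%:C = 1 - a^* * a by rewrite conj_mul rmorphB rmorph1.
have H (b : R[i]) : b != 0 -> 1 - b * z != 0 ->
    (a - z) / (1 - b * z) = 1 / b - (1 - b * a) / b * (1 / (1 - b * z)).
  by move=> b0 bz; field; rewrite b0 bz.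
exact: H.
Qed.

(** * The Bloch and Besov norms for [q > 1] *)

Section Besov.
Variables (q : R) (f : R[i] -> R[i]).
Hypotheses (q1 : 1 < q) (bf : in_besov q f).

Let af : analytic_disk f. Proof. by case: bf. Qed.
Let ag : analytic_disk (derive1 f). Proof. exact: analytic_derive1. Qed.
Let Nfin : (bergman_norm q (derive1 f) < +oo)%E. Proof. by case: bf. Qed.
Let N := bergman_value q (derive1 f).
Let N0 : 0 <= N. Proof. exact: (bergman_value_ge0 q1 Nfin). Qed.
Let q0 : 0 < q. Proof. exact: lt_trans ltr01 q1. Qed.

Let seminorm_le : (bloch_seminorm f <= N%:E)%E.
Proof.
by apply: ge_ereal_sup => _ [z dz <-]; rewrite lee_fin; exact: (bloch_le_bergman q1 ag Nfin dz).
Qed.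

Lemma besov_in_bloch : in_bloch f.
Proof. by split=> //; apply: le_lt_trans seminorm_le _; rewrite ltry. Qed.

Let norm1E : besov_norm1 q f = (cmod (f 0) + N)%:E.
Proof. by rewrite /besov_norm1 (bergman_valueE q1 Nfin). Qed.

Lemma bloch_le_besov1 : (bloch_norm f <= besov_norm1 q f)%E.
Proof. by rewrite norm1E /bloch_norm EFinD leeD2l. Qed.

(** Hölder's inequality for the pairs [(|f 0|, N)] and [(1, 1)]; the second has norm [2^((q-1)/q)]
    for the conjugate exponent. *)
Lemma besov1_le_besov2 :
  (besov_norm1 q f <= (2 `^ ((q - 1) / q))%:E * besov_norm2 q f)%E.
Proof.
rewrite norm1E /besov_norm2 (bergman_valueE q1 Nfin) -/N !poweR_EFin lee_fin.
have p0 : 0 < q / (q - 1) by rewrite divr_gt0// subr_gt0.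
have q11 : q - 1 != 0 by rewrite subr_eq0 gt_eqF.
have pq : q^-1 + (q / (q - 1))^-1 = 1.
  by rewrite invf_div mulrBl mul1r divff ?gt_eqF// addrC subrK.
have := hoelder2 (cmod_ge0 (f 0)) N0 ler01 ler01 q0 p0 pq.
by rewrite !mulr1 powR1 invf_div mulrC.
Qed.

Let derive1_eq0 : N = 0 -> forall z, disk z -> derive1 f z = 0.
Proof.
move=> N00 z dz; have := bloch_le_bergman q1 ag Nfin dz.
rewrite /bloch_value -/N N00 pmulr_lle0 ?one_sub_sqr_gt0// => h.
by apply/eqP; rewrite -cmod_eq0 eq_le h cmod_ge0.
Qed.

Lemma besov_bloch_extremal : bloch_norm f = besov_norm1 q f ->
  (exists lam be a, disk a /\ forall z, disk z -> f z = lam * moebius a z + be).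
Proof.
rewrite norm1E /bloch_norm => eqN.
have supN : bloch_seminorm f = N%:E.
  by move: eqN; case: (bloch_seminorm f) => [s| |]//= [/addrI->].
(* If [N = 0], then [f] is constant, and the coefficient 0 in front of any Moebius map gives the
   required form. *)
have [N00|Nn0] := eqVneq N 0.
  exists 0, (f 0), 0; split; first exact: disk0.
  by move=> z dz; rewrite mul0r add0r; apply: analytic_zero_derive => //; exact: derive1_eq0.
have Np : 0 < N by rewrite lt_neqAle eq_sym Nn0.
have approx e : 0 < e -> exists2 a, disk a & N - e < bloch_value (derive1 f) a.
  move=> e0; have : ((N - e)%:E < bloch_seminorm f)%E by rewrite supN lte_fin ltrBlDr ltrDl.
  by move=> /ereal_sup_gt[_ [a da <-]]; rewrite lte_fin => ?; exists a.
have [a da aN] := bloch_sup_attained q1 ag Nfin Np approx.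
have ga : derive1 f a != 0.
  by apply: contraNneq Nn0 => ga; rewrite /N -aN /bloch_value ga cmod0 mul0r.
have gE := bloch_eq_bergman q1 ag Nfin da ga aN.
set lam := derive1 f a / dmoebius a a in gE.
pose u z := f z - lam * moebius a z.
have du z : disk z -> cdiff u z 0.
  move=> dz; apply: (cdiff_eq (cdiffB (analytic_cdiff af dz) (cdiff_cmul lam (cdiff_moebius da dz)))).
  by rewrite gE// subrr.
have au : analytic_disk u by move=> z /du/cdiff_derivable.
exists lam, (u 0), a; split => // z dz.
rewrite -(analytic_zero_derive au _ dz); last by move=> w /du/cdiff_derive1.
by rewrite /u addrC subrK.
Qed.

End Besov.

(** * Complex sequences and series *)

Lemma ccvgP (u : nat -> R[i]) (l : R[i]) :
  u @ \oo --> l <-> forall e : R, 0 < e -> \forall n \near \oo, cmod (u n - l) < e.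
Proof.
split=> [ul e e0|H A /nbhs_cmodP[e e0 eA]].
  by apply: (ul [set w | cmod (w - l) < e]); apply/nbhs_cmodP; exists e.
by near=> n; apply: eA; near: n; exact: H.
Unshelve. all: by end_near. Qed.

Lemma ccvgB (u v : nat -> R[i]) (l m : R[i]) :
  u @ \oo --> l -> v @ \oo --> m -> (fun n => u n - v n) @ \oo --> l - m.
Proof.
move=> /ccvgP ul /ccvgP vm; apply/ccvgP => e e0.
have e20 : 0 < e / 2 by rewrite divr_gt0.
have nu := ul _ e20; have nv := vm _ e20.
near=> n; have -> : u n - v n - (l - m) = (u n - l) - (v n - m) by ring.
apply: le_lt_trans (cmodBD _ _) _; rewrite [ltRHS]splitr.
by rewrite ltrD//; near: n.
Unshelve. all: by end_near. Qed.

Lemma ccvgMr (u : nat -> R[i]) (l k : R[i]) :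
  u @ \oo --> l -> (fun n => u n * k) @ \oo --> l * k.
Proof.
move=> /ccvgP ul; apply/ccvgP => x x0.
have k0 : 0 < cmod k + 1 by rewrite ltr_wpDl// cmod_ge0.
have := ul _ (divr_gt0 x0 k0); apply: filterS => n.
rewrite ltr_pdivlMr// -mulrBl cmodM; apply: le_lt_trans.
by rewrite ler_wpM2l ?cmod_ge0// lerDl.
Qed.

Lemma ccvg_bound (u : nat -> R[i]) (l : R[i]) (k : R) : u @ \oo --> l ->
  (forall n, cmod (u n) <= k) -> cmod l <= k.
Proof.
move=> /ccvgP ul uk; apply/ler_addgt0Pr => e /ul[n _ /(_ n (leqnn n)) /= nE].
have := cmod_sub_ge l (u n); have := uk n.
have <- : cmod (u n - l) = cmod (l - u n) by rewrite -cmodN opprB.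
by move: nE; move: (cmod (u n - l)) (cmod l) (cmod (u n)) => x y t; lra.
Qed.

Lemma ccvg_series_abs (u : nat -> R[i]) (k : R) :
  (forall n, \sum_(0 <= i < n) cmod (u i) <= k) ->
  exists l : R[i], series u @ \oo --> l.
Proof.
move=> uk.
have cvg1 : cvgn (series (fun n => cmod (u n))).
  apply: nondecreasing_is_cvgn.
    by apply/nondecreasing_seqP => n; rewrite /series/= big_nat_recr//= lerDl cmod_ge0.
  by exists k => _ [n _ <-]; exact: uk.
have part (p : R[i] -> R) : (forall w, `|p w| <= cmod w) -> cvgn (series (fun n => p (u n))).
  move=> pP; apply: normed_cvg; apply: series_le_cvg cvg1 => n //=; exact: cmod_ge0.
have [cx cy] := (part _ (@Re_cmod R), part _ (@Im_cmod R)).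
pose x := limn (series (fun n => Re (u n))).
pose y := limn (series (fun n => Im (u n))).
have SE n : series u n =
    series (fun n => Re (u n)) n +i* series (fun n => Im (u n)) n.
  rewrite /series/=; elim: n => [|n IH]; first by rewrite !big_geq.
  by rewrite !big_nat_recr//= IH; apply: cplx_eq; rewrite ?ReD ?ImD.
exists (x +i* y); apply/ccvgP => e e0.
have e20 : 0 < e / 2 by rewrite divr_gt0.
have /cvgrPdist_lt/(_ _ e20) nx := cx; have /cvgrPdist_lt/(_ _ e20) ny := cy.
near=> n; apply: le_lt_trans (cmod_ReIm _) _; rewrite [ltRHS]splitr SE.
by rewrite ltrD//= distrC; near: n.
Unshelve. all: by end_near. Qed.

Lemma moebius_sub a w z : disk a -> disk w -> disk z ->
  moebius a w - moebius a z - dmoebius a z * (w - z) =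
  - ((1 - cmod a ^+ 2)%:C * a^* * (w - z) ^+ 2 / ((1 - a^* * w) * (1 - a^* * z) ^+ 2)).
Proof.
move=> da dw dz; have w0 := moebius_den_neq0 da dw; have z0 := moebius_den_neq0 da dz.
have aE : (1 - cmod a ^+ 2)%:C = 1 - a^* * a by rewrite conj_mul rmorphB rmorph1.
rewrite /dmoebius aE /moebius.
have H (b : R[i]) : 1 - b * w != 0 -> 1 - b * z != 0 ->
    (a - w) / (1 - b * w) - (a - z) / (1 - b * z) -
      - ((1 - b * a) / (1 - b * z) ^+ 2) * (w - z) =
    - ((1 - b * a) * b * (w - z) ^+ 2 / ((1 - b * w) * (1 - b * z) ^+ 2)).
  by move=> bw bz; field; rewrite bw bz.
exact: H.
Qed.

(** The bound does not depend on [a], which permits termwise differentiation of a series of Moebius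
    maps. It uses [|1 - conj a v| >= 1 - |v| >= s] at both points. *)
Lemma cmod_moebius_sub a w z (s : R) : disk a -> disk w -> disk z ->
  0 < s -> s <= 1 - cmod w -> s <= 1 - cmod z ->
  cmod (moebius a w - moebius a z - dmoebius a z * (w - z)) <= cmod (w - z) ^+ 2 / s ^+ 3.
Proof.
move=> da dw dz s0 sw sz; rewrite moebius_sub// cmodN.
have a1 := ltW da.
have den v : disk v -> s <= 1 - cmod v -> s <= cmod (1 - a^* * v).
  move=> dv sv; apply: le_trans (cmod_sub_ge _ _); apply: (le_trans sv).
  by rewrite cmod1 lerD2l lerN2 cmodM cmodJ ler_piMl ?cmod_ge0.
have [dw1 dz1] := (den w dw sw, den z dz sz).
rewrite cmodM cmodV !(cmodX, cmodM) cmodJ cmod_real ger0_norm ?(ltW (one_sub_sqr_gt0 da))//.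
apply: ler_pM.
- by rewrite !mulr_ge0 ?exprn_ge0 ?cmod_ge0 ?(ltW (one_sub_sqr_gt0 da)).
- by rewrite invr_ge0 mulr_ge0 ?exprn_ge0 ?cmod_ge0.
- rewrite ler_piMl ?exprn_ge0 ?cmod_ge0//.
  rewrite mulr_ile1 ?cmod_ge0 ?(ltW (one_sub_sqr_gt0 da))//.
  by rewrite gerBl sqr_ge0.
- rewrite lef_pV2 ?posrE ?exprn_gt0 ?mulr_gt0 ?exprn_gt0 ?(lt_le_trans s0)//.
  by rewrite exprS ler_pM ?exprn_ge0 ?(ltW s0)// lerXn2r ?nnegrE ?cmod_ge0 ?(ltW s0).
Qed.

(** * Functions given by an atomic decomposition *)

Section AtomicDecomposition.
Variables (f : R[i] -> R[i]) (a b : nat -> R[i]).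
Hypothesis fab : besov1_repr f a b.

Let L := fine (l1_norm b).
Let da k : disk (a k). Proof. by case: fab. Qed.
Lemma atomic_l1E : l1_norm b = L%:E.
Proof.
have [_ L1 _] := fab; rewrite /L fineK// ge0_fin_numE//.
by apply: nneseries_ge0 => k _ _; rewrite lee_fin cmod_ge0.
Qed.

Let partial_le n : \sum_(0 <= k < n) cmod (b k) <= L.
Proof.
rewrite -lee_fin -atomic_l1E -sumEFin; apply: nneseries_lim_ge => k _ _.
by rewrite lee_fin cmod_ge0.
Qed.

Let L0 : 0 <= L. Proof. by have := partial_le 0; rewrite big_nil. Qed.

Let wsum_le (v : nat -> R[i]) (x : R) n : 0 <= x -> (forall k, cmod (v k) <= x) ->
  \sum_(0 <= k < n) cmod (b k * v k) <= L * x.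
Proof.
move=> x0 vx; apply: (@le_trans _ _ (\sum_(0 <= k < n) cmod (b k) * x)).
  by apply: ler_sum => k _; rewrite cmodM ler_wpM2l ?cmod_ge0.
by rewrite -mulr_suml ler_wpM2r.
Qed.

Let wsum_cmod (v : nat -> R[i]) (x : R) n : 0 <= x -> (forall k, cmod (v k) <= x) ->
  cmod (series (fun k => b k * v k) n) <= L * x.
Proof.
move=> x0 vx; apply: le_trans (wsum_le n x0 vx); rewrite /series/=.
elim: n => [|n IH]; first by rewrite !big_nil cmod0.
by rewrite !big_nat_recr//=; apply: le_trans (cmodD _ _) _; rewrite lerD2r.
Qed.

Lemma atomic_bound z : disk z -> cmod (f z) <= L.
Proof.
move=> dz; have [_ _ /(_ z dz) fz] := fab.
rewrite -[L]mulr1; apply: (ccvg_bound fz) => n; apply: wsum_cmod => // k.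
by apply: ltW; exact: cmod_moebius_lt1.
Qed.

(** The derivative is the series of the [b k * dmoebius (a k) z]. It converges absolutely since
    [|phi_a'| (1 - |z|^2) <= 1], and the same bound yields the estimate. *)
Lemma atomic_cdiff z : disk z ->
  exists d, cdiff f z d /\ cmod d * (1 - cmod z ^+ 2) <= L.
Proof.
move=> dz; have z2 := one_sub_sqr_gt0 dz.
have dmk k : cmod (dmoebius (a k) z) <= (1 - cmod z ^+ 2)^-1.
  by rewrite -[leRHS]mul1r ler_pdivlMr// cmod_dmoebius// gerBl sqr_ge0.
have z20 : 0 <= (1 - cmod z ^+ 2)^-1 by rewrite invr_ge0 ltW.
have [d dE] := ccvg_series_abs (fun n => wsum_le n z20 dmk).
exists d; split; last first.
  rewrite -ler_pdivlMr//; apply: (ccvg_bound dE) => n; exact: wsum_cmod.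
have [s20 zw] := disk_nbhs dz.
pose s := (1 - cmod z) / 2.
have s0 : 0 < s by rewrite divr_gt0.
have sz : s <= 1 - cmod z by rewrite /s; move: s20; lra.
have s30 : 0 < s ^+ 3 by rewrite exprn_gt0.
apply/cdiffP => e e0.
(* Within this distance the summed remainder [L |w - z|^2 / s^3] is at most [e |w - z|]; the added 1
   covers [L = 0]. *)
pose r := Num.min s (e * s ^+ 3 / (L + 1)).
have L10 : 0 < L + 1 by rewrite ltr_wpDl.
exists r; first by rewrite lt_min s0 divr_gt0// mulr_gt0.
move=> w; rewrite lt_min => /andP[ws we].
have dw : disk w by apply: zw; exact: lt_le_trans sz.
have sw : s <= 1 - cmod w.
  have := cmod_sub_ge w z; move: ws; rewrite /s.
  by move: (cmod (w - z)) (cmod w) (cmod z) => x y t; lra.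
have [_ _ fE] := fab.
have lim1 : series (fun k => b k * (moebius (a k) w - moebius (a k) z - dmoebius (a k) z * (w - z)))
    @ \oo --> f w - f z - d * (w - z).
  have -> : series (fun k => b k * (moebius (a k) w - moebius (a k) z - dmoebius (a k) z * (w - z))) =
      (fun n => series (fun k => b k * moebius (a k) w) n - series (fun k => b k * moebius (a k) z) n -
        series (fun k => b k * dmoebius (a k) z) n * (w - z)).
    apply/funext => n; rewrite /series/= mulr_suml -!sumrB; apply: eq_bigr => k _.
    by rewrite 2!mulrBr [b k * (dmoebius _ _ * _)]mulrA.
  exact: (ccvgB (ccvgB (fE w dw) (fE z dz)) (ccvgMr dE)).
have x0 : 0 <= cmod (w - z) ^+ 2 / s ^+ 3 by rewrite divr_ge0 ?exprn_ge0 ?cmod_ge0 ?(ltW s0).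
apply: (@le_trans _ _ (L * (cmod (w - z) ^+ 2 / s ^+ 3))).
  apply: (ccvg_bound lim1) => n; apply: wsum_cmod => // k; exact: cmod_moebius_sub.
rewrite expr2 -!mulrA mulrCA [leRHS]mulrC ler_wpM2l ?cmod_ge0// mulrA ler_pdivrMr//.
move: we; rewrite ltr_pdivlMr// mulrDr mulr1 => we.
apply: le_trans (ltW we); by rewrite mulrC lerDl cmod_ge0.
Qed.

End AtomicDecomposition.

(** * The Bloch norm on [B^1]: bound, equality and sharpness *)

Lemma besov1_norm_ge0 f : (0 <= besov1_norm f)%E.
Proof.
apply: le_ereal_inf_tmp => _ [a [b [_ ->]]].
by apply: nneseries_ge0 => k _ _; rewrite lee_fin cmod_ge0.
Qed.

Lemma besov1_norm_fin f : in_besov1 f -> exists2 m, 0 <= m & besov1_norm f = m%:E.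
Proof.
move=> [a [b fab]]; have le1 : (besov1_norm f <= l1_norm b)%E.
  by apply: ereal_inf_lbound; exists a, b.
exists (fine (besov1_norm f)); first by rewrite fine_ge0// besov1_norm_ge0.
rewrite fineK// ge0_fin_numE ?besov1_norm_ge0//; apply: le_lt_trans le1 _.
by case: fab.
Qed.

Lemma besov1_bound f z : disk z -> ((cmod (f z))%:E <= besov1_norm f)%E.
Proof.
move=> dz; apply: le_ereal_inf_tmp => _ [a [b [fab ->]]].
by rewrite (atomic_l1E fab) lee_fin (atomic_bound fab).
Qed.

Lemma besov1_bloch_seminorm f : (bloch_seminorm f <= besov1_norm f)%E.
Proof.
apply: le_ereal_inf_tmp => _ [a [b [fab ->]]].
apply: ge_ereal_sup => _ [z dz <-].
have [d [fd dL]] := atomic_cdiff fab dz.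
by rewrite (atomic_l1E fab) lee_fin (cdiff_derive1 fd).
Qed.

Lemma besov1_in_bloch f : in_besov1 f -> in_bloch f.
Proof.
move=> fB; split.
  have [a [b fab]] := fB; move=> z dz.
  by have [d [/cdiff_derivable]] := atomic_cdiff fab dz.
have [m _ mE] := besov1_norm_fin fB.
by apply: le_lt_trans (besov1_bloch_seminorm f) _; rewrite mE ltry.
Qed.

Lemma bloch_le_besov1_double f : (bloch_norm f <= 2%:E * besov1_norm f)%E.
Proof.
rewrite mule_natl mule2n /bloch_norm leeD ?besov1_bound ?besov1_bloch_seminorm//.
exact: disk0.
Qed.

(** By the mean value property the nonnegative function [|f 0|^2 - Re (conj (f 0) f)] has integral 0
    over discs about 0, hence vanishes. With [|f z| <= |f 0|] this gives [|f z - f 0|^2 <= 0]. *)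
Lemma constant_of_max f : analytic_disk f ->
  (forall z, disk z -> cmod (f z) <= cmod (f 0)) -> forall z, disk z -> f z = f 0.
Proof.
move=> af fmax z dz; set m := cmod (f 0) in fmax.
have [s zs s1] : exists2 s : R, cmod z < s & s < 1.
  by exists ((cmod z + 1) / 2); move: dz; rewrite /disk/=; move: (cmod z) => x; lra.
have s0 : 0 < s := le_lt_trans (cmod_ge0 z) zs.
pose h z := (f 0)^* * f z.
have ah : analytic_disk h.
  by move=> w dw; exact: (cdiff_derivable (cdiff_cmul (f 0)^* (analytic_cdiff af dw))).
have inD w : cmod (w - 0) <= s -> disk w by rewrite subr0 => /le_lt_trans; apply.
have ch : closed_continuous 0 s (fun z => Re (h z)).
  by move=> w /inD dw; apply: (@continuous_comp _ _ _ h (@Re R)); [exact: (analytic_cont ah dw)|exact: continuous_Re].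
have cm : closed_continuous 0 s (fun=> m ^+ 2) by exact: closed_continuous_cst.
have hmul w : Re (h w) <= m * cmod (f w).
  apply: le_trans (ler_norm _) _; apply: le_trans (Re_cmod _) _.
  by rewrite /h cmodM cmodJ.
have u0 w : cmod (w - 0) < s -> 0 <= m ^+ 2 - Re (h w).
  move=> /ltW/inD dw; rewrite subr_ge0; apply: le_trans (hmul w) _.
  by rewrite expr2 ler_wpM2l ?fmax// /m cmod_ge0.
have cu : closed_continuous 0 s (fun w => m ^+ 2 - Re (h w)) by exact: closed_continuousB.
have h0 : Re (h 0) = m ^+ 2 by rewrite /h conj_mul.
have I0 : dint 0 s (fun w => m ^+ 2 - Re (h w)) = 0.
  rewrite dintB// dint_cst// mean_value// ?cmod0 ?add0r//.
  by rewrite h0 subrr.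
have zs0 : cmod (z - 0) < s by rewrite subr0.
have /eqP := dint_eq0 cu u0 I0 zs0; rewrite subr_eq0 => /eqP hz.
apply/eqP; rewrite -subr_eq0 -cmod_eq0 -sqrf_eq0 eq_le sqr_ge0 andbT.
have := fmax z dz; have := hz; rewrite /h /m !sqr_cmod.
rewrite -(@ler_pXn2r _ 2) ?nnegrE ?cmod_ge0// !sqr_cmod !ReM !ReJ !ImJ !ReB !ImB.
move: (Re (f z)) (Im (f z)) (Re (f 0)) (Im (f 0)) => x y p q.
nra.
Qed.

Lemma besov1_extremal f : in_besov1 f -> bloch_norm f = (2%:E * besov1_norm f)%E ->
  forall z, disk z -> f z = 0.
Proof.
move=> fB E; have [m m0 mE] := besov1_norm_fin fB.
have [af _] := besov1_in_bloch fB.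
have f0m : cmod (f 0) <= m by rewrite -lee_fin -mE besov1_bound//; exact: disk0.
have sm := besov1_bloch_seminorm f.
have [f0E sE] : cmod (f 0) = m /\ bloch_seminorm f = m%:E.
  move: E sm; rewrite /bloch_norm mE -EFinM.
  case: (bloch_seminorm f) => [s| |]//= [] sE; rewrite lee_fin => sm.
  have -> : s = m by lra.
  by split=> //; lra.
have fc : forall z, disk z -> f z = f 0.
  apply: constant_of_max => // z dz.
  by rewrite f0E -lee_fin -mE besov1_bound.
have d0 z : disk z -> derive1 f z = 0.
  move=> dz; have [z0 zw] := disk_nbhs dz; apply: cdiff_derive1.
  by apply: (cdiff_near z0 _ (cdiff_cst (f 0) z)) => w /zw/fc.
have mle : m <= 0.
  rewrite -lee_fin -sE; apply: ge_ereal_sup => _ [z dz <-].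
  by rewrite d0// cmod0 mul0r.
move=> z /fc ->; apply/eqP; rewrite -cmod_eq0 f0E.
by rewrite eq_le mle.
Qed.

Lemma moebius_besov1 a : disk a -> in_besov1 (moebius a) /\ (besov1_norm (moebius a) <= 1)%E.
Proof.
move=> da; pose b (n : nat) : R[i] := (n == 0)%:R.
have l1 : (l1_norm b <= 1)%E.
  apply: lime_le; first by apply: is_cvg_nneseries => k _ _; rewrite lee_fin cmod_ge0.
  apply: nearW => -[|n]; first by rewrite big_geq.
  rewrite big_ltn// big_nat_cond big1 ?adde0 /b/= ?cmod1//.
  by move=> [|k]//= _; rewrite cmod0.
have H : besov1_repr (moebius a) (fun=> a) b.
  split=> //; first by apply: le_lt_trans l1 _; rewrite ltry.
  move=> z dz; apply/ccvgP => e e0; exists 1%N => // -[|n]//= _.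
  rewrite /series/= big_ltn// big_nat_cond big1 ?addr0 /b/= ?mul1r ?subrr ?cmod0//.
  by move=> [|k]//= _; rewrite mul0r.
split; first by exists (fun=> a), b.
by apply: le_trans l1; apply: ereal_inf_lbound; exists (fun=> a), b.
Qed.

Lemma besov1_sharp (k : R) : k < 2 ->
  ~ (forall f, in_besov1 f -> (bloch_norm f <= k%:E * besov1_norm f)%E).
Proof.
move=> k2 H.
(* [moebius t] has modulus [t] at 0, and its seminorm is at least 1, seen at [z = t], while its
   [B^1] norm is at most 1. As [k < 2], [t >= k / 2] gives [t + 1 > k]. *)
have [t [t0 t1 tk]] : exists t : R, [/\ 0 <= t, t < 1 & k / 2 <= t].
  exists (Num.max 0 (k / 2)); rewrite le_max lexx gt_max ltr01/= le_max lexx orbT.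
  by split=> //; lra.
have ct : cmod t%:C = t by rewrite cmod_real ger0_norm.
have dt : disk t%:C by rewrite /disk/= ct.
have [tB t_le1] := moebius_besov1 dt.
have [m m0 mE] := besov1_norm_fin tB.
have := H _ tB; rewrite mE -EFinM; apply/negP; rewrite -ltNge.
apply: (@lt_le_trans _ _ (t + 1)%:E).
  rewrite lte_fin; move: t_le1; rewrite mE lee_fin => m1.
  have [k0|k0] := leP k 0.
    by apply: (@le_lt_trans _ _ 0); [exact: mulr_le0_ge0|lra].
  apply: (@le_lt_trans _ _ k); first by rewrite ler_piMr// ltW.
  by lra.
rewrite EFinD /bloch_norm; apply: leeD.
  by rewrite lee_fin /moebius mulr0 !subr0 divr1 ct.
apply: ereal_sup_ubound; exists t%:C => //.
rewrite derive1_moebius// cmod_dmoebius//.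
by rewrite /moebius subrr mul0r cmod0 expr0n subr0.
Qed.

End Disk.

Theorem proposition2p1 (R : realType) :
  (forall q : R, 1 < q ->
     (forall f : R[i] -> R[i], in_besov q f ->
        [/\ in_bloch f,
            (bloch_norm f <= besov_norm1 q f)%E &
            (bloch_norm f <= (2 `^ ((q - 1) / q))%:E * besov_norm2 q f)%E])
     /\
     (forall f : R[i] -> R[i], in_besov q f ->
        bloch_norm f = besov_norm1 q f \/
        bloch_norm f = ((2 `^ ((q - 1) / q))%:E * besov_norm2 q f)%E ->
        (exists alpha beta : R[i],
           forall z : R[i], disk z -> f z = alpha * z + beta)
        \/
        (exists gamma delta zeta : R[i],
           0 < cmod zeta < 1 /\
           forall z : R[i], disk z ->
             f z = gamma * ((1 - cmod zeta ^+ 2)%:C / zeta^*)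
                     * (1 / (1 - zeta^* * z)) + delta)))
  /\
  [/\ (forall f : R[i] -> R[i], in_besov1 f ->
         in_bloch f /\ (bloch_norm f <= 2%:E * besov1_norm f)%E),
      (forall c : R, c < 2 ->
         ~ (forall f : R[i] -> R[i], in_besov1 f ->
              (bloch_norm f <= c%:E * besov1_norm f)%E)) &
      (forall f : R[i] -> R[i], in_besov1 f ->
         bloch_norm f = (2%:E * besov1_norm f)%E ->
         forall z : R[i], disk z -> f z = 0)].
Proof.
split=> [q q1|].
  split=> f bf.
    have le1 := bloch_le_besov1 q1 bf.
    split=> //; first exact: (besov_in_bloch q1 bf).
    exact: le_trans le1 (besov1_le_besov2 q1 bf).
  (* The [B^q] norm of the first kind lies between the two sides of the second inequality, so
     equality there forces equality in the first. *)
  move=> E; have {E}E : bloch_norm f = besov_norm1 q f.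
    case: E => // E; apply/eqP; rewrite eq_le (bloch_le_besov1 q1 bf)/= E.
    exact: (besov1_le_besov2 q1 bf).
  have [lam [be [a [da fE]]]] := besov_bloch_extremal q1 bf E.
  (* [moebius 0 z = - z] gives the affine form; otherwise [zeta = a] and [gamma = - lam] by partial
     fractions. *)
  have [a0|a0] := eqVneq a 0.
    left; exists (- lam), be => z dz.
    rewrite fE// a0 moebius0 mulrN mulNr; exact: erefl.
  right; exists (- lam), (lam * (1 / a^*) + be), a; split.
    by apply/andP; split; [rewrite cmod_gt0|exact: da].
  move=> z dz; rewrite fE// moebius_partial_fraction// mulrBr 2!mulNr.
  by rewrite -[lam * _ * (1 / (1 - _))]mulrA addrAC [LHS]addrC.
split.
- by move=> f fB; split; [exact: besov1_in_bloch|exact: bloch_le_besov1_double].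
- by move=> k k2; exact: besov1_sharp.
- exact: besov1_extremal.
Qed.
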